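(* The discrete group $S^1$ (i.e. the abstract group $\mathbb{R}/\mathbb{Z}$, without topology) embeds in $\Gamma$: there is an injective group homomorphism $S^1\to\Gamma$.
   Context: $\Gamma$ denotes the mapping class group of the plane minus a Cantor set, i.e. the group of isotopy classes of orientation-preserving homeomorphisms of $\mathbb{R}^2\setminus K$, where $K\subset\mathbb{R}^2$ is a Cantor set. *)

(* Defs.v *)
From HB Require Import structures.
From mathcomp Require Import all_boot all_order all_algebra.
From mathcomp Require Import all_classical all_reals all_analysis.
From mathcomp Require Import lra.

Set Implicit Arguments.
Unset Strict Implicit.
Unset Printing Implicit Defensive.

Import Order.TTheory GRing.Theory Num.Theory numFieldNormedType.Exports.

Local Open Scope classical_set_scope.
Local Open Scope quotient_scope.
Local Open Scope ring_scope.

Record homeomorphism (X Y : topologicalType) := Homeomorphism {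
  homeo_fun :> X -> Y;
  homeo_inv : Y -> X;
  homeo_funK : cancel homeo_fun homeo_inv;
  homeo_invK : cancel homeo_inv homeo_fun;
  homeo_fun_continuous : continuous homeo_fun;
  homeo_inv_continuous : continuous homeo_inv }.

Lemma homeomorphismP (X Y : topologicalType) (f g : homeomorphism X Y) :
  f =1 g -> f = g.
Proof.
move: f g => [f f' fK f'K cf cf'] [g g' gK g'K cg cg'] /= /funext fg.
subst g; have f'g' : f' = g'.
  by apply/funext => y; apply: (can_inj fK); rewrite f'K g'K.
by subst g'; congr Homeomorphism; exact: Prop_irrelevance.
Qed.

Section HomeoGroup.
Variable X : topologicalType.

Definition Homeo := homeomorphism X X.

HB.instance Definition _ := gen_eqMixin Homeo.
HB.instance Definition _ := gen_choiceMixin Homeo.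

Definition homeo_id : Homeo :=
  @Homeomorphism X X id id (fun=> erefl) (fun=> erefl)
    (fun=> cvg_id) (fun=> cvg_id).

Definition homeo_inverse (f : Homeo) : Homeo :=
  Homeomorphism (@homeo_invK _ _ f) (@homeo_funK _ _ f)
    (@homeo_inv_continuous _ _ f) (@homeo_fun_continuous _ _ f).

Definition homeo_comp (f g : Homeo) : Homeo :=
  @Homeomorphism X X (f \o g) (homeo_inv g \o homeo_inv f)
    (can_comp (@homeo_funK _ _ f) (@homeo_funK _ _ g))
    (can_comp (@homeo_invK _ _ g) (@homeo_invK _ _ f))
    (fun x => continuous_comp (@homeo_fun_continuous _ _ g x)
                              (@homeo_fun_continuous _ _ f (g x)))
    (fun x => continuous_comp (@homeo_inv_continuous _ _ f x)
                              (@homeo_inv_continuous _ _ g (homeo_inv f x))).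

Lemma homeo_compA : associative homeo_comp.
Proof. by move=> f g h; apply: homeomorphismP. Qed.

Lemma homeo_comp1f : left_id homeo_id homeo_comp.
Proof. by move=> f; apply: homeomorphismP. Qed.

Lemma homeo_compf1 : right_id homeo_id homeo_comp.
Proof. by move=> f; apply: homeomorphismP. Qed.

Lemma homeo_compVf : left_inverse homeo_id homeo_inverse homeo_comp.
Proof. by move=> f; apply: homeomorphismP => x /=; exact: homeo_funK. Qed.

Lemma homeo_compfV : right_inverse homeo_id homeo_inverse homeo_comp.
Proof. by move=> f; apply: homeomorphismP => x /=; exact: homeo_invK. Qed.

HB.instance Definition _ := isGroup.Build Homeo
  homeo_compA homeo_comp1f homeo_compf1 homeo_compVf homeo_compfV.

End HomeoGroup.

Section MappingClassGroup.
Variables (R : realType) (U : set (R * R)).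

(* [gamma], restricted to [0, 1], avoids [p] and winds [n] times
   counterclockwise around it: [theta] is a continuous choice of argument of
   [gamma - p] whose total variation is [2 * pi * n]. *)
Definition winds (gamma : R -> R * R) (p : R * R) (n : int) : Prop :=
  exists r theta : R -> R,
    [/\ {within `[0, 1], continuous theta},
        forall t : R, 0 <= t <= 1 -> 0 < r t /\
          gamma t = (p.1 + r t * cos (theta t), p.2 + r t * sin (theta t))
      & theta 1 - theta 0 = 2 * pi * n%:~R].

(* The winding number identifies the local homology group H_2(U, U \ {x}),
   i.e. H_1(D \ {x}) for a small disc D around x, with the integers, compatibly
   with the standard orientation of the plane.  So for an open [U] the condition
   says that [f] maps the local orientation at each [x] to the one at [f x]. *)
Definition orientation_preserving (f : Homeo U) : Prop :=
  forall x : U, exists2 N : set U, nbhs x N &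
    forall gamma : R -> U,
      {within `[0, 1], continuous gamma} -> gamma 0 = gamma 1 ->
      (forall t : R, 0 <= t <= 1 -> N (gamma t) /\ gamma t <> x) ->
      forall n : int,
        winds (fun t => set_val (gamma t)) (set_val x) n <->
        winds (fun t => set_val (f (gamma t))) (set_val (f x)) n.

Definition is_orientation_preserving : pred (Homeo U) :=
  fun f => `[< orientation_preserving f >].

Lemma orientation_preserving_group : group_closed is_orientation_preserving.
Proof.
split=> [|f g /asboolP fP /asboolP gP]; apply/asboolP.
  by move=> x; exists setT => //; exact: filterT.
move=> x.
pose y := homeo_inv g x.
have gy : g y = x by exact: homeo_invK.
have [N Nx NP] := fP y; have [M My MP] := gP y.
exists (homeo_inv g @^-1` (N `&` M)).
  by apply: (@homeo_inv_continuous _ _ g x); exact: filterI.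
move=> gamma cgamma gamma01 gammaN n.
pose delta := homeo_inv g \o gamma.
have cdelta : {within `[0, 1], continuous delta}.
  apply: within_continuous_comp cgamma => z _.
  exact: homeo_inv_continuous.
have delta01 : delta 0 = delta 1 by rewrite /delta /= gamma01.
have deltay t : 0 <= t <= 1 -> delta t <> y.
  by move=> /gammaN[_ gx] dy; apply: gx; rewrite -gy -dy; exact/esym/homeo_invK.
have := NP delta cdelta delta01.
move=> /(_ (fun t t01 => conj (gammaN t t01).1.1 (deltay t t01))) /(_ n) fn.
have := MP delta cdelta delta01.
move=> /(_ (fun t t01 => conj (gammaN t t01).1.2 (deltay t t01))) /(_ n) gn.
have gdE t : g (delta t) = gamma t by exact: homeo_invK.
under [X in winds X]eq_fun do rewrite -gdE.
rewrite -{1}gy.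
by apply: iff_trans fn; apply: iff_sym.
Qed.

Record HomeoPlus := MkHomeoPlus {
  homeo_plus_val :> Homeo U;
  homeo_plusP : is_orientation_preserving homeo_plus_val }.

HB.instance Definition _ := [isSub for homeo_plus_val].
HB.instance Definition _ := [Choice of HomeoPlus by <:].
HB.instance Definition _ :=
  SubChoice_isSubGroup.Build _ _ HomeoPlus orientation_preserving_group.

(* The intermediate stages of an isotopy starting at an orientation-preserving
   homeomorphism are automatically orientation-preserving, so this is not
   required of [H t]. *)
Definition isotopic (f g : Homeo U) : Prop :=
  exists H : R -> Homeo U,
    [/\ H 0 = f, H 1 = g &
        {within [set p : R * U | 0 <= p.1 <= 1],
          continuous (fun p : R * U => H p.1 p.2)}].

Definition isotopicb : rel HomeoPlus := fun f g => `[< isotopic f g >].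

Lemma within_continuous_comp_homo (X Y Z : topologicalType) (A : set X)
    (B : set Y) (f : X -> Y) (g : Y -> Z) : (forall x, A x -> B (f x)) ->
  {within A, continuous f} -> {within B, continuous g} ->
  {within A, continuous (fun x => g (f x))}.
Proof.
move=> AB /subspace_continuousP cf /subspace_continuousP cg.
apply/subspace_continuousP => x Ax.
apply: cvg_trans (cg _ (AB _ Ax)) => V /= VB.
have xV : nbhs x [set z | A z -> B (f z) -> V (g (f z))] := cf _ Ax _ VB.
suff : nbhs x [set z | A z -> V (g (f z))] by [].
by apply: filterS xV => z Vz Az; exact: Vz Az (AB _ Az).
Qed.

Local Notation cylinder := [set p : R * U | 0 <= p.1 <= 1].

Lemma continuous_reparametrization (u : R -> R) : continuous u ->
  continuous (fun p : R * U => (u p.1, p.2)).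
Proof.
move=> cu p; apply: (@cvg_pair _ _ _ (nbhs p) (nbhs (u p.1)) (nbhs p.2) _ _ _
  (fun q : R * U => u q.1) snd); last exact: cvg_snd.
by apply: (cvg_comp _ _ cvg_fst); exact: cu.
Qed.

Lemma isotopic_refl f : isotopic f f.
Proof.
exists (fun=> f); split=> //; apply: continuous_subspaceT => p.
by apply: (cvg_comp _ _ cvg_snd); exact: homeo_fun_continuous.
Qed.

Lemma isotopic_sym f g : isotopic f g -> isotopic g f.
Proof.
move=> [H [H0 H1 cH]]; exists (fun t => H (1 - t)).
split; rewrite ?subr0 ?subrr //.
apply: (@within_continuous_comp_homo _ _ _ cylinder cylinder
  (fun p : R * U => (1 - p.1, p.2)) (fun p : R * U => H p.1 p.2)) => //.
  by move=> [t x] /= t01; lra.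
apply: continuous_subspaceT.
apply: (@continuous_reparametrization (fun t => 1 - t)).
by move=> t; apply: cvgB; [exact: cvg_cst|exact: cvg_id].
Qed.

Lemma isotopic_trans f g h : isotopic f g -> isotopic g h -> isotopic f h.
Proof.
move=> [F [F0 F1 cF]] [G [G0 G1 cG]].
pose H t := if t <= 2^-1 then F (2 * t) else G (2 * t - 1).
exists H; split.
- by rewrite /H mulr0 ifT //; lra.
- by rewrite /H ifF; [rewrite -G1; congr G; lra|lra].
have cfst : continuous (fst : R * U -> R) by move=> p; exact: cvg_fst.
pose A : set (R * U) :=
  fst @^-1` [set t | 0 <= t] `&` fst @^-1` [set t | t <= 2^-1].
pose B : set (R * U) :=
  fst @^-1` [set t | 2^-1 <= t] `&` fst @^-1` [set t | t <= 1].
have -> : cylinder = A `|` B.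
  apply/seteqP; split=> -[t x] /=.
    by move=> t01; have [t2|t2] := leP t 2^-1; [left|right]; split=> /=; lra.
  by move=> [] [] /= ? ?; lra.
apply: withinU_continuous.
- by apply: closedI; apply: (preimage_closed (fun p _ => cfst p));
    [exact: closed_ge|exact: closed_le].
- by apply: closedI; apply: (preimage_closed (fun p _ => cfst p));
    [exact: closed_ge|exact: closed_le].
- apply: (@subspace_eq_continuous _ A _ (fun p : R * U => F (2 * p.1) p.2)).
    move=> [t x]; rewrite inE => -[] /= t0 t2.
    by rewrite /from_subspace /H /= t2.
  apply: (@within_continuous_comp_homo _ _ _ A cylinder
    (fun p : R * U => (2 * p.1, p.2)) (fun p : R * U => F p.1 p.2)) => //.
    by move=> [t x] /= [] /= ? ?; lra.
  apply: continuous_subspaceT; apply: (@continuous_reparametrization ( *%R 2)).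
  by move=> t; apply: cvgM; [exact: cvg_cst|exact: cvg_id].
- apply: (@subspace_eq_continuous _ B _ (fun p : R * U => G (2 * p.1 - 1) p.2)).
    move=> [t x]; rewrite inE => -[] /= t2 t1; rewrite /from_subspace /H /=.
    case: ifPn => // t2'; have -> : t = 2^-1 by lra.
    by rewrite divff // subrr G0 F1.
  apply: (@within_continuous_comp_homo _ _ _ B cylinder
    (fun p : R * U => (2 * p.1 - 1, p.2)) (fun p : R * U => G p.1 p.2)) => //.
    by move=> [t x] /= [] /= ? ?; lra.
  apply: continuous_subspaceT.
  apply: (@continuous_reparametrization (fun t => 2 * t - 1)) => t.
  apply: cvgB; last exact: cvg_cst.
  by apply: cvgM; [exact: cvg_cst|exact: cvg_id].
Qed.

Lemma isotopic_mul (f f' g g' : Homeo U) :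
  isotopic f f' -> isotopic g g' -> isotopic (f * g)%g (f' * g')%g.
Proof.
move=> [F [<- <- cF]] [G [<- <- cG]].
exists (fun t => F t * G t)%g; split=> //.
apply: (@within_continuous_comp_homo _ _ _ cylinder cylinder
  (fun p : R * U => (p.1, G p.1 p.2)) (fun p : R * U => F p.1 p.2)) => //.
apply/subspace_continuousP => p cp.
apply: (@cvg_pair _ _ _ (within cylinder (nbhs p)) (nbhs p.1)
  (nbhs (G p.1 p.2)) _ _ _ (fun q : R * U => q.1) (fun q => G q.1 q.2)).
  move=> V pV; have {}pV : nbhs p (fst @^-1` V) by exact: cvg_fst pV.
  suff : nbhs p [set q | cylinder q -> V q.1] by [].
  by apply: filterS pV => q Vq _.
by move/subspace_continuousP: cG; exact.
Qed.

Lemma isotopic_inv (f g : Homeo U) : isotopic f g -> isotopic f^-1%g g^-1%g.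
Proof.
move=> fg; have := isotopic_mul (isotopic_refl f^-1%g)
  (isotopic_mul fg (isotopic_refl g^-1%g)).
by rewrite mulgV mulg1 mulgA mulVg mul1g => /isotopic_sym.
Qed.

Lemma isotopicb_equiv : equiv_class_of isotopicb.
Proof.
split=> [f|f g|g f h].
- by apply/asboolP; exact: isotopic_refl.
- by apply/asboolP/asboolP; exact: isotopic_sym.
- by move=> /asboolP fg /asboolP gh; apply/asboolP; exact: isotopic_trans gh.
Qed.

Canonical isotopicb_equivRel := EquivRelPack isotopicb_equiv.

Definition mapping_class_group := {eq_quot isotopicb}.

HB.instance Definition _ : EqQuotient HomeoPlus isotopicb mapping_class_group :=
  EqQuotient.on mapping_class_group.
HB.instance Definition _ := Choice.on mapping_class_group.

Local Notation Gamma := mapping_class_group.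

Definition mcg_one : Gamma := \pi_Gamma 1%g.
Definition mcg_inv (a : Gamma) : Gamma := \pi_Gamma (repr a)^-1%g.
Definition mcg_mul (a b : Gamma) : Gamma := \pi_Gamma (repr a * repr b)%g.

Lemma mcg_eqP (f g : HomeoPlus) :
  reflect (isotopic f g) (\pi_Gamma f == \pi_Gamma g).
Proof. by rewrite piE; exact: asboolP. Qed.

Lemma mcg_reprP (f : HomeoPlus) : isotopic (repr (\pi_Gamma f)) f.
Proof. by apply/mcg_eqP; rewrite reprK. Qed.

Lemma mcg_piM (f g : HomeoPlus) :
  \pi_Gamma (f * g)%g = mcg_mul (\pi_Gamma f) (\pi_Gamma g).
Proof.
by apply/eqP/mcg_eqP/isotopic_sym/isotopic_mul; exact: mcg_reprP.
Qed.

Lemma mcg_piV (f : HomeoPlus) : \pi_Gamma f^-1%g = mcg_inv (\pi_Gamma f).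
Proof. by apply/eqP/mcg_eqP/isotopic_sym/isotopic_inv; exact: mcg_reprP. Qed.

Lemma mcg_mulA : associative mcg_mul.
Proof.
move=> a b c; rewrite -[a]reprK -[b]reprK -[c]reprK.
move: (repr a) (repr b) (repr c) => f g h.
by rewrite -(mcg_piM g h) -(mcg_piM f g) -(mcg_piM f) -(mcg_piM _ h) mulgA.
Qed.

Lemma mcg_mul1 : left_id mcg_one mcg_mul.
Proof. by move=> a; rewrite -[a]reprK -mcg_piM mul1g. Qed.

Lemma mcg_mulr1 : right_id mcg_one mcg_mul.
Proof. by move=> a; rewrite -[a]reprK -mcg_piM mulg1. Qed.

Lemma mcg_mulV : left_inverse mcg_one mcg_inv mcg_mul.
Proof. by move=> a; rewrite -[a]reprK -mcg_piV -mcg_piM mulVg. Qed.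

Lemma mcg_mulrV : right_inverse mcg_one mcg_inv mcg_mul.
Proof. by move=> a; rewrite -[a]reprK -mcg_piV -mcg_piM mulgV. Qed.

HB.instance Definition _ := isGroup.Build mapping_class_group
  mcg_mulA mcg_mul1 mcg_mulr1 mcg_mulV mcg_mulrV.

End MappingClassGroup.

(* The empty space is [cantor_like] in the sense of the library, so we ask for a
   homeomorphism with the Cantor space instead. *)
Definition is_cantor_set (R : realType) (K : set (R * R)) : Prop :=
  inhabited (homeomorphism cantor_space K).

(* The additive group R/Z: [Num.int_num_subdef] is the predicate underlying
   [Num.int], to which the closure structures are attached. *)
Definition circle_group (R : realType) : zmodType :=
  @Quotient.quot R (@Num.int_num_subdef R : {pred R}).

(* Main.v *)
Require Import Defs.
From HB Require Import structures.
From mathcomp Require Import all_boot all_order all_algebra.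
From mathcomp Require Import finmap.
From mathcomp Require Import all_classical all_reals all_analysis.
From mathcomp Require Import ring lra zify.
From Stdlib Require List.

(** The circle group acts on the plane by homeomorphisms that preserve a given
    Cantor set [K], and no element except the identity acts by a map isotopic to
    the identity in the complement of [K].

    Model on the line.  The real line is a rational vector space; a Hamel basis
    containing 1 yields countably many additive functionals [R -> rat] separating
    the points, the first with value 1 at 1 and the others with value 0
    ([separating_functionals]).  They embed [R] into [Q * Q^N], which acts by
    order automorphisms on a countable dense order ([gapindex]); here 1 acts as
    the unit translation.  If [C] is a Cantor set in the open unit interval, the
    gaps of [C + Z] form a countable dense order, isomorphic to [gapindex] by
    back and forth, even compatibly with unit translations ([gap_system]).  So
    [R] permutes the gaps, and mapping each gap affinely onto its image extends to
    an action on the line that commutes with unit translations and preserves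
    [C + Z] ([circle_action]).  An element [x] fixing [C] modulo the integers
    translates every gap by an integer, which forces [x] to be an integer.

    From the line to the plane.  Dividing by [Z] gives an action of [R / Z] on the
    circle, and coning radially an action on the plane ([cone]); the Cantor set
    [C] becomes a Cantor set on the unit circle.

    From that Cantor set to [K].  All Cantor sets in the plane are equivalent under
    homeomorphisms of the plane, and what is needed is [circular_position]: some
    homeomorphism carries [K] into the upper half circle.  First [K] is made to
    project injectively to the first axis ([flatten_totally_split]); after
    rescaling, a shear given by a Tietze extension then puts it on the circle.
    The flattening is a limit of small homeomorphisms.  For each of them, cover
    [K] by the cells of a fine grid and fill the holes of the clusters of cells
    linked through [K]: the maximal filled clusters are disjoint and small, since
    [K] is totally disconnected ([polyomino_cover]).  Such a polyomino can be
    collapsed cell by cell ([collapsible_ex], by a discrete Jordan argument)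
    while pushing [K] along ([collapse_step]), until each point of [K] is interior
    to one cell ([grid_isolate]).  Squeezing the columns of cells to thin strips
    and shearing slightly, one can tell from the first coordinate alone in which
    cell a point lies ([grid_separate]).

    Injectivity.  All maps of the action are isotopic to the identity in the
    plane, whence orientation preserving.  Let [x] not be an integer.  Then [x]
    moves some point [q] of [K] to another point [p] of [K].  An ellipse avoiding
    [K] winds once around [p] and not around [q] ([ellipse_separates]).  Its image
    under [x] does not wind around the image [p] of [q] ([winds_isotopy]), so it
    is not homotopic to the ellipse in the complement of [p] ([winds_homotopy]).
    An isotopy in the complement of [K] would provide such a homotopy. *)

Set Implicit Arguments.
Unset Strict Implicit.
Unset Printing Implicit Defensive.
Import Order.TTheory GRing.Theory Num.Theory numFieldNormedType.Exports.
Local Open Scope classical_set_scope.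
Local Open Scope ring_scope.

(** * Polyominoes *)

Notation cell := (int * int)%type.

Definition adj (a b : cell) : bool :=
  ((a.1 == b.1) && ((a.2 == b.2 + 1) || (b.2 == a.2 + 1))) ||
  ((a.2 == b.2) && ((a.1 == b.1 + 1) || (b.1 == a.1 + 1))).

Lemma adj_sym a b : adj a b = adj b a.
Proof. by case: a b => [a1 a2] [b1 b2]; rewrite /adj /=; lia. Qed.

Lemma adj_neq a b : adj a b -> b != a.
Proof. by apply: contraTneq => ->; rewrite /adj; lia. Qed.

Lemma adj_h x y e : (e == 1) || (e == -1) -> adj (x, y) (x + e, y).
Proof. by rewrite /adj /=; lia. Qed.

Lemma adj_v x y e : (e == 1) || (e == -1) -> adj (x, y) (x, y + e).
Proof. by rewrite /adj /=; lia. Qed.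

Lemma adj_h1 (s : cell) : adj s (s.1 + 1, s.2).
Proof. by rewrite {1}[s]surjective_pairing adj_h. Qed.

Lemma adj_v1 (s : cell) : adj s (s.1, s.2 + 1).
Proof. by rewrite {1}[s]surjective_pairing adj_v. Qed.

Inductive reach (P : cell -> Prop) (a : cell) : cell -> Prop :=
| reach0 : P a -> reach P a a
| reachS b c : reach P a b -> adj b c -> P c -> reach P a c.

Lemma reach_start P a b : reach P a b -> P a.
Proof. by elim. Qed.

Lemma reach_end P a b : reach P a b -> P b.
Proof. by elim. Qed.

Lemma reach_sub (P P' : cell -> Prop) a b :
  (forall c, P c -> P' c) -> reach P a b -> reach P' a b.
Proof.
move=> PP'; elim=> [/PP'|b' c _ IH bc /PP' Pc]; first exact: reach0.
exact: reachS IH bc Pc.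
Qed.

Lemma reach_trans P a b c : reach P a b -> reach P b c -> reach P a c.
Proof. by move=> ab; elim=> // d e _ ad de Pe; exact: reachS ad de Pe. Qed.

Lemma reach1 P a b : P a -> P b -> adj a b -> reach P a b.
Proof. by move=> Pa Pb ab; apply: reachS ab Pb; exact: reach0. Qed.

Lemma reach_sym P a b : reach P a b -> reach P b a.
Proof.
elim=> [|b' c ab' IH b'c Pc]; first exact: reach0.
apply: reach_trans IH; apply: reach1 => //; first exact: reach_end ab'.
by rewrite adj_sym.
Qed.

Lemma reach_closed (P S : cell -> Prop) a b : reach P a b -> S a ->
  (forall c d, S c -> P c -> P d -> adj c d -> S d) -> S b.
Proof.
move=> ab Sa SP; elim: ab => // c d ac Sc cd Pd.
exact: SP Sc (reach_end ac) Pd cd.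
Qed.

Lemma reach_path P a b : reach P a b ->
  exists p : seq cell, [/\ path adj a p, last a p = b &
    forall c, c \in a :: p -> P c].
Proof.
elim=> [Pa|c d _ [p [ap lp Pp]] cd Pd].
  by exists [::]; split=> // c; rewrite inE => /eqP->.
exists (rcons p d); rewrite rcons_path ap lp last_rcons; split=> // e.
by rewrite -rcons_cons mem_rcons inE => /orP[/eqP->//|]; exact: Pp.
Qed.

Lemma reach_up (P : cell -> Prop) x y (n : nat) :
  (forall k : nat, (k <= n)%N -> P (x, y + k%:Z)) ->
  reach P (x, y) (x, y + n%:Z).
Proof.
elim: n => [|n IH] Pn.
  by have := Pn 0%N isT; rewrite addr0; exact: reach0.
apply: (@reachS _ _ (x, y + n%:Z)); last exact: Pn.
  by apply: IH => k kn; apply: Pn; exact: leqW.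
by rewrite /adj /=; lia.
Qed.

Section Polyomino.
Local Open Scope fset_scope.
Local Open Scope ring_scope.
Implicit Types (Q F G : {fset cell}) (a b c d s t r q : cell).

Local Notation inside Q := (fun c => c \in Q).
Local Notation outside Q := (fun c => c \notin Q).

(** Lying beyond all rows of [Q] stands for being near infinity. *)
Definition far Q c : Prop :=
  (forall q, q \in Q -> c.2 < q.2) \/ (forall q, q \in Q -> q.2 < c.2).

(** The complement of [Q] has no bounded component. *)
Definition filled Q : Prop :=
  forall c, c \notin Q -> exists2 c', far Q c' & reach (outside Q) c c'.

Definition polyconn Q : Prop :=
  forall a b, a \in Q -> b \in Q -> reach (inside Q) a b.

Lemma far_sub Q Q' c : Q' `<=` Q -> far Q c -> far Q' c.
Proof.
by move=> /fsubsetP sQ [] f; [left|right] => q /sQ; exact: f.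
Qed.

(** A vertical step that crosses the horizontal ray issuing from the lower side
    of [c] to the left.  The parity of such steps in a loop is its winding number
    around [c] modulo 2. *)
Definition ray_step c a b : bool :=
  [&& a.1 == b.1, a.1 < c.1 & Num.max a.2 b.2 == c.2].

Fixpoint ray_parity c a (p : seq cell) : bool :=
  if p is b :: p' then ray_step c a b (+) ray_parity c b p' else false.

(** The parities differ by a telescoping sum: a step counts for exactly one of
    the two rays if it enters or leaves the part of the row of [c] to the left
    of [c]. *)
Lemma ray_parity_up c a p : path adj a p -> c \notin a :: p ->
  ray_parity c a p (+) ray_parity (c.1, c.2 + 1) a p =
  ((a.2 == c.2) && (a.1 < c.1)) (+)
  (((last a p).2 == c.2) && ((last a p).1 < c.1)).
Proof.
elim: p a => [|b p IH] a /=; first by rewrite addbb.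
move=> /andP[ab bp]; rewrite inE negb_or => /andP[ca cbp].
have cb : c != b by move: cbp; rewrite inE negb_or => /andP[].
have {IH} := IH b bp cbp.
have : ray_step c a b (+) ray_step (c.1, c.2 + 1) a b =
    ((a.2 == c.2) && (a.1 < c.1)) (+) ((b.2 == c.2) && (b.1 < c.1)).
  move: ab ca cb; rewrite /ray_step /adj.
  case: a b c {bp cbp} => [a1 a2] [b1 b2] [c1 c2] /=.
  rewrite /Num.max !xpair_eqE; case: ifP; lia.
move: (ray_step _ _ _) (ray_step _ _ _) (ray_parity _ _ _) (ray_parity _ _ _).
move: ((a.2 == _) && _) ((b.2 == _) && _) (((last _ _).2 == _) && _).
by do 7![case].
Qed.

(** Only a vertical step through [c] itself could make a difference. *)
Lemma ray_parity_right c a p : path adj a p -> c \notin a :: p ->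
  ray_parity (c.1 + 1, c.2) a p = ray_parity c a p.
Proof.
elim: p a => [//|b p IH] a /= /andP[ab bp].
rewrite inE negb_or => /andP[ca cbp].
have cb : c != b by move: cbp; rewrite inE negb_or => /andP[].
rewrite IH //; congr (_ (+) _); move: ab ca cb.
rewrite /ray_step /adj.
case: a b c {IH bp cbp} => [a1 a2] [b1 b2] [c1 c2] /=.
rewrite /Num.max !xpair_eqE; case: ifP; lia.
Qed.

Lemma ray_parity_adj c d a p : path adj a p -> last a p = a ->
  c \notin a :: p -> d \notin a :: p -> adj c d ->
  ray_parity c a p = ray_parity d a p.
Proof.
move=> ap la ca da cd.
have up e : e \notin a :: p ->
    ray_parity e a p = ray_parity (e.1, e.2 + 1) a p.
  move=> ea; have := ray_parity_up ap ea; rewrite la addbb.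
  by case: ray_parity; case: ray_parity.
have : [|| d == (c.1, c.2 + 1), c == (d.1, d.2 + 1), d == (c.1 + 1, c.2) |
           c == (d.1 + 1, d.2)].
  by case: c d {ca da} cd => [c1 c2] [d1 d2]; rewrite /adj !xpair_eqE /=; lia.
case/or4P=> /eqP E.
- by rewrite E -up.
- by rewrite E -up.
- by rewrite E ray_parity_right.
- by rewrite E ray_parity_right.
Qed.

Lemma ray_parity_far Q c a p : path adj a p ->
  (forall b, b \in a :: p -> b \in Q) -> far Q c -> ray_parity c a p = false.
Proof.
elim: p a => [//|b p IH] a /= /andP[ab bp] Q_ fc.
rewrite IH //; last by move=> e be; apply: Q_; rewrite inE be orbT.
rewrite addbF.
have aQ : a \in Q by apply: Q_; rewrite inE eqxx.
have bQ : b \in Q by apply: Q_; rewrite !inE eqxx orbT.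
rewrite /ray_step /Num.max; case: fc => f; have := f _ aQ; have := f _ bQ;
  case: ifP; case: a b c {f IH ab bp Q_ aQ bQ} => [a1 a2] [b1 b2] [c1 c2] /=;
  lia.
Qed.

Definition lowest_left Q s : Prop := s \in Q /\
  forall q, q \in Q -> s.2 < q.2 \/ (s.2 = q.2 /\ s.1 <= q.1).

(** A discrete Jordan theorem.  Such a path closes up through [s] to a loop.  Its
    parity at the missing diagonal cell is odd: since no cell of [Q] is lower than
    [s], or left of it in the same row, the loop crosses the ray only next to [s].
    But the parity is constant along a path outside [Q] from the diagonal cell to
    infinity, where it vanishes. *)
Lemma corner_cut Q s : filled Q -> lowest_left Q s ->
  (s.1 + 1, s.2 + 1) \notin Q ->
  ~ reach (inside (Q `\ s)) (s.1, s.2 + 1) (s.1 + 1, s.2).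
Proof.
move=> fQ [sQ sl] dQ /reach_path[p [tp lp pQ]].
set t := (s.1, s.2 + 1) in tp lp pQ; set r := (s.1 + 1, s.2) in lp.
set d := (s.1 + 1, s.2 + 1) in dQ.
pose L := rcons (t :: p) s.
have sL : path adj s L.
  rewrite /L /= rcons_path tp lp /=.
  by rewrite /adj /t /r /=; lia.
have lL : last s L = s by rewrite /L last_rcons.
have LQ c : c \in s :: L -> c \in Q.
  rewrite inE => /orP[/eqP->//|]; rewrite mem_rcons inE => /orP[/eqP->//|].
  by move=> /pQ; rewrite !inE => /andP[].
have [c' fc'] := fQ _ dQ.
move=> /(reach_closed (S := fun c => c \notin Q /\ ray_parity c s L)).
case.
- split=> //; rewrite /L /=.
  have -> : ray_step d s t.
    by rewrite /ray_step /d /t /Num.max /=; case: ifP; lia.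
  suff -> : ray_parity d t (rcons p s) = false by [].
  have rs : ray_step d r s = false by rewrite /ray_step /r /=; lia.
  have {sL lL LQ} : forall q, q \in t :: p -> q \in Q /\ q != s.
    by move=> q /pQ; rewrite !inE => /andP[].
  elim: p (t) lp tp {pQ L} => [|b p IH] a /= lp.
    by rewrite lp rs.
  move=> /andP[ab bp] Q_.
  rewrite IH //; last by move=> q qb; apply: Q_; rewrite inE qb orbT.
  have [aQ as_] := Q_ a (mem_head _ _).
  have [bQ bs] : b \in Q /\ b != s by apply: Q_; rewrite !inE eqxx orbT.
  move: (sl _ aQ) (sl _ bQ) as_ bs ab; rewrite /ray_step /adj /d /Num.max.
  case: a b s {fQ sQ sl dQ rs IH bp Q_ aQ bQ lp t r d fc'}
    => [a1 a2] [b1 b2] [s1 s2] /=; rewrite !xpair_eqE addbF; case: ifP; lia.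
- move=> e f [eQ pe] _ fQ_ ef; split=> //.
  by rewrite -(@ray_parity_adj e) //; apply/negP => /LQ; apply/negP.
- by move=> _; rewrite (ray_parity_far sL LQ fc').
Qed.

(** The vector [e] is a direction in which [s] can be pushed into the rest of
    [Q].  In the last two conditions, a side of [s] behind the motion, or parallel
    to it, is one that no point of [s] in the interior of [Q] can lie on. *)
Definition collapsible Q s : Prop := exists e : int * int,
  [/\ (e.1 \in [:: -1; 0; 1]) && (e.2 \in [:: -1; 0; 1]) && (e != (0, 0)),
      forall a b : int, a \in [:: 0; e.1] -> b \in [:: 0; e.2] ->
        (s.1 + a, s.2 + b) \in Q,
      if e.1 == 0 then ((s.1 + 1, s.2) \notin Q) && ((s.1 - 1, s.2) \notin Q)
      else (s.1 - e.1, s.2) \notin Q &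
      if e.2 == 0 then ((s.1, s.2 + 1) \notin Q) && ((s.1, s.2 - 1) \notin Q)
      else (s.1, s.2 - e.2) \notin Q].

Lemma adj_cases s n : adj s n -> [\/ n = (s.1 + 1, s.2), n = (s.1 - 1, s.2),
  n = (s.1, s.2 + 1) | n = (s.1, s.2 - 1)].
Proof.
case: s n => [s1 s2] [n1 n2] /=; rewrite /adj /= => sn.
have : [|| (n1, n2) == (s1 + 1, s2), (n1, n2) == (s1 - 1, s2),
  (n1, n2) == (s1, s2 + 1) | (n1, n2) == (s1, s2 - 1)].
  by rewrite !xpair_eqE; lia.
by case/or4P=> /eqP ->; [apply: Or41|apply: Or42|apply: Or43|apply: Or44].
Qed.

(** Up to symmetry the neighbours of [s] in [Q] are ahead of the motion, and
    they are joined through the diagonal cell. *)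
Lemma collapse_nbrs Q s n m : collapsible Q s -> adj s n -> adj s m ->
  n \in Q -> m \in Q -> reach (inside (Q `\ s)) n m.
Proof.
move=> [[e1 e2] /= [he A B1 B2]] sn sm nQ mQ.
have he1 : e1 != 0 -> (e1 == 1) || (e1 == -1).
  by move: he; rewrite !inE; clear; lia.
have he2 : e2 != 0 -> (e2 == 1) || (e2 == -1).
  by move: he; rewrite !inE; clear; lia.
have nbr q : adj s q -> q \in Q ->
    (e1 != 0 /\ q = (s.1 + e1, s.2)) \/ (e2 != 0 /\ q = (s.1, s.2 + e2)).
  move=> sq; case: (adj_cases sq) => -> qQ; move: B1 B2.
  - case: ifP => [_|/negbT e10]; first by rewrite qQ.
    move=> h _; left; split=> //; case/orP: (he1 e10) h => /eqP -> //.
    by rewrite opprK qQ.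
  - case: ifP => [_|/negbT e10]; first by rewrite qQ andbF.
    by move=> h _; left; split=> //; case/orP: (he1 e10) h => /eqP -> //; rewrite qQ.
  - move=> _; case: ifP => [_|/negbT e20]; first by rewrite qQ.
    move=> h; right; split=> //; case/orP: (he2 e20) h => /eqP -> //.
    by rewrite opprK qQ.
  - move=> _; case: ifP => [_|/negbT e20]; first by rewrite qQ andbF.
    by move=> h; right; split=> //; case/orP: (he2 e20) h => /eqP -> //; rewrite qQ.
have in_ q : adj s q -> q \in Q -> q \in Q `\ s.
  by move=> /adj_neq qs qQ; rewrite !inE qs.
have hm : (s.1 + e1, s.2) \in Q by have := A e1 0; rewrite addr0; apply; rewrite !inE eqxx ?orbT.
have vm : (s.1, s.2 + e2) \in Q by have := A 0 e2; rewrite addr0; apply; rewrite !inE eqxx ?orbT.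
have nm : e1 != 0 -> e2 != 0 ->
    reach (inside (Q `\ s)) (s.1 + e1, s.2) (s.1, s.2 + e2).
  move=> e10 e20.
  have dQ : (s.1 + e1, s.2 + e2) \in Q `\ s.
    rewrite in_fsetD1 A ?inE ?eqxx ?orbT // andbT [s in _ != s]surjective_pairing.
    by rewrite xpair_eqE -[X in _ == X]addr0 (inj_eq (addrI _)) (negPf e10).
  have sh : adj s (s.1 + e1, s.2) by rewrite {1}[s]surjective_pairing adj_h ?he1.
  have sv : adj s (s.1, s.2 + e2) by rewrite {1}[s]surjective_pairing adj_v ?he2.
  apply: (@reachS _ _ (s.1 + e1, s.2 + e2)); last exact: in_.
    by apply: reach1; [exact: in_|exact: dQ|exact: adj_v (he2 e20)].
  by rewrite adj_sym; exact: adj_h (he1 e10).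
have nin := in_ _ sn nQ; have min := in_ _ sm mQ.
case: (nbr _ sn nQ) nin => -[e0 ->]; case: (nbr _ sm mQ) min => -[e0' ->] _ nin.
- exact: reach0.
- exact: nm.
- by apply/reach_sym/nm.
- exact: reach0.
Qed.

Lemma collapse_polyconn Q s : polyconn Q -> collapsible Q s ->
  polyconn (Q `\ s).
Proof.
move=> cQ col a b; rewrite !inE => /andP[as_ aQ] /andP[bs bQ].
have aQs : a \in Q `\ s by rewrite !inE as_.
suff /(_ b (cQ a b aQ bQ)) : forall b, reach (inside Q) a b ->
    if b == s then exists n, [/\ adj s n, n \in Q & reach (inside (Q `\ s)) a n]
    else reach (inside (Q `\ s)) a b.
  by rewrite (negPf bs).
move=> {bs bQ} {}b; elim=> [_|c d ac IH cd dQ].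
  by rewrite (negPf as_); exact: reach0.
have [E|ds] := eqVneq d s.
  have cs : c != s by rewrite -E eq_sym adj_neq.
  exists c; split; [by rewrite adj_sym -E|exact: reach_end ac|].
  by move: IH; rewrite (negPf cs).
have dQs : d \in Q `\ s by rewrite !inE ds.
move: IH; case: eqVneq => [E [n [sn nQ an]]|cs ac'].
  apply: reach_trans an _; apply: collapse_nbrs => //.
  by rewrite -E.
exact: reachS ac' cd dQs.
Qed.

Lemma collapse_filled Q s : filled Q -> s \in Q -> collapsible Q s ->
  filled (Q `\ s).
Proof.
move=> fQ sQ col.
have sub : Q `\ s `<=` Q by exact: fsubD1set.
have out c : c \notin Q -> exists2 c', far (Q `\ s) c' &
    reach (outside (Q `\ s)) c c'.
  move=> /fQ[c' fc cc']; exists c'; first exact: far_sub fc.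
  apply: reach_sub cc' => x xQ; rewrite !inE negb_and; rewrite xQ orbT //.
move=> c; rewrite !inE negb_and negbK => /orP[/eqP->|]; last exact: out.
have [n sn nQ] : exists2 n, adj s n & n \notin Q.
  case: col => -[e1 e2] /= [he _ B1 _]; move: B1; case: ifP => [_ /andP[+ _]|e0].
    by exists (s.1 + 1, s.2) => //; exact: adj_h1.
  exists (s.1 - e1, s.2) => //; rewrite {1}[s]surjective_pairing adj_h //.
  by move: he e0; rewrite !inE; clear; lia.
have [c' fc nc'] := out _ nQ; exists c' => //.
apply: reach_trans nc'; apply: reach1 => //.
- by rewrite !inE eqxx.
- by rewrite !inE negb_and nQ orbT.
Qed.

Definition opp (c : cell) : cell := (- c.1, - c.2).

Lemma oppK : involutive opp.
Proof. by move=> [a b]; rewrite /opp /= !opprK. Qed.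

Definition fopp Q : {fset cell} := [fset opp c | c in Q].

Lemma mem_fopp Q c : (c \in fopp Q) = (opp c \in Q).
Proof.
apply/imfsetP/idP => [[d dQ ->]|cQ]; first by rewrite oppK.
by exists (opp c); rewrite ?oppK.
Qed.

Lemma card_fopp Q : #|` fopp Q| = #|` Q|.
Proof. by apply: card_imfset; exact: can_inj oppK. Qed.

Lemma adj_opp a b : adj (opp a) (opp b) = adj a b.
Proof. by case: a b => [a1 a2] [b1 b2]; rewrite /adj /opp /=; lia. Qed.

Lemma reach_opp (P : cell -> Prop) a b :
  reach P a b -> reach (P \o opp) (opp a) (opp b).
Proof.
elim=> [Pa|c d _ IH cd Pd]; first by apply: reach0; rewrite /= oppK.
by apply: (reachS IH _ _); rewrite /= ?oppK ?adj_opp.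
Qed.

Lemma polyconn_opp Q : polyconn Q -> polyconn (fopp Q).
Proof.
move=> cQ a b; rewrite !mem_fopp => aQ bQ.
rewrite -[a]oppK -[b]oppK; have := reach_opp (cQ _ _ aQ bQ).
by apply: reach_sub => c /=; rewrite mem_fopp.
Qed.

Lemma filled_opp Q : filled Q -> filled (fopp Q).
Proof.
move=> fQ c; rewrite mem_fopp => /fQ[c' fc cc']; exists (opp c').
  case: fc => fc; [right|left] => q; rewrite mem_fopp => /fc /=;
    by rewrite /opp /=; lia.
rewrite -[c]oppK; have := reach_opp cc'.
by apply: reach_sub => d /=; rewrite mem_fopp.
Qed.

Lemma collapsible_opp Q s : collapsible (fopp Q) (opp s) -> collapsible Q s.
Proof.
move=> [[e1 e2] [/= he A B1 B2]]; exists (- e1, - e2); split=> /=.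
- by move: he; rewrite !inE !xpair_eqE; lia.
- move=> a b; rewrite !inE => ha hb.
  have := A (- a) (- b); rewrite !inE mem_fopp /opp /= -!opprD !opprK.
  by apply; lia.
- move: B1; rewrite oppr_eq0; case: ifP => _; rewrite !mem_fopp /opp /=.
    by rewrite !opprD !opprK andbC.
  by rewrite opprD !opprK.
- move: B2; rewrite oppr_eq0; case: ifP => _; rewrite !mem_fopp /opp /=.
    by rewrite !opprD !opprK andbC.
  by rewrite opprD !opprK.
Qed.

Lemma lowest_left_ex Q : Q != fset0 -> exists s, lowest_left Q s.
Proof.
have [n] := ubnP #|` Q|; elim: n Q => // n IH Q lt Q0.
have [q qQ] : exists q : cell, q \in Q by exact/fset0Pn.
have [E|Qq0] := eqVneq (Q `\ q) fset0.
  exists q; split=> // r rQ; right; suff -> : r = q by [].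
  by apply/eqP; apply: contraT => rq; move: (in_fset0 r); rewrite -E !inE rq rQ.
have := cardfsD1 q Q; rewrite qQ => cQ.
have [|s [sQ sl]] := IH (Q `\ q) _ Qq0; first by lia.
have sQ' : s \in Q by move: sQ; rewrite !inE => /andP[].
have [h|h] : (s.2 < q.2 \/ (s.2 = q.2 /\ s.1 <= q.1)) \/
          (q.2 < s.2 \/ (s.2 = q.2 /\ q.1 <= s.1)) by lia.
  exists s; split=> // r rQ; have [->//|rq] := eqVneq r q.
  by apply: sl; rewrite !inE rq.
exists q; split=> // r rQ; have [->|rq] := eqVneq r q; first by right.
have := sl r; rewrite !inE rq rQ => /(_ isT); lia.
Qed.

Lemma reach_nbr Q s b : reach (inside Q) s b -> b != s ->
  exists2 n, adj s n & n \in Q.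
Proof.
elim=> [_|c d sc IH cd dQ ds]; first by rewrite eqxx.
have [E|cs] := eqVneq c s; last exact: IH.
by exists d; rewrite // -E.
Qed.

(** A lowest left cell [s] has no neighbours below and to the left, hence is
    collapsible unless both other neighbours are present but the diagonal cell
    between them is missing.  In that case [corner_cut] shows that removing [s]
    separates these neighbours.  One of the two parts does not contain the cell
    [root]; with [s] added it is a smaller filled polyomino, so by induction it
    has a collapsible cell other than [s], which is collapsible in [Q] as well.
    The cell [root] to be avoided is there for this induction; if it is the lowest
    left cell, start from the highest right one. *)
Lemma collapsible_ex Q root : filled Q -> polyconn Q -> (1 < #|` Q|)%N ->
  exists s, [/\ s \in Q, s != root & collapsible Q s].
Proof.
have [n] := ubnP #|` Q|; elim: n Q root => // n IH Q root lt fQ cQ Q1.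
have corner P root' s : filled P -> polyconn P -> (1 < #|` P|)%N ->
    (#|` P| < n.+1)%N -> lowest_left P s -> s != root' ->
    exists s, [/\ s \in P, s != root' & collapsible P s].
  move=> {root lt Q fQ cQ Q1} fQ cQ Q1 lt lls sroot.
  have [sQ sl] := lls.
  have lQ : (s.1 - 1, s.2) \notin P by apply/negP => /sl /=; lia.
  have bQ : (s.1, s.2 - 1) \notin P by apply/negP => /sl /=; lia.
  have [b bQs] : exists b : cell, b \in P `\ s.
    apply/fset0Pn; rewrite -cardfs_gt0; have := cardfsD1 s P; rewrite sQ; lia.
  move: bQs; rewrite !inE => /andP[bs bP].
  have [n' sn nP] := reach_nbr (cQ _ _ sQ bP) bs.
  have [tP|tP] := boolP ((s.1, s.2 + 1) \in P); last first.
    have rP : (s.1 + 1, s.2) \in P.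
      by case: (adj_cases sn) nP => ->; rewrite ?(negPf tP) ?(negPf lQ) ?(negPf bQ).
    exists s; split=> //; exists (1, 0); split=> //=; last by rewrite tP bQ.
    by move=> x y; rewrite !inE => /orP[]/eqP-> /orP[]/eqP->;
      rewrite ?addr0 // -surjective_pairing.
  have [rP|rP] := boolP ((s.1 + 1, s.2) \in P); last first.
    exists s; split=> //; exists (0, 1); split=> //=; last by rewrite rP lQ.
    by move=> x y; rewrite !inE => /orP[]/eqP-> /orP[]/eqP->;
      rewrite ?addr0 // -surjective_pairing.
  have [dP|dP] := boolP ((s.1 + 1, s.2 + 1) \in P).
    exists s; split=> //; exists (1, 1); split=> //=.
    by move=> x y; rewrite !inE => /orP[]/eqP-> /orP[]/eqP->;
      rewrite ?addr0 // -surjective_pairing.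
  have cut := corner_cut fQ lls dP.
  have part u u' : u \in P -> u' \in P -> adj s u -> adj s u' ->
      (forall c, adj s c -> c \in P -> c = u \/ c = u') ->
      adj u' (s.1 + 1, s.2 + 1) -> ~ reach (inside (P `\ s)) u u' ->
      ~ reach (inside (P `\ s)) u root' ->
      exists s, [/\ s \in P, s != root' & collapsible P s].
    move=> uP u'P su su' nbr u'd cut' nroot.
    (* the part [S] of the neighbour [u], closed up by [s] *)
    have ns u0 : adj s u0 -> u0 != s := @adj_neq s u0.
    pose S := [fset c in P `\ s | `[< reach (inside (P `\ s)) u c >]].
    have SE c : (c \in S) = `[< reach (inside (P `\ s)) u c >].
      rewrite 2!inE /=; apply: andb_idl => /asboolP /reach_end //.
    pose P' := s |` S.
    have P'E c : (c \in P') = (c == s) || (c \in S) by rewrite inE in_fset1.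
    have PP' : P' `<=` P.
      apply/fsubsetP => c; rewrite P'E SE => /orP[/eqP->//|/asboolP/reach_end].
      by rewrite inE => /andP[].
    have uS : u \in S.
      by rewrite SE; apply/asboolP/reach0; rewrite !inE uP ns.
    have u'S : u' \notin S by rewrite SE; apply/asboolP.
    have u'P' : u' \notin P' by rewrite P'E negb_or u'S ns.
    have ltP' : (#|` P'| < n)%N.
      rewrite -ltnS; apply: leq_trans lt; rewrite ltnS; apply: fproper_ltn_card.
      by rewrite fproperE PP'; apply/negP => /fsubsetP/(_ _ u'P); exact/negP.
    have P'1 : (1 < #|` P'|)%N.
      have : [fset s; u] `<=` P'.
        apply/fsubsetP => c; rewrite in_fset2 P'E => /orP[/eqP->|/eqP->].
          by rewrite eqxx.
        by rewrite uS orbT.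
      move=> /fsubset_leq_card; apply: leq_trans.
      by rewrite cardfs2 eq_sym ns.
    have reachS' c : reach (inside (P `\ s)) u c -> reach (inside P') u c.
      elim=> [_|e c' ue IH' ec c'P]; first by apply: reach0; rewrite P'E uS orbT.
      apply: (reachS IH' ec); rewrite P'E SE; apply/orP; right; apply/asboolP.
      exact: reachS ue ec c'P.
    have fromu c : c \in P' -> reach (inside P') u c.
      rewrite P'E => /orP[/eqP->|]; last by rewrite SE => /asboolP/reachS'.
      by apply: reach1; rewrite ?P'E ?uS ?eqxx ?orbT // adj_sym.
    have cP' : polyconn P'.
      by move=> c e cP eP; apply: reach_trans (fromu _ eP); exact/reach_sym/fromu.
    have split_ c : c \in P -> [\/ c = s, reach (inside (P `\ s)) u c |
        reach (inside (P `\ s)) u' c].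
      move=> /(cQ _ _ sQ); elim=> [_|e c' se IH' ec c'P]; first exact: Or31.
      have [->|c's] := eqVneq c' s; first exact: Or31.
      have c'Ps : c' \in P `\ s by rewrite !inE c's.
      case: IH' => [E|ue|u'e].
      - rewrite E in ec; case: (nbr _ ec c'P) => <-; [apply: Or32|apply: Or33];
          exact: reach0.
      - by apply: Or32; exact: reachS ue ec c'Ps.
      - by apply: Or33; exact: reachS u'e ec c'Ps.
    (* The cells of the other part escape through [u'] to the missing diagonal
       cell, which is outside [P] and so linked to infinity. *)
    have fP' : filled P'.
      have out c : c \notin P -> exists2 c', far P' c' & reach (outside P') c c'.
        move=> /fQ[c' fc cc']; exists c'; first exact: far_sub fc.
        by apply: reach_sub cc' => x; apply: contraNN => /(fsubsetP PP').
      move=> c cnP; have [cP|/out//] := boolP (c \in P).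
      have u'c : reach (inside (P `\ s)) u' c.
        case: (split_ _ cP) => // [E|uc]; move: cnP.
          by rewrite P'E E eqxx.
        by rewrite P'E SE asboolT // orbT.
      have [c' fc dc'] := out _ dP; exists c' => //.
      apply: reach_trans dc'; apply: (@reachS _ _ u') => //; last first.
        by apply: contraNN dP => /(fsubsetP PP').
      apply: reach_sym; elim: u'c => [_|e c'' u'e IH' ec c''P].
        exact: reach0.
      apply: (reachS IH' ec _); rewrite P'E negb_or SE; move: (c''P).
      rewrite in_fsetD1 => /andP[-> _] /=; apply/asboolP => uc; apply: cut'.
      by apply: reach_trans uc _; apply: reach_sym; exact: reachS u'e ec c''P.
    have [s' [s'P' s's [e [he A B1 B2]]]] := IH P' s ltP' fP' cP' P'1.
    have s'S : reach (inside (P `\ s)) u s'.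
      by move: s'P'; rewrite P'E (negPf s's) SE => /asboolP.
    (* Around a cell other than [s], the polyominoes [P'] and [P] agree. *)
    have same c : adj s' c -> (c \in P') = (c \in P).
      move=> s'c; apply/idP/idP => [/(fsubsetP PP')//|cP].
      rewrite P'E; case: eqVneq => //= cs; rewrite SE; apply/asboolP.
      by apply: (reachS s'S s'c _); rewrite !inE cs.
    exists s'; split; first exact: (fsubsetP PP').
      by apply: contra_notN nroot => /eqP <-.
    exists e; split=> //.
    - by move=> a c ha hc; apply: (fsubsetP PP'); exact: A.
    - move: B1; case: ifP => e1; rewrite !same //; clear -he e1; move: he e1;
        rewrite /adj !inE /=; lia.
    - move: B2; case: ifP => e2; rewrite !same //; clear -he e2; move: he e2;
        rewrite /adj !inE /=; lia.
  have st := adj_v1 s.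
  have sr := adj_h1 s.
  have nbr c : adj s c -> c \in P -> c = (s.1, s.2 + 1) \/ c = (s.1 + 1, s.2).
    move=> sc; case: (adj_cases sc) => -> cP; [by right| |by left|].
      by rewrite cP in lQ.
    by rewrite cP in bQ.
  have [troot|troot] :=
      pselect (reach (inside (P `\ s)) (s.1, s.2 + 1) root').
    apply: (part (s.1 + 1, s.2) (s.1, s.2 + 1)) => //.
    - by move=> c sc cP; case: (nbr _ sc cP); [right|left].
    - exact: (adj_h1 (_, _)).
    - by move=> /reach_sym.
    - by move=> rroot; apply: cut; apply: reach_trans troot (reach_sym rroot).
  apply: (part (s.1, s.2 + 1) (s.1 + 1, s.2)) => //.
  exact: (adj_v1 (_, _)).
have Q0 : Q != fset0 by rewrite -cardfs_gt0; lia.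
have [s ls] := lowest_left_ex Q0.
have [E|] := eqVneq s root; last exact: corner ls.
have Qo0 : fopp Q != fset0 by rewrite -cardfs_gt0 card_fopp; lia.
have [s' ls'] := lowest_left_ex Qo0.
have [|||||s'' [s''Q s''r /=]] := @corner (fopp Q) (opp root) s' _ _ _ _ ls'.
- exact: filled_opp.
- exact: polyconn_opp.
- by rewrite card_fopp.
- by rewrite card_fopp.
- apply/eqP => s'root; have := cardfs_gt0 (Q `\ s); have := cardfsD1 s Q; rewrite ls.1 => cQs.
  have -> : (0 < #|` Q `\ s|)%N by lia.
  move=> /esym Qs0; have [q] : exists q : cell, q \in Q `\ s by exact/fset0Pn.
  rewrite !inE => /andP[qs qQ].
  have := ls.2 _ qQ; have := ls'.2 (opp q); rewrite mem_fopp oppK => /(_ qQ).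
  rewrite s'root -E; move: qs; clear; case: q s => [q1 q2] [s1 s2].
  by rewrite /opp xpair_eqE /=; lia.
- rewrite -[s'']oppK => /collapsible_opp col; exists (opp s''); split=> //.
    by rewrite -mem_fopp.
  by apply: contraNneq s''r => <-; rewrite oppK.
Qed.

Definition exits Q c : Prop := exists2 c', far Q c' & reach (outside Q) c c'.

Lemma far_out Q c : far Q c -> c \notin Q.
Proof. by case=> f; apply/negP => /f; rewrite ltxx. Qed.

Lemma far_exits Q c : far Q c -> exits Q c.
Proof. by move=> fc; exists c => //; exact/reach0/far_out. Qed.

Lemma exits_out Q c : exits Q c -> c \notin Q.
Proof. by move=> [c' _ /reach_start]. Qed.

Lemma exits_adj Q c d : adj c d -> c \notin Q -> exits Q d -> exits Q c.
Proof.
move=> cd cQ [c' fc dc']; exists c' => //; apply: (reach_trans _ dc').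
by apply: reach1 => //; exact: reach_start dc'.
Qed.

Lemma exits_reach Q c d : reach (outside Q) c d -> exits Q d -> exits Q c.
Proof. by move=> cd [c' fc dc']; exists c' => //; exact: reach_trans cd dc'. Qed.

(** [F] is [Q] with its holes filled. *)
Definition is_fill F Q : Prop := forall c, c \in F <-> ~ exits Q c.

Section Fill.
Variables (F Q : {fset cell}).
Hypothesis FQ : is_fill F Q.

Lemma fill_sub : Q `<=` F.
Proof. by apply/fsubsetP => c cQ; apply/FQ => /exits_out; rewrite cQ. Qed.

Lemma fill_out c : c \notin F -> exits Q c.
Proof. by move=> /negP cF; apply: contrapT => h; exact/cF/FQ. Qed.

Lemma fill_far c : far Q c -> far F c.
Proof.
move=> [] f; [left|right] => d dF; rewrite real_ltNge ?num_real //;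
  apply/negP => h; apply: (iffLR (FQ d) dF); apply: far_exits;
  [left|right] => q /f; lia.
Qed.

Lemma fill_exits c : exits Q c -> exits F c.
Proof.
move=> [c' fc /reach_sym c'c]; exists c'; first exact: fill_far.
apply: reach_sym; elim: c'c => [c'Q|b d c'b IH bd dQ].
  by apply: reach0; apply/negP => /FQ; apply; exact: far_exits.
apply: (reachS IH bd); apply/negP => /FQ; apply; exists c' => //.
by apply: reach_sym; exact: reachS c'b bd dQ.
Qed.

Lemma fill_filled : filled F.
Proof. by move=> c /fill_out/fill_exits. Qed.

Lemma fill_reach c : Q != fset0 -> c \in F ->
  exists2 q, q \in Q & reach (inside F) c q.
Proof.
move=> Q0; have [n] : exists n : nat, forall q, q \in Q -> q.2 < c.2 + n%:Z.
  exists (\max_(q <- Q) absz (q.2 - c.2)).+1 => q qQ.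
  have : (absz (q.2 - c.2) <= \max_(q <- Q) absz (q.2 - c.2))%N.
    exact: (@leq_bigmax_seq _ _ xpredT (fun q : cell => absz (q.2 - c.2))).
  by move: (\max_(_ <- _) _) => n; clear; lia.
elim: n c => [|n IH] c cn cF.
  by exfalso; apply: (iffLR (FQ c) cF); apply: far_exits; right=> q /cn; lia.
have [cQ|cQ] := boolP (c \in Q); first by exists c => //; exact: reach0.
have cd := adj_v1 c.
have dF : (c.1, c.2 + 1) \in F.
  by apply/FQ => /(exits_adj cd cQ); exact: (iffLR (FQ c) cF).
have [q /cn /=|q qQ dq] := IH (c.1, c.2 + 1) _ dF; first by lia.
by exists q => //; apply: (reach_trans _ dq); exact: reach1.
Qed.

Lemma fill_polyconn : Q != fset0 -> polyconn Q -> polyconn F.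
Proof.
move=> Q0 cQ a b aF bF; have [q qQ aq] := fill_reach Q0 aF.
have [r rQ br] := fill_reach Q0 bF; apply: reach_trans aq _.
apply: (reach_trans _ (reach_sym br)).
by apply: reach_sub (cQ _ _ qQ rQ) => c; exact: (fsubsetP fill_sub).
Qed.
End Fill.

Lemma fill_laminar_sub Q1 Q2 F1 F2 q : is_fill F1 Q1 -> is_fill F2 Q2 ->
  polyconn Q2 -> (forall c, c \in Q1 -> c \notin Q2) ->
  q \in Q2 -> q \in F1 -> F2 `<=` F1.
Proof.
move=> fF1 fF2 cQ2 dis qQ qF.
have Q2F1 : Q2 `<=` F1.
  apply/fsubsetP => r rQ; apply/fF1 => er; apply: (iffLR (fF1 q) qF).
  apply: exits_reach er; apply: reach_sub (cQ2 _ _ qQ rQ) => c cQ.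
  by apply/negP => /dis; rewrite cQ.
apply/fsubsetP => c; apply: contraTT => /fill_out -/(_ _ fF1).
move=> /(fill_exits fF1)[c' fc cc']; apply/negP => /fF2; apply; exists c'.
  exact: far_sub fc.
by apply: reach_sub cc' => d; apply: contraNN; exact: (fsubsetP Q2F1).
Qed.

Lemma fill_ext F1 F2 Q1 Q2 : is_fill F1 Q1 -> is_fill F2 Q2 -> Q1 =i Q2 ->
  F1 = F2.
Proof.
move=> f1 f2 /fsetP E; move: E f2 => <- f2; apply/fsetP => c.
by apply/idP/idP => /[dup]; [move=> _ /f1 /f2|move=> _ /f2 /f1].
Qed.

(** If neither polyomino meets the filling of the other, a path in the first
    filling from a common cell to the first polyomino avoids the second polyomino
    and ends outside the second filling, so the common cell was not in it. *)
Lemma fill_laminar Q1 Q2 F1 F2 c : is_fill F1 Q1 -> is_fill F2 Q2 ->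
  polyconn Q1 -> polyconn Q2 -> Q1 != fset0 ->
  (forall c, c \in Q1 -> c \notin Q2) ->
  c \in F1 -> c \in F2 -> F1 `<=` F2 \/ F2 `<=` F1.
Proof.
move=> f1 f2 c1 c2 Q10 dis cF1 cF2.
have [[q qQ qF]|h1] := pselect (exists2 q, q \in Q2 & q \in F1).
  by right; exact: fill_laminar_sub f1 f2 c2 dis qQ qF.
have [[q qQ qF]|h2] := pselect (exists2 q, q \in Q1 & q \in F2).
  left; apply: fill_laminar_sub f2 f1 c1 _ qQ qF => d dQ.
  by apply/negP => /dis; rewrite dQ.
have [q qQ cq] := fill_reach f1 Q10 cF1.
exfalso; apply: (iffLR (f2 c) cF2); apply: (@exits_reach _ _ q).
  by apply: reach_sub cq => d dF; apply/negP => dQ; apply: h1; exists d.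
apply: fill_out f2 _ _; apply/negP => qF; apply: h2; by exists q.
Qed.

Section Cover.
Variable touch : cell -> cell -> Prop.
Hypothesis touch_sym : forall c d, touch c d -> touch d c.

(** Two cells touch when they have a point of some given compact set in common;
    the clusters below are the components of that relation among the cells. *)
Inductive link a : cell -> Prop :=
| link0 : link a a
| linkS b c : link a b -> adj b c -> touch b c -> link a c.

Hypothesis touch_link : forall c d, touch c d -> link c d.

Lemma link_trans a b c : link a b -> link b c -> link a c.
Proof. by move=> ab; elim=> // d e _ ad de t; exact: linkS ad de t. Qed.

Lemma link_sym a b : link a b -> link b a.
Proof.
elim=> [|c d _ IH cd t]; first exact: link0.
apply: link_trans IH; apply: linkS (link0 _) _ (touch_sym t).
by rewrite adj_sym.
Qed.

Variable M : nat.
Hypothesis link_bounded : forall a c, link a c ->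
  (absz (c.1 - a.1) <= M)%N /\ (absz (c.2 - a.2) <= M)%N.

Definition box a : seq cell :=
  [seq (a.1 + (i%:Z - M%:Z), a.2 + (j%:Z - M%:Z)) |
    i <- iota 0 M.*2.+1, j <- iota 0 M.*2.+1].

Lemma mem_box a c : (absz (c.1 - a.1) <= M)%N -> (absz (c.2 - a.2) <= M)%N ->
  c \in box a.
Proof.
move=> h1 h2; apply/allpairsP.
exists (absz (c.1 - a.1 + M%:Z), absz (c.2 - a.2 + M%:Z)).
rewrite !mem_iota /=; split; [lia|lia|].
rewrite [LHS]surjective_pairing; congr pair; lia.
Qed.

Lemma box_mem a c : c \in box a ->
  (absz (c.1 - a.1) <= M)%N /\ (absz (c.2 - a.2) <= M)%N.
Proof.
by move=> /allpairsP[[i j] [+ + ->]]; rewrite !mem_iota /=; clear; lia.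
Qed.

Definition cluster a : {fset cell} := [fset c in box a | `[< link a c >]].

Lemma clusterP a c : c \in cluster a <-> link a c.
Proof.
rewrite !inE /=; split=> [/andP[_ /asboolP]//|ac].
by apply/andP; split; [apply: mem_box; have [] := link_bounded ac|exact/asboolP].
Qed.

Definition shadow a : {fset cell} :=
  [fset c in box a | `[< ~ exits (cluster a) c >]].

Lemma shadowP a : is_fill (shadow a) (cluster a).
Proof.
move=> c; rewrite !inE /=; split=> [/andP[_ /asboolP]//|ce].
apply/andP; split; last exact/asboolP.
apply/negPn/negP => cbox; apply: ce.
have [h2|h2] := leqP (absz (c.2 - a.2)) M; last first.
  apply: far_exits; have [h|h] := ltP a.2 c.2; [right|left] => q;
    by move=> /clusterP/link_bounded; lia.
have h1 : (M < absz (c.1 - a.1))%N.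
  by rewrite ltnNge; apply: contraNN cbox => h1; exact: mem_box.
exists (c.1, c.2 + (M.*2.+1)%:Z).
  by right=> q /clusterP/link_bounded /=; lia.
rewrite {1}[c]surjective_pairing; apply: reach_up => k _.
by apply/negP => /clusterP/link_bounded /=; lia.
Qed.

Lemma cluster_self a : a \in cluster a.
Proof. by apply/clusterP; exact: link0. Qed.

Lemma cluster_neq0 a : cluster a != fset0.
Proof. by apply/fset0Pn; exists a; exact: cluster_self. Qed.

Lemma cluster_polyconn a : polyconn (cluster a).
Proof.
have from c : link a c -> reach (inside (cluster a)) a c.
  elim=> [|b d ab IH bd t]; first by apply: reach0; exact: cluster_self.
  by apply: (reachS IH bd _); apply/clusterP; exact: linkS ab bd t.
move=> c d /clusterP/from ac /clusterP/from ad.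
exact: reach_trans (reach_sym ac) ad.
Qed.

Lemma shadow_self a : a \in shadow a.
Proof. by apply: (fsubsetP (fill_sub (@shadowP a))); exact: cluster_self. Qed.

Lemma shadow_link a b c : link b c -> b \in shadow a -> c \in shadow a.
Proof.
move=> bc bF; elim: bc => // {c} c d _ cF cd t.
have [cQ|cQ] := boolP (c \in cluster a).
  apply: (fsubsetP (fill_sub (@shadowP a))); apply/clusterP.
  by move/clusterP: cQ => ac; exact: linkS ac cd t.
by apply/shadowP => /(exits_adj cd cQ); apply/shadowP.
Qed.

Lemma shadow_laminar a b c : c \in shadow a -> c \in shadow b ->
  shadow a `<=` shadow b \/ shadow b `<=` shadow a.
Proof.
move=> ca cb; have [ab|ab] := pselect (link a b).
  suff -> : shadow a = shadow b by left.
  apply: fill_ext (@shadowP a) (@shadowP b) _ => d; apply/idP/idP.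
    by move=> /clusterP ad; apply/clusterP; exact: link_trans (link_sym ab) ad.
  by move=> /clusterP bd; apply/clusterP; exact: link_trans ab bd.
apply: fill_laminar (@shadowP a) (@shadowP b) _ _ _ _ ca cb.
- exact: cluster_polyconn.
- exact: cluster_polyconn.
- exact: cluster_neq0.
- move=> d /clusterP ad; apply/negP => /clusterP bd; apply: ab.
  exact: link_trans ad (link_sym bd).
Qed.

(** The filled clusters are laminar, so the maximal ones are disjoint. *)
Lemma polyomino_cover (B : seq cell) : exists Fs : seq {fset cell},
  [/\ forall F, F \in Fs -> [/\ filled F, polyconn F, F != fset0,
        forall c d, touch c d -> c \in F -> d \in F &
        exists a, {subset F <= box a}],
      forall b, b \in B -> exists2 F, F \in Fs & b \in F &
      forall F G c, F \in Fs -> G \in Fs -> c \in F -> c \in G -> F = G].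
Proof.
pose S := [seq shadow b | b <- B].
pose maxi := fun F => all (fun G => (F `<=` G) ==> (G `<=` F)) S.
exists [seq F <- S | maxi F]; split.
- move=> F; rewrite mem_filter => /andP[_ /mapP[a _ ->]]; split.
  + exact: fill_filled (@shadowP a).
  + exact: fill_polyconn (@shadowP a) (cluster_neq0 a) (@cluster_polyconn a).
  + by apply/fset0Pn; exists a; exact: shadow_self.
  + by move=> c d /touch_link; exact: shadow_link.
  + by exists a => c; rewrite !inE => /andP[].
- move=> b bB; have bS : shadow b \in S by apply: map_f.
  have [F [FS bF Fm]] : exists F, [/\ F \in S, b \in F &
      forall G, G \in S -> b \in G -> (#|` G| <= #|` F|)%N].
    pose P n := has (fun G => (b \in G) && (#|` G| == n)%N) S.
    have exP : exists n, P n.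
      by exists #|` shadow b|; apply/hasP; exists (shadow b); rewrite ?shadow_self /=.
    have ubP n : P n -> (n <= \max_(G <- S) #|` G|)%N.
      move=> /hasP[G GS /andP[_ /eqP <-]].
      exact: (@leq_bigmax_seq _ _ xpredT (fun G : {fset cell} => #|` G|)).
    have [n /hasP[F FS /andP[bF /eqP Fn]] nm] := ex_maxnP exP ubP.
    exists F; split=> // G GS bG; rewrite Fn; apply: nm.
    by apply/hasP; exists G; rewrite ?bG /=.
  exists F => //; rewrite mem_filter FS andbT; apply/allP => G GS.
  apply/implyP => FG; have bG := fsubsetP FG _ bF.
  have /eqP -> // : F == G by rewrite eqEfcard FG Fm.
- move=> F G c; rewrite !mem_filter => /andP[/allP Fm FS] /andP[/allP Gm GS].
  have [/mapP[a _ Fa] /mapP[b _ Gb]] := (FS, GS) => cF cG.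
  apply/eqP; rewrite eqEfsubset.
  case: (@shadow_laminar a b c); rewrite -?Fa -?Gb // => FG; rewrite FG ?andbT.
    by have := Fm _ GS; rewrite FG.
  by have := Gm _ FS; rewrite FG.
Qed.
End Cover.
End Polyomino.

(** * Lipschitz homeomorphisms of the plane *)

Section PlaneMetric.
Variable R : realType.
Local Notation plane := (R * R)%type.
Implicit Types (p q : plane) (f g : plane -> plane).

Lemma plane_nbhsP p (A : set plane) :
  nbhs p A <-> exists2 d : R, 0 < d & forall q, `|p - q| < d -> A q.
Proof.
split=> [/(@nbhs_ballP R plane)[d /= d0 dA]|[d d0 dA]].
  by exists d => // q pq; apply: dA; rewrite -ball_normE.
by apply/(@nbhs_ballP R plane); exists d => // q; rewrite -ball_normE; exact: dA.
Qed.

Lemma plane_continuousP f p : {for p, continuous f} <->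
  forall e, 0 < e -> exists2 d, 0 < d & forall q, `|p - q| < d -> `|f p - f q| < e.
Proof.
split=> [/cvgrPdist_lt h e /h /plane_nbhsP//|h].
by apply/cvgrPdist_lt => e /h ?; rewrite nearE; exact/plane_nbhsP.
Qed.

Lemma plane_openP (A : set plane) : open A <->
  forall p, A p -> exists2 d : R, 0 < d & forall q, `|p - q| < d -> A q.
Proof.
rewrite openE; split=> h p /h => [/plane_nbhsP//|?]; exact/plane_nbhsP.
Qed.

Lemma plane_norm_lt p (e : R) : (`|p| < e) = (`|p.1| < e) && (`|p.2| < e).
Proof. by rewrite -gt_max. Qed.

Lemma plane_norm_le p (e : R) : (`|p| <= e) = (`|p.1| <= e) && (`|p.2| <= e).
Proof. by rewrite -ge_max. Qed.

Lemma plane_norm1 p : `|p.1| <= `|p|.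
Proof. by have := lexx `|p|; rewrite plane_norm_le => /andP[]. Qed.

Lemma plane_norm2 p : `|p.2| <= `|p|.
Proof. by have := lexx `|p|; rewrite plane_norm_le => /andP[]. Qed.

Lemma real_cauchy_limit (u e : nat -> R) :
  (forall eps, 0 < eps -> exists N, e N < eps) ->
  (forall n m, (n <= m)%N -> `|u m - u n| <= e n) ->
  exists l, forall n, `|l - u n| <= e n.
Proof.
move=> e0 ue.
have cu : cvgn u.
  apply/cauchy_cvgP/cauchy_exP => eps /e0[N eN].
  exists (u N); exists N => // m /= Nm.
  rewrite /ball /= distrC; exact: le_lt_trans (ue _ _ Nm) eN.
exists (limn u) => n; rewrite leNgt; apply/negP => h.
have d0 : 0 < `|limn u - u n| - e n by rewrite subr_gt0.
move/cvgrPdist_lt: cu => /(_ _ d0)[N _ hN].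
have := hN (maxn n N) (leq_maxr _ _).
have := ue n (maxn n N) (leq_maxl _ _).
have := ler_distD (u (maxn n N)) (limn u) (u n); lra.
Qed.

Lemma plane_cauchy_limit (u : nat -> plane) (e : nat -> R) :
  (forall eps, 0 < eps -> exists N, e N < eps) ->
  (forall n m, (n <= m)%N -> `|u m - u n| <= e n) ->
  exists l, forall n, `|l - u n| <= e n.
Proof.
move=> e0 ue.
have [|l1 h1] := real_cauchy_limit (u := fst \o u) e0.
  by move=> n m /ue; apply: le_trans; exact: plane_norm1 (u m - u n).
have [|l2 h2] := real_cauchy_limit (u := snd \o u) e0.
  by move=> n m /ue; apply: le_trans; exact: plane_norm2 (u m - u n).
by exists (l1, l2) => n; rewrite plane_norm_le; apply/andP; split; [exact: h1|exact: h2].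
Qed.

Definition lip (k : R) f : Prop := forall p q, `|f p - f q| <= k * `|p - q|.

Lemma lip_continuous k f : lip k f -> continuous f.
Proof.
move=> fk p; apply/plane_continuousP => e e0.
have k0 : 0 < `|k| + 1 by rewrite ltr_wpDl.
exists (e / (`|k| + 1)) => [|q]; first by rewrite divr_gt0.
rewrite ltr_pdivlMr // => h; apply: le_lt_trans h.
apply: le_trans (fk p q) _; rewrite mulrC ler_wpM2l //.
by apply: le_trans (ler_norm k) _; rewrite lerDl.
Qed.

(** Bi-Lipschitz maps, unlike mere homeomorphisms, transport uniform estimates
    both ways: how much a composite moves points, and how separated the pieces of
    a set are. *)
Definition bilip f g : Prop := [/\ cancel f g, cancel g f,
  exists2 k, 0 < k & lip k f & exists2 k, 0 < k & lip k g].

Lemma bilip_id : bilip id id.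
Proof. by split=> //; exists 1 => // p q; rewrite mul1r. Qed.

Lemma bilip_sym f g : bilip f g -> bilip g f.
Proof. by case. Qed.

Lemma bilip_comp f f' g g' : bilip f f' -> bilip g g' ->
  bilip (f \o g) (g' \o f').
Proof.
have lc k l u v : 0 < k -> lip k u -> lip l v -> lip (k * l) (u \o v).
  move=> k0 ku lv p q; apply: le_trans (ku _ _) _.
  by rewrite -mulrA ler_wpM2l ?lv // ltW.
move=> [fK f'K [k k0 fk] [k' k'0 f'k]] [gK g'K [l l0 gl] [l' l'0 g'l]].
split; [exact: can_comp|exact: can_comp| |].
- by exists (k * l); [rewrite mulr_gt0|exact: lc].
- by exists (l' * k'); [rewrite mulr_gt0|exact: lc].
Qed.

Lemma bilip_iter f g n : bilip f g -> bilip (iter n f) (iter n g).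
Proof.
move=> fg; elim: n => [|n IH]; first exact: bilip_id.
have := bilip_comp IH fg; congr bilip; apply/funext => p /=.
by rewrite -iterSr.
Qed.

(** The inverse image of [q] is the fixed point of the contraction [q - f]. *)
Lemma contraction_bilip (c : R) f : 0 <= c < 1 -> lip c f ->
  exists g, bilip (fun p => p + f p) g.
Proof.
move=> /andP[c0 c1] fc; have d0 : 0 < 1 - c by rewrite subr_gt0.
have low p q : (1 - c) * `|p - q| <= `|p + f p - (q + f q)|.
  have := fc p q; have := ler_normB (p + f p - (q + f q)) (f p - f q).
  have -> : p + f p - (q + f q) - (f p - f q) = p - q.
    by apply: (addIr (f p - f q)); rewrite subrK opprD addrACA.
  by lra.
have inj p q : p + f p = q + f q -> p = q.
  move=> E; have := low p q; rewrite E subrr normr0 pmulr_rle0 // => h.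
  by apply/eqP; rewrite -subr_eq0 -normr_le0.
have surj q : exists p, p + f p = q.
  pose u := fix u n := if n is n'.+1 then q - f (u n') else q.
  pose C := `|f q| / (1 - c).
  have C0 : 0 <= C by rewrite divr_ge0 // ltW.
  have u1 n : `|u n.+1 - u n| <= C * (c ^+ n - c ^+ n.+1).
    elim: n => [|n IH].
      rewrite /= expr0 expr1 /C divfK ?gt_eqF //.
      by rewrite addrAC subrr add0r normrN.
    have -> : u n.+2 - u n.+1 = f (u n) - f (u n.+1).
      have sh (a b : plane) : q - a - (q - b) = b - a.
        by rewrite opprB addrC addrA subrK.
      exact: sh.
    apply: le_trans (fc _ _) _; rewrite distrC.
    rewrite !exprS; apply: le_trans (ler_wpM2l c0 IH) _.
    by rewrite exprS; nra.
  have um n m : (n <= m)%N -> `|u m - u n| <= C * c ^+ n.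
    move=> nm; apply: (@le_trans _ _ (C * (c ^+ n - c ^+ m))); last first.
      by rewrite ler_wpM2l // gerBl exprn_ge0.
    move: nm => /subnK <-; elim: (m - n)%N => [|k IH].
      by rewrite add0n !subrr mulr0 normr0.
    have := ler_distD (u (k + n)%N) (u (k.+1 + n)%N) (u n).
    have := u1 (k + n)%N; rewrite -addSn; lra.
  have e0 eps : 0 < eps -> exists N, C * c ^+ N < eps.
    move=> eps0; have : (fun n => C * c ^+ n) @ \oo --> (C * 0 : R).
      by apply: cvgM; [exact: cvg_cst|apply: cvg_expr; rewrite ger0_norm].
    rewrite mulr0 => /cvgrPdist_lt/(_ _ eps0)[N _ hN].
    exists N; have := hN N (leqnn _); rewrite sub0r normrN.
    by move=> /(le_lt_trans (ler_norm _)).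
  have [l hl] := plane_cauchy_limit e0 um.
  exists l; apply/eqP; rewrite -subr_eq0 -normr_le0 leNgt; apply/negP => h0.
  have /e0[N hN] : 0 < `|l + f l - q| / 2 by rewrite divr_gt0.
  have E : l + f l - q = (l - u N.+1) + (f l - f (u N)).
    have sh (a b : plane) : l + a - q = l - (q - b) + (a - b).
      by rewrite opprB -[RHS]addrA [X in _ = l + X]addrC subrKA addrA.
    exact: sh.
  have h1 : `|l - u N.+1| <= C * c ^+ N.
    apply: le_trans (hl _) _; rewrite exprS mulrCA; apply: ler_piMl (ltW c1).
    by rewrite mulr_ge0 // exprn_ge0.
  have h2 : `|f l - f (u N)| <= C * c ^+ N.
    apply: le_trans (fc _ _) _; apply: le_trans (hl N).
    exact: ler_piMl (normr_ge0 _) (ltW c1).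
  have := ler_normD (l - u N.+1) (f l - f (u N)); rewrite -E.
  by lra.
have [g gP] := choice surj.
exists g; split=> //.
- by move=> p; apply: inj; rewrite gP.
- exists (1 + c); first by rewrite ltr_wpDr.
  move=> p q; have := fc p q; have := ler_normD (p - q) (f p - f q).
  by rewrite addrACA -opprD; lra.
- exists (1 - c)^-1; first by rewrite invr_gt0.
  move=> p q; rewrite mulrC ler_pdivlMr // mulrC.
  by have := low (g p) (g q); rewrite !gP.
Qed.
End PlaneMetric.

(** * Pushing a compact set along a vector *)

Section Push.
Variable R : realType.
Local Notation plane := (R * R)%type.
Implicit Types (p q w : plane) (C V T : set plane).

Lemma compact_collar T V : compact T -> open V -> T `<=` V ->
  exists2 r : R, 0 < r & forall t q, T t -> `|t - q| < r -> V q.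
Proof.
move=> cT oV TV.
have /compact_near_coveringP := cT.
move=> /(_ R (0 : R)^'+ (fun r t => forall q, `|t - q| < r -> V q)).
move=> /(_ _ _)[].
  move=> t Tt; have /plane_openP/(_ _ (TV _ Tt))[d d0 dV] := oV.
  exists ([set q | `|t - q| < d / 2], [set r : R | r < d / 2]) => /=.
    split; first by apply/plane_nbhsP; exists (d / 2) => //; rewrite divr_gt0.
    by apply: nbhs_right_lt; rewrite divr_gt0.
  move=> [q r] /= [tq rd] q' qq'; apply: dV.
  by have := ler_distD q t q'; lra.
move=> r /= r0 rV; exists (r / 2); first by rewrite divr_gt0.
have r2 : 0 < r / 2 by rewrite divr_gt0.
move=> t q Tt tq; apply: (rV (r / 2)) Tt _ tq => //.
by rewrite /ball /= sub0r normrN gtr0_norm //; lra.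
Qed.

Definition dist T p : R := inf [set `|p - t| | t in T].

Lemma dist_le T p t : T t -> dist T p <= `|p - t|.
Proof.
move=> Tt; apply: ge_inf; last by exists t.
by exists 0 => _ [s _ <-].
Qed.

Lemma dist_lip T p q : T !=set0 -> dist T p - dist T q <= `|p - q|.
Proof.
move=> [t0 Tt0]; rewrite lerBlDr -lerBlDl; apply: lb_le_inf.
  by exists `|q - t0|, t0.
move=> _ [t Tt <-]; have := dist_le p Tt; have := ler_distD q p t; lra.
Qed.

Lemma dist_lt T p (e : R) : T !=set0 -> dist T p < e ->
  exists2 t, T t & `|p - t| < e.
Proof.
move=> [t0 Tt0] h; apply: contrapT => hn; move: h; apply/negP.
rewrite -leNgt; apply: lb_le_inf; first by exists `|p - t0|, t0.
move=> _ [t Tt <-]; rewrite leNgt; apply/negP => h; apply: hn.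
by exists t.
Qed.

(** Points move only forward along [w], and within [V]; this controls the points
    outside the set that is to be transported. *)
Definition pushes w V (g : plane -> plane) p : Prop :=
  g p = p \/ exists2 m : R, 0 <= m &
    g p = p + m *: w /\ forall l, 0 <= l <= m -> V (p + l *: w).

(** Iterate a displacement by a small multiple of [w], cut off by the distance to
    the region swept by the compact set; for small multiples this displacement is
    a contraction, so the maps are invertible. *)
Lemma push_compact C w V : compact C -> open V ->
  (forall p l, C p -> 0 <= l <= 1 -> V (p + l *: w)) ->
  exists g g', [/\ bilip g g', forall p, ~ V p -> g p = p,
    forall p, C p -> g p = p + w & forall p, pushes w V g p].
Proof.
move=> cC oV CV.
have [C0|C0] := pselect (C !=set0); last first.
  exists id, id; split=> //; first exact: bilip_id.
    by move=> p Cp; exfalso; apply: C0; exists p.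
  by move=> p; left.
pose T := (fun x : plane * R => x.1 + x.2 *: w) @` (C `*` `[0, 1]).
have cT : compact T.
  apply: continuous_compact; last exact: compact_setX cC (@segment_compact R 0 1).
  apply: continuous_subspaceT => x; apply: cvgD; first exact: cvg_fst.
  by apply: cvgZr_tmp; exact: cvg_snd.
have TV : T `<=` V.
  by move=> t [[p l] /= [Cp]]; rewrite in_itv /= => l01 <-; exact: CV.
have T0 : T !=set0.
  have [p Cp] := C0; exists (p + 0 *: w), (p, 0); split=> //=.
  by rewrite in_itv /= lexx ler01.
have [r2 r20 rV] := compact_collar cT oV TV.
pose r := r2 / 2; have r0 : 0 < r by rewrite divr_gt0.
pose phi p : R := Num.max 0 (1 - dist T p / r).
have phi_ge0 p : 0 <= phi p by rewrite le_max lexx.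
have dist_ge0 p : 0 <= dist T p.
  apply: lb_le_inf; first by have [t Tt] := T0; exists `|p - t|, t.
  by move=> _ [t _ <-].
have phi_le1 p : phi p <= 1.
  by rewrite ge_max ler01 /= gerBl divr_ge0 // ltW.
have phi_lip p q : `|phi p - phi q| <= r^-1 * `|p - q|.
  wlog le : p q / phi q <= phi p => [h|].
    by have [|/ltW] := leP (phi q) (phi p) => /h //; rewrite distrC (distrC p).
  rewrite ger0_norm ?subr_ge0 //.
  have := dist_lip q p T0; rewrite distrC => d.
  have h : 0 <= r^-1 * (`|p - q| - (dist T q - dist T p)).
    by rewrite mulr_ge0 ?invr_ge0 ?subr_ge0 // ltW.
  have h' : 0 <= r^-1 * `|p - q| by rewrite mulr_ge0 ?invr_ge0 // ltW.
  move: h h'; rewrite /phi !maxEle; do 2 case: ifP => ?; lra.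
have phi_T p : T p -> phi p = 1.
  move=> Tp; rewrite /phi; suff -> : dist T p = 0 by rewrite mul0r subr0 maxEle ler01.
  by apply/eqP; rewrite eq_le dist_ge0 andbT -(normr0 plane) -(subrr p) dist_le.
have phi_V p l : 0 < phi p -> `|l *: w| <= r -> V (p + l *: w).
  rewrite lt_max ltxx /= subr_gt0 ltr_pdivrMr // mul1r => /(dist_lt T0)[t Tt pt] lw.
  apply: (rV t) => //; rewrite opprD addrA.
  have := ler_normB (t - p) (l *: w); rewrite distrC in pt; rewrite /r in lw pt.
  by lra.
have [N N0 Nw] : exists2 N : nat, (0 < N)%N & `|w| / N%:R <= r / 2.
  exists (Num.truncn (`|w| / (r / 2))).+1 => //.
  rewrite ler_pdivrMr // mulrC -ler_pdivrMr ?divr_gt0 //; apply: ltW.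
  exact: truncnS_gt.
have N0' : 0 < N%:R :> R by rewrite ltr0n.
pose s p := p + (phi p / N%:R) *: w.
have [s' ss'] : exists s', bilip s s'.
  apply: (contraction_bilip (c := 2^-1)); first lra.
  move=> p q; rewrite -scalerBl normrZ -mulrBl normrM (@ger0_norm _ N%:R^-1).
    rewrite -mulrA [_ * `|w|]mulrC.
    apply: le_trans (ler_pM _ _ (phi_lip p q) Nw) _ => //.
    have -> // : r^-1 * `|p - q| * (r / 2) = 2^-1 * `|p - q|.
    by field; rewrite gt_eqF.
  by rewrite invr_ge0 ltW.
exists (iter N s), (iter N s'); split.
- exact: bilip_iter.
- move=> p Vp; elim: (N) => //= n ->; rewrite /s.
  suff -> : phi p = 0 by rewrite mul0r scale0r addr0.
  apply/eqP; rewrite eq_le phi_ge0 andbT leNgt; apply/negP => /phi_V.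
  by move=> /(_ 0); rewrite scale0r normr0 addr0 => /(_ (ltW r0)).
- move=> p Cp.
  suff h n : (n <= N)%N -> iter n s p = p + (n%:R / N%:R) *: w.
    by rewrite h // divff ?scale1r // gt_eqF.
  elim: n => [_|n IH nN]; first by rewrite mul0r scale0r addr0.
  rewrite /= IH 1?ltnW // /s phi_T.
    by rewrite -addrA -scalerDl -mulrDl natr1.
  exists (p, n%:R / N%:R) => //=; split=> //=; rewrite in_itv /=.
  by rewrite divr_ge0 //= ler_pdivrMr // mul1r ler_nat ltnW.
- move=> p; elim: (N) => [|n IH]; first by left.
  have step q : pushes w V s q.
    have := phi_ge0 q; rewrite le_eqVlt => /orP[/eqP E|h].
      by left; rewrite /s -E mul0r scale0r addr0.
    right; exists (phi q / N%:R); first by rewrite divr_ge0 // ltW.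
    split=> // l /andP[l0 lN]; apply: phi_V => //.
    rewrite normrZ ger0_norm //; apply: le_trans (_ : `|w| / N%:R <= _).
      rewrite mulrC ler_wpM2l //; apply: le_trans lN _.
      by rewrite ler_piMl // invr_ge0 ltW.
    by move: Nw; lra.
  rewrite /pushes iterS; case: (step (iter n s p)) => [->|[m m0 [-> mV]]] //.
  case: IH mV => [->|[m' m'0 [-> m'V]] mV]; first by right; exists m.
  right; exists (m' + m); first exact: addr_ge0.
  split=> [|l /andP[l0 lm]]; first by rewrite scalerDl addrA.
  have [lm'|lm'] := leP l m'; first by apply: m'V; rewrite l0.
  have := mV (l - m'); rewrite -addrA -scalerDl (addrC m') subrK; apply.
  by rewrite subr_ge0 ltW //= lerBlDl.
Qed.
End Push.

(** * Collapsing a polyomino while pushing a compact set *)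

Section Cells.
Variable R : realType.
Local Notation plane := (R * R)%type.
Implicit Types (p q w : plane) (C V T : set plane) (Q : {fset cell}) (c s : cell).

Definition unit1 (k : int) (x : R) : bool := k%:~R <= x <= k%:~R + 1.

Definition in_cell c p : bool := unit1 c.1 p.1 && unit1 c.2 p.2.

(** Interior of the union of the cells of [Q]. *)
Definition region Q : set plane := [set p | forall c, in_cell c p -> c \in Q].

Lemma unit1_near (x : R) : exists2 d, 0 < d &
  forall y, `|x - y| < d -> forall k, unit1 k y -> unit1 k x.
Proof.
have : (Num.floor x)%:~R <= x < (Num.floor x)%:~R + 1.
  by rewrite ge_floor /= -intrD1 lt_succ_floor.
set k0 := Num.floor x => /andP[h1 h2].
have aux (d : R) : 0 < d -> d <= k0%:~R + 1 - x ->
    (d <= x - k0%:~R \/ (x = k0%:~R /\ d <= 1)) ->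
    forall y, `|x - y| < d -> forall k, unit1 k y -> unit1 k x.
  move=> d0 d1 d2 y; rewrite ltr_norml => /andP[y1 y2] k /andP[k1 k2].
  have kk0 : (k <= k0)%R.
    rewrite -ltzD1 -(ltr_int R) intrD1; apply: le_lt_trans k1 _; lra.
  case: d2 => [d2|[xk d2]].
    have k0k : (k0 <= k)%R.
      rewrite -ltzD1 -(ltr_int R) intrD1; apply: lt_le_trans k2; lra.
    have -> : k = k0 by apply/eqP; rewrite eq_le kk0.
    by rewrite /unit1 h1 ltW.
  have k0k : (k0 <= k + 1)%R.
    rewrite -ltzD1 -(ltr_int R) !intrD1; lra.
  move: kk0 k0k; rewrite -!(ler_int R) intrD1 /unit1 xk => -> ->//.
have [E|E] := eqVneq x k0%:~R.
  by exists 1 => //; apply: aux => //; [rewrite E; lra|right].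
have h3 : k0%:~R < x by rewrite lt_neqAle eq_sym E.
exists (Num.min (x - k0%:~R) (k0%:~R + 1 - x)).
  by rewrite lt_min !subr_gt0 h3.
apply: aux; first by rewrite lt_min !subr_gt0 h3.
  by rewrite ge_min lexx orbT.
by left; rewrite ge_min lexx.
Qed.

Lemma in_cell_near p : exists2 d, 0 < d &
  forall q, `|p - q| < d -> forall c, in_cell c q -> in_cell c p.
Proof.
have [d1 d10 h1] := unit1_near p.1; have [d2 d20 h2] := unit1_near p.2.
exists (Num.min d1 d2); first by rewrite lt_min d10.
move=> q; rewrite plane_norm_lt !lt_min => /andP[/andP[a _] /andP[_ b]] c.
by move=> /andP[c1 c2]; apply/andP; split; [exact: h1 a _ c1|exact: h2 b _ c2].
Qed.

Lemma region_open Q : open (region Q).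
Proof.
apply/plane_openP => p Qp; have [d d0 h] := in_cell_near p.
by exists d => // q /h pq c /pq /Qp.
Qed.

Lemma region_sub Q Q' : (Q `<=` Q')%fset -> region Q `<=` region Q'.
Proof. by move=> /fsubsetP s p Qp c /Qp /s. Qed.

Lemma in_cell_closed c : closed [set p | in_cell c p].
Proof.
rewrite -[X in closed X]setCK; apply: open_closedC; apply/plane_openP => p cp.
have [d d0 h] := in_cell_near p; exists d => // q pq /= cq; apply: cp.
exact: h pq _ cq.
Qed.

Lemma floor_cell p : in_cell (Num.floor p.1, Num.floor p.2) p.
Proof.
by rewrite /in_cell /unit1 /= !ge_floor -!intrD1 !ltW // lt_succ_floor.
Qed.

(** One coordinate of a push run backwards from a point of a cell: it stays in
    its interval, or first meets the end that lies behind the motion. *)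
Lemma back1 (s : int) (e k m q : R) : e = -1 \/ e = 0 \/ e = 1 -> 0 < k ->
  0 <= m -> unit1 s q ->
  (forall l, 0 <= l <= m -> unit1 s (q - l * (k * e))) \/
  exists2 l, 0 <= l <= m &
    (e = 1 /\ q - l * (k * e) = s%:~R \/ e = -1 /\ q - l * (k * e) = s%:~R + 1)
    /\ forall l', 0 <= l' <= l -> unit1 s (q - l' * (k * e)).
Proof.
rewrite /unit1 => he k0 m0 /andP[q1 q2].
have h l : 0 <= l -> 0 <= l * k by move=> l0; rewrite mulr_ge0 // ltW.
case: he => [|[|]] ->; rewrite ?mulr0 ?mulr1 ?mulrN1.
- have [hm|hm] := leP (m * k) (s%:~R + 1 - q).
    left=> l /andP[l0 lm]; have := ler_wpM2r (ltW k0) lm; have := h l l0.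
    by rewrite mulrN; lra.
  right; exists ((s%:~R + 1 - q) / k).
    by rewrite divr_ge0 ?(ltW k0) ?subr_ge0 //= ler_pdivrMr // ltW.
  split=> [|l /andP[l0 lm]]; first by right; rewrite mulrN divfK ?gt_eqF //; lra.
  have := ler_wpM2r (ltW k0) lm; have := h l l0.
  by rewrite mulrN divfK ?gt_eqF //; lra.
- by left=> l _; rewrite mulr0 subr0 q1.
- have [hm|hm] := leP (m * k) (q - s%:~R).
    left=> l /andP[l0 lm]; have := ler_wpM2r (ltW k0) lm; have := h l l0.
    by lra.
  right; exists ((q - s%:~R) / k).
    by rewrite divr_ge0 ?(ltW k0) ?subr_ge0 //= ler_pdivrMr // ltW.
  split=> [|l /andP[l0 lm]]; first by left; rewrite divfK ?gt_eqF //; lra.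
  have := ler_wpM2r (ltW k0) lm; have := h l l0.
  by rewrite divfK ?gt_eqF //; lra.
Qed.

(** One coordinate of a push by less than a side: it meets no interval except its
    own and the one ahead. *)
Lemma forward1 (s c : int) (e : int) (m x : R) :
  e \in [:: -1; 0; 1] -> 0 <= m < 1 -> unit1 s x ->
  (if e == 0 then s%:~R < x < s%:~R + 1 else
    if e == 1 then s%:~R < x else x < s%:~R + 1) ->
  unit1 c (x + m * e%:~R) -> c - s \in [:: 0; e].
Proof.
rewrite /unit1 !inE => he /andP[m0 m1] /andP[x1 x2] hx /andP[c1 c2].
suff : ((s + Num.min 0 e - 1 < c) && (c < s + Num.max 0 e + 1))%R.
  by rewrite minEle maxEle; move: he; case: ifP; lia.
rewrite -!(ltr_int R) intrD1 intrB !intrD.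
move: he hx c1 c2 => /or3P[] /eqP-> /=; rewrite ?mulr0 ?mulr1 ?mulrN1;
  rewrite minEle maxEle /= ?mulr0z ?mulr1z ?mulrN1z; lra.
Qed.

Lemma region_side Q s (d : int) p : region Q p -> unit1 s.2 p.2 ->
  (s.1 + d, s.2) \notin Q -> ~~ unit1 (s.1 + d) p.1.
Proof.
move=> Qp p2 sQ; apply: contra sQ => p1; apply: Qp; rewrite /in_cell /=.
by apply/andP.
Qed.

Lemma region_side2 Q s (d : int) p : region Q p -> unit1 s.1 p.1 ->
  (s.1, s.2 + d) \notin Q -> ~~ unit1 (s.2 + d) p.2.
Proof.
move=> Qp p2 sQ; apply: contra sQ => p1; apply: Qp; rewrite /in_cell /=.
by apply/andP.
Qed.

Lemma unit1_strict (s e : int) (x : R) : e \in [:: -1; 0; 1] -> unit1 s x ->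
  (if e == 0 then ~~ unit1 (s + 1) x && ~~ unit1 (s - 1) x
   else ~~ unit1 (s - e) x) ->
  if e == 0 then s%:~R < x < s%:~R + 1 else
    if e == 1 then s%:~R < x else x < s%:~R + 1.
Proof.
rewrite /unit1 !inE => /or3P[] /eqP -> /= /andP[x1 x2];
  rewrite ?intrD ?intrN ?opprK ?mulrN1z ?mulr1z; lra.
Qed.

Lemma strict_noback (s e : int) (x : R) : e \in [:: -1; 0; 1] ->
  (if e == 0 then s%:~R < x < s%:~R + 1 else
    if e == 1 then s%:~R < x else x < s%:~R + 1) ->
  ~ (e%:~R = 1 :> R /\ x = s%:~R \/ e%:~R = -1 :> R /\ x = s%:~R + 1).
Proof.
by rewrite !inE => /or3P[]/eqP-> /=; rewrite ?mulrN1z ?mulr1z ?mulr0z; lra.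
Qed.

(** Push the part of the set in the cell [s] in the collapsing direction by almost
    a full side.  The swept region meets only cells of [Q] ahead of [s].  The
    pushed points leave [s], because they started at a positive distance from its
    back sides.  No other point of the set enters [s]: running its path backwards
    it would come in through a back side or a side parallel to the motion, which a
    point in the interior of [Q] cannot lie on. *)
Lemma collapse_step Q s C : collapsible Q s -> compact C -> C `<=` region Q ->
  exists g g', [/\ bilip g g', forall p, ~ region Q p -> g p = p &
    forall p, C p -> region (Q `\ s)%fset (g p)].
Proof.
move=> [[e1 e2] /= [/andP[/andP[he1 he2] he] A B1 B2]] cC CQ.
pose C' := C `&` [set p | in_cell s p].
have cC' : compact C' by apply: compact_closedI => //; exact: in_cell_closed.
have C'Q : C' `<=` region Q by move=> p [/CQ].
have [r r0 rV] := compact_collar cC' (@region_open Q) C'Q.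
(* slightly less than a full side, but more than a side minus the distance [r] *)
pose k := 1 - Num.min r 1 / 2.
have rk : 0 < Num.min r 1 <= 1 by rewrite lt_min r0 ltr01 ge_min lexx orbT.
have k0 : 0 < k by rewrite /k; lra.
have k1 : k < 1 by rewrite /k; lra.
pose w : plane := (k * e1%:~R, k * e2%:~R).
have str1 p : region Q p -> in_cell s p ->
    if e1 == 0 then s.1%:~R < p.1 < s.1%:~R + 1 else
    if e1 == 1 then s.1%:~R < p.1 else p.1 < s.1%:~R + 1.
  move=> Qp /andP[p1 p2]; apply: unit1_strict => //; move: B1.
  by case: ifP => _ => [/andP[h h']|h]; rewrite !(region_side Qp p2).
have str2 p : region Q p -> in_cell s p ->
    if e2 == 0 then s.2%:~R < p.2 < s.2%:~R + 1 else
    if e2 == 1 then s.2%:~R < p.2 else p.2 < s.2%:~R + 1.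
  move=> Qp /andP[p1 p2]; apply: unit1_strict => //; move: B2.
  by case: ifP => _ => [/andP[h h']|h]; rewrite !(region_side2 Qp p1).
have sweep p l : C' p -> 0 <= l <= 1 -> region Q (p + l *: w).
  move=> [/CQ Qp ps] /andP[l0 l1] c /andP[/= c1 c2].
  have lk : 0 <= l * k < 1.
    by rewrite mulr_ge0 ?(ltW k0) //=; apply: le_lt_trans k1; rewrite ler_piMl // ltW.
  have /andP[ps1 ps2] := ps.
  have c1' : unit1 c.1 (p.1 + l * k * e1%:~R) by rewrite -mulrA.
  have c2' : unit1 c.2 (p.2 + l * k * e2%:~R) by rewrite -mulrA.
  have d1 := forward1 he1 lk ps1 (str1 _ Qp ps) c1'.
  have d2 := forward1 he2 lk ps2 (str2 _ Qp ps) c2'.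
  have := A _ _ d1 d2; rewrite ![s.1 + _]addrC ![s.2 + _]addrC !subrK.
  by rewrite -surjective_pairing.
have [g [g' [gg' gQ gC gp]]] := push_compact cC' (@region_open Q) sweep.
exists g, g'; split=> // p Cp.
have Qg : region Q (g p).
  apply: contrapT => h; have gK := can_inj (let: And4 h _ _ _ := gg' in h).
  by have := gK _ _ (gQ _ h) => E; apply: h; rewrite E; exact: CQ.
suff sg : ~~ in_cell s (g p).
  move=> c cg; rewrite !inE (Qg c cg) andbT.
  by apply: contraNneq sg => <-.
have [ps|ps] := boolP (in_cell s p).
  rewrite gC //; have /andP[p1 p2] := ps.
  have near1 x : `|p.1 - x| < r -> region Q (x, p.2).
    move=> px; apply: (rV p); first by split.
    by rewrite plane_norm_lt /= px subrr normr0.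
  have near2 x : `|p.2 - x| < r -> region Q (p.1, x).
    move=> px; apply: (rV p); first by split.
    by rewrite plane_norm_lt /= px subrr normr0 r0.
  have rmin : Num.min r 1 <= r by rewrite ge_min lexx.
  apply/negP => /andP[]; rewrite /unit1 /=.
  have [E1|e10] := eqVneq e1 0.
    have e20 : e2 != 0 by apply: contraNneq he => ->; rewrite E1.
    move=> _; move: B2; rewrite (negPf e20) => B2.
    have nb x : unit1 (s.2 - e2) x -> r <= `|p.2 - x|.
      move=> sx; rewrite leNgt; apply/negP => /near2 Qx.
      by have := region_side2 Qx p1 B2; rewrite sx.
    move: he2 e20 nb p2; rewrite !inE /unit1 => /or3P[] /eqP-> // _ nb /andP[h1 h2].
      have := nb (s.2%:~R + 1); rewrite opprK intrD lexx mulr1z lerDl ler01.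
      by rewrite ler0_norm; [move=> /(_ isT)|]; rewrite ?mulrN1z /k; lra.
    have := nb s.2%:~R; rewrite intrB mulr1z subrK lexx gerBl ler01.
    by rewrite ger0_norm; [move=> /(_ isT)|]; rewrite ?mulr1z /k; lra.
  move=> + _; move: B1; rewrite (negPf e10) => B1.
  have nb x : unit1 (s.1 - e1) x -> r <= `|p.1 - x|.
    move=> sx; rewrite leNgt; apply/negP => /near1 Qx.
    by have := region_side Qx p2 B1; rewrite sx.
  move: he1 e10 nb p1; rewrite !inE /unit1 => /or3P[] /eqP-> // _ nb /andP[h1 h2].
    have := nb (s.1%:~R + 1); rewrite opprK intrD lexx mulr1z lerDl ler01.
    by rewrite ler0_norm; [move=> /(_ isT)|]; rewrite ?mulrN1z /k; lra.
  have := nb s.1%:~R; rewrite intrB mulr1z subrK lexx gerBl ler01.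
  by rewrite ger0_norm; [move=> /(_ isT)|]; rewrite ?mulr1z /k; lra.
case: (gp p) => [->//|[m m0 [E mV]]].
apply/negP => /andP[gs1 gs2].
have he1' : e1%:~R = -1 :> R \/ e1%:~R = 0 :> R \/ e1%:~R = 1 :> R.
  by move: he1; rewrite !inE => /or3P[] /eqP->; rewrite ?mulrN1z; auto.
have he2' : e2%:~R = -1 :> R \/ e2%:~R = 0 :> R \/ e2%:~R = 1 :> R.
  by move: he2; rewrite !inE => /or3P[] /eqP->; rewrite ?mulrN1z; auto.
pose q := g p.
have back l : q - l *: w = p + (m - l) *: w.
  by rewrite /q E scalerBl addrA.
have pE : p = q - m *: w by rewrite back subrr scale0r addr0.
have noback l : 0 <= l <= m -> in_cell s (q - l *: w) ->
  ~ (e1%:~R = 1 :> R /\ (q - l *: w).1 = s.1%:~R \/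
    e1%:~R = -1 :> R /\ (q - l *: w).1 = s.1%:~R + 1) /\
  ~ (e2%:~R = 1 :> R /\ (q - l *: w).2 = s.2%:~R \/
    e2%:~R = -1 :> R /\ (q - l *: w).2 = s.2%:~R + 1).
  move=> /andP[l0 lm] ls.
  have Ql : region Q (q - l *: w).
    by rewrite back; apply: mV; rewrite subr_ge0 lm gerBl.
  by split; apply: strict_noback => //; [exact: str1|exact: str2].
have [i1|[l1 l1m [b1 i1]]] := back1 he1' k0 m0 gs1.
  have [i2|[l2 l2m [b2 i2]]] := back1 he2' k0 m0 gs2.
    move: ps; rewrite pE /in_cell => /negP; apply; apply/andP; split.
      by apply: i1; rewrite m0 lexx.
    by apply: i2; rewrite m0 lexx.
  have [] := noback l2 l2m; last by move=> _; apply.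
  apply/andP; split; [exact: i1|apply: i2].
  by case/andP: l2m => -> _; rewrite lexx.
have [i2|[l2 l2m [b2 i2]]] := back1 he2' k0 m0 gs2.
  have [] := noback l1 l1m; last by move=> + _; apply.
  apply/andP; split; [apply: i1|exact: i2].
  by case/andP: l1m => -> _; rewrite lexx.
have [l12|/ltW l12] := leP l1 l2.
  have [] := noback l1 l1m; last by move=> + _; apply.
  case/andP: l1m => l10 _.
  by apply/andP; split; [apply: i1|apply: i2]; rewrite l10 ?lexx.
have [] := noback l2 l2m; last by move=> _; apply.
case/andP: l2m => l20 _.
by apply/andP; split; [apply: i1|apply: i2]; rewrite l20 ?lexx.
Qed.

Lemma support_preserve V (g : plane -> plane) p : injective g ->
  (forall p, ~ V p -> g p = p) -> V p -> V (g p).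
Proof.
move=> gi gV Vp; apply: contrapT => h; have := gV _ h => /gi E.
by apply: h; rewrite E.
Qed.

(** Collapse the cells one at a time; being filled and connected persists. *)
Lemma collapse_all Q C : filled Q -> polyconn Q -> Q != fset0 -> compact C ->
  C `<=` region Q ->
  exists g g' r, [/\ bilip g g', forall p, ~ region Q p -> g p = p,
    r \in Q & forall p, C p -> region [fset r]%fset (g p)].
Proof.
have [n] := ubnP #|` Q|; elim: n Q C => // n IH Q C lt fQ cQ Q0 cC CQ.
have [r rQ] : exists r : cell, r \in Q by exact/fset0Pn.
have [Q1|Q1] := leqP #|` Q| 1.
  exists id, id, r; split=> // [|p /CQ]; first exact: bilip_id.
  apply: region_sub; apply/fsubsetP => c cQ'; rewrite inE.
  have : (#|` [fset r; c]%fset| <= #|` Q|)%N.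
    by apply: fsubset_leq_card; apply/fsubsetP => x; rewrite !inE => /orP[]/eqP->.
  by rewrite cardfs2 => h; have := leq_trans h Q1; rewrite eq_sym; case: eqVneq.
have [s [sQ _ sc]] := collapsible_ex r fQ cQ Q1.
have [g [g' [gg' gQ gC]]] := collapse_step sc cC CQ.
have ltQ : (#|` (Q `\ s)%fset| < n)%N by have := cardfsD1 s Q; rewrite sQ; lia.
have Qs0 : (Q `\ s)%fset != fset0.
  by rewrite -cardfs_gt0; have := cardfsD1 s Q; rewrite sQ; lia.
have cg : continuous g by case: gg' => _ _ [k _ /lip_continuous].
have cgC : compact (g @` C).
  by apply: continuous_compact cC; exact: continuous_subspaceT.
have [|h [h' [r' [hh' hQ r'Q hC]]]] := IH _ (g @` C) ltQ
  (collapse_filled fQ sQ sc) (collapse_polyconn cQ sc) Qs0 cgC.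
  by move=> _ [p Cp <-]; exact: gC.
exists (h \o g), (g' \o h'), r'; split.
- exact: bilip_comp.
- move=> p Qp /=; rewrite gQ // hQ // => Qsp; apply: Qp.
  by apply: region_sub Qsp; exact: fsubD1set.
- by move: r'Q; rewrite !inE => /andP[].
- by move=> p Cp; apply: hC; exists p.
Qed.
End Cells.

(** * Moving every point into the interior of a cell *)

Section Isolate.
Variable R : realType.
Local Notation plane := (R * R)%type.
Implicit Types (p q w : plane) (C V T : set plane) (Q F G : {fset cell})
  (c s : cell).

Definition touch C c d : Prop := exists2 p, C p & in_cell c p && in_cell d p.

Lemma touch_sym C c d : touch C c d -> touch C d c.
Proof. by move=> [p Cp h]; exists p; rewrite // andbC. Qed.

Lemma unit1_close (k l : int) (x : R) : unit1 k x -> unit1 l x ->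
  [|| l == k, l == k + 1 | k == l + 1].
Proof.
move=> /andP[k1 k2] /andP[l1 l2].
have : (k <= l + 1)%R && (l <= k + 1)%R by rewrite -!(ler_int R) !intrD; lra.
by clear; lia.
Qed.

(** Cells with only a corner in common are linked through the other two cells at
    that corner, which contain the same point. *)
Lemma touch_link C c d : touch C c d -> link (touch C) c d.
Proof.
move=> [p Cp /andP[/andP[c1 c2] /andP[d1 d2]]].
have ce : link (touch C) c (d.1, c.2).
  have := unit1_close c1 d1; case: eqVneq => [-> _|_ /= h].
    by rewrite -surjective_pairing; exact: link0.
  apply: (linkS (link0 _ _)); last first.
    by exists p; rewrite // /in_cell /= c1 c2 d1.
  move: h; rewrite /adj /=; clear; lia.
have := unit1_close c2 d2; case: eqVneq => [E _|_ /= h].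
  by rewrite [d]surjective_pairing E.
apply: (linkS ce); last by exists p; rewrite // /in_cell /= c2 d1 d2.
move: h; rewrite /adj /=; clear; lia.
Qed.

Definition covered Q : set plane := [set p | exists2 c, c \in Q & in_cell c p].

Lemma covered_closed Q : closed (covered Q).
Proof.
rewrite -[X in closed X]setCK; apply: open_closedC; apply/plane_openP => p cp.
have [d d0 h] := in_cell_near p; exists d => // q /h pq [c cQ /pq cp'].
by apply: cp; exists c.
Qed.

Lemma region_covered Q p : region Q p -> covered Q p.
Proof. by move=> Qp; exists (Num.floor p.1, Num.floor p.2); [apply: Qp|]; exact: floor_cell. Qed.

Lemma compact_bound C : compact C -> exists N : nat, forall p, C p -> `|p| < N%:R.
Proof.
move=> /compact_bounded[B [_ hB]]; exists (Num.truncn (`|B| + 1)).+1 => p Cp.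
apply: le_lt_trans (truncnS_gt _).
by apply: (hB (`|B| + 1)) Cp; apply: le_lt_trans (ler_norm _) _; rewrite ltrDl.
Qed.

Lemma cells_cover C : compact C -> exists B : seq cell,
  forall p, C p -> (Num.floor p.1, Num.floor p.2) \in B.
Proof.
move=> /compact_bound[N hN]; exists (box N.+1 (0, 0)) => p /hN.
rewrite plane_norm_lt => /andP[h1 h2].
have aux (x : R) : `|x| < N%:R -> (absz (Num.floor x - 0)%R <= N.+1)%N.
  rewrite ltr_norml => /andP[x1 x2].
  have f1 : (Num.floor x < N%:Z)%R.
    by rewrite -(ltr_int R); apply: le_lt_trans x2; exact: ge_floor.
  have f2 : (- N%:Z < Num.floor x + 1)%R.
    by rewrite -(ltr_int R) intrN; apply: lt_trans x1 _; exact: lt_succ_floor.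
  by move: f1 f2; clear; lia.
by apply: mem_box; exact: aux.
Qed.

(** Collapse the disjoint filled clusters one after the other; each collapse is
    the identity outside its own cluster.  No point of the set lies on the boundary
    of a cluster, as the filled clusters are closed under touching. *)
Lemma grid_isolate C (M : nat) : compact C ->
  (forall a c, link (touch C) a c ->
    (absz (c.1 - a.1)%R <= M)%N /\ (absz (c.2 - a.2)%R <= M)%N) ->
  exists g g', [/\ bilip g g', forall p, `|g p - p| <= M%:R * 2 + 1 &
    forall p, C p -> exists r, region [fset r]%fset (g p)].
Proof.
move=> cC linkM.
have [B hB] := cells_cover cC.
have [Fs [FsP FsB Fsd]] := polyomino_cover (@touch_sym C) (@touch_link C) linkM B.
have CF F p : F \in Fs -> C p -> covered F p -> region F p.
  move=> /FsP[_ _ _ Ft _] Cp [c cF cp] d dp; apply: Ft cF; exists p => //.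
  by rewrite cp.
have disj F G p : F \in Fs -> G \in Fs -> region F p -> region G p -> F = G.
  by move=> FFs GFs /region_covered[c cF cp] /(_ _ cp); exact: Fsd cF.
suff [g [g' [gg' gfix gin gC]]] : exists g g', [/\ bilip g g',
    forall p, (forall F, F \in Fs -> ~ region F p) -> g p = p,
    forall F p, F \in Fs -> region F p -> region F (g p) &
    forall F p, F \in Fs -> C p -> region F p ->
      exists2 r, r \in F & region [fset r]%fset (g p)].
  exists g, g'; split=> // p; last first.
    move=> Cp; have [F FFs pF] := FsB _ (hB _ Cp).
    have Fp : region F p.
      by apply: CF => //; exists (Num.floor p.1, Num.floor p.2); rewrite ?floor_cell.
    by have [r _ hr] := gC _ _ FFs Cp Fp; exists r.
  have [[F FFs Fp]|h] := pselect (exists2 F, F \in Fs & region F p); last first.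
    rewrite gfix ?subrr ?normr0 ?addr_ge0 // => F FFs Fp; apply: h.
    by exists F.
  have [_ _ _ _ [a Fa]] := FsP _ FFs.
  have [c /Fa/box_mem[c1 c2] /andP[cp1 cp2]] := region_covered Fp.
  have [d /Fa/box_mem[d1 d2] /andP[dp1 dp2]] := region_covered (gin _ _ FFs Fp).
  have aux (k l m : int) (x y : R) : (absz (k - m)%R <= M)%N ->
      (absz (l - m)%R <= M)%N -> unit1 k x -> unit1 l y ->
      `|y - x| <= M%:R * 2 + 1.
    move=> km lm /andP[x1 x2] /andP[y1 y2].
    have : (k <= l + M%:Z + M%:Z)%R && (l <= k + M%:Z + M%:Z)%R.
      by move: km lm; clear; lia.
    rewrite -!(ler_int R) !intrD ler_norml => /andP[h1 h2].
    by apply/andP; split; lra.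
  by rewrite plane_norm_le (aux _ _ _ _ _ c1 d1) // (aux _ _ _ _ _ c2 d2).
have : {subset Fs <= Fs} by [].
elim: {1 3 4 5}Fs => [_|F L IH sub].
  by exists id, id; split=> //; exact: bilip_id.
have [|g [g' [gg' gfix gin gC]]] := IH.
  by move=> G GL; apply: sub; rewrite inE GL orbT.
have [FL|FL] := boolP (F \in L).
  exists g, g'; split=> // [p h|G p|G p].
  - by apply: gfix => G GL; apply: h; rewrite inE GL orbT.
  - by rewrite inE => /orP[/eqP->|]; exact: gin.
  - by rewrite inE => /orP[/eqP->|]; exact: gC.
have FFs : F \in Fs by apply: sub; rewrite mem_head.
have LFs G : G \in L -> G \in Fs by move=> GL; apply: sub; rewrite inE GL orbT.
have dis G p : G \in L -> region G p -> ~ region F p.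
  move=> GL Gp Fp; move: FL; rewrite (disj _ _ _ FFs (LFs _ GL) Fp Gp).
  by rewrite GL.
have [fF cF F0 _ _] := FsP _ FFs.
have [||h [h' [r [hh' hfix rF hC]]]] :=
    @collapse_all R F (C `&` covered F) fF cF F0.
- by apply: compact_closedI => //; exact: covered_closed.
- by move=> p [Cp Fp]; exact: CF.
have hin p : region F p -> region F (h p).
  by apply: support_preserve => //; case: hh' => /can_inj.
exists (h \o g), (g' \o h'); split.
- exact: bilip_comp.
- move=> p hp /=; rewrite gfix => [|G GL]; last by apply: hp; rewrite inE GL orbT.
  by apply: hfix; apply: hp; rewrite mem_head.
- move=> G p; rewrite inE => /orP[/eqP->|GL] Gp /=.
    rewrite gfix; first exact: hin.
    by move=> G' G'L G'p; exact: dis G'L G'p Gp.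
  have := gin _ _ GL Gp => Ggp; rewrite hfix //; exact: dis GL Ggp.
- move=> G p; rewrite inE => /orP[/eqP->|GL] Cp Gp /=.
    rewrite gfix => [|G' G'L G'p]; last exact: dis G'L G'p Gp.
    by exists r => //; apply: hC; split=> //; exact: region_covered.
  have [r' r'G r'p] := gC _ _ GL Cp Gp; exists r' => //.
  by rewrite hfix //; apply: (dis G) => //; exact: gin.
Qed.
End Isolate.

(** * Separating small pieces by the first coordinate *)

Section Stage.
Variable R : realType.
Local Notation plane := (R * R)%type.
Implicit Types (p q w : plane) (C V T : set plane) (c s : cell) (x y : R).

(** Distance to the nearest integer. *)
Definition intdist x : R :=
  Num.min (x - (Num.floor x)%:~R) ((Num.floor x)%:~R + 1 - x).

Lemma floorP x : (Num.floor x)%:~R <= x < (Num.floor x)%:~R + 1.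
Proof. by rewrite ge_floor /= -intrD1 lt_succ_floor. Qed.

Lemma intdist_le x (n : int) : intdist x <= `|x - n%:~R|.
Proof.
have := floorP x; rewrite /intdist; set k := Num.floor x => /andP[h1 h2].
have [nk|kn] := leP n k; rewrite ge_min.
  have h : n%:~R <= k%:~R :> R by rewrite ler_int.
  by apply/orP; left; rewrite ger0_norm; lra.
have h : k%:~R + 1 <= n%:~R :> R by rewrite -intrD1 ler_int; move: kn; clear; lia.
by apply/orP; right; rewrite ler0_norm; lra.
Qed.

Lemma intdist_ex x : exists n : int, intdist x = `|x - n%:~R|.
Proof.
have := floorP x; rewrite /intdist; set k := Num.floor x => /andP[h1 h2].
rewrite minEle; case: ifP => h; first by exists k; rewrite ger0_norm; lra.
by exists (k + 1); rewrite intrD1 ler0_norm; lra.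
Qed.

Lemma intdist_lip x y : `|intdist x - intdist y| <= `|x - y|.
Proof.
wlog : x y / intdist y <= intdist x => [h|].
  have [|/ltW] := leP (intdist y) (intdist x) => /h //.
  by rewrite distrC (distrC x).
move=> h; rewrite ger0_norm ?subr_ge0 //.
have [n ->] := intdist_ex y; have := intdist_le x n.
by have := ler_distD y x n%:~R; lra.
Qed.

(** The map [x + wave x / 2] has the integers as repelling and the
    half-integers as attracting fixed points. *)
Definition wave x : R := intdist (x + 4^-1) - 4^-1.

Definition attract p : plane := p + (wave p.1 / 2, 0).

Lemma wave_half (k : int) x : k%:~R <= x <= k%:~R + 1 ->
  let D := x - (k%:~R + 2^-1) in
  wave x = if 0 <= D then - Num.min D (2^-1 - D) else Num.min (- D) (2^-1 + D).
Proof.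
move=> /andP[x1 x2] D; rewrite /wave.
have id (n : int) : n%:~R <= x + 4^-1 <= n%:~R + 1 ->
    intdist (x + 4^-1) = Num.min (x + 4^-1 - n%:~R) (n%:~R + 1 - (x + 4^-1)).
  move=> /andP[n1 n2]; have := floorP (x + 4^-1); rewrite /intdist.
  set f := Num.floor _ => /andP[f1 f2].
  have nf : (n <= f)%R by rewrite -ltzD1 -(ltr_int R) intrD1; lra.
  have fn : (f <= n + 1)%R by rewrite -(ler_int R) intrD1; lra.
  have : (f == n) || (f == n + 1) by move: nf fn; clear; lia.
  case/orP => /eqP fE; first by rewrite fE.
  have xE : x + 4^-1 = n%:~R + 1.
    by apply/eqP; rewrite eq_le n2 -intrD1 -fE f1.
  by rewrite fE intrD1 xE !minEle; do 2 case: ifP; lra.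
have [h|h] := leP x (k%:~R + 3 / 4).
  rewrite (id k); last lra.
  by rewrite !minEle /D; do ![case: ifP]; lra.
rewrite (id (k + 1)) intrD1; last lra.
by rewrite !minEle /D; do ![case: ifP]; lra.
Qed.

Lemma attract_bilip : exists g, bilip attract g.
Proof.
apply: (contraction_bilip (c := 2^-1)); first lra.
move=> p q; rewrite plane_norm_le /= subrr normr0 mulr_ge0 // andbT.
have := intdist_lip (p.1 + 4^-1) (q.1 + 4^-1).
have := plane_norm1 (p - q); rewrite /= -mulrBl normrM (@ger0_norm _ 2^-1) //.
rewrite /wave => h1 h2; rewrite mulrC ler_wpM2l //; apply: le_trans h1.
have -> : forall a b c : R, a - c - (b - c) = a - b by move=> a b c; ring.
apply: le_trans h2 _; have -> : p.1 + 4^-1 - (q.1 + 4^-1) = p.1 - q.1 by ring.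
by [].
Qed.

Lemma attract_step (k : int) p : let D p := p.1 - (k%:~R + 2^-1) in
  `|D p| <= 2^-1 ->
  [/\ (attract p).2 = p.2, 0 <= D p -> 0 <= D (attract p) <= D p,
      D p <= 0 -> D p <= D (attract p) <= 0 &
      `|D (attract p)| = `|D p| - Num.min `|D p| (2^-1 - `|D p|) / 2].
Proof.
move=> D; rewrite ler_norml => /andP[D1 D2].
have px : k%:~R <= p.1 <= k%:~R + 1 by move: D1 D2; rewrite /D; lra.
have := wave_half px; rewrite -/(D p) /= => W.
have DE : D (attract p) = D p + wave p.1 / 2 by rewrite /D /=; ring.
split; first by rewrite /= addr0.
- by move=> D0; rewrite DE W D0 minEle; case: ifP; lra.
- rewrite le_eqVlt => /orP[/eqP D0|D0].
    by rewrite DE W D0 lexx minEle; case: ifP; lra.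
  have D0' : (0 <= D p) = false by rewrite leNgt D0.
  by rewrite DE W D0' minEle; case: ifP; lra.
- rewrite DE W; case: ifP => [D0|/negbT]; rewrite ?(ger0_norm D0).
    rewrite minEle; case: ifP => h; rewrite ger0_norm; lra.
  rewrite -ltNge => D0; rewrite (ltr0_norm D0) opprK.
  by rewrite minEle; case: ifP => h; rewrite ler0_norm; lra.
Qed.

(** As long as the distance to the half-integer exceeds [s], each step decreases
    it by at least half the minimum of [s] and [t]. *)
Lemma attract_iter (k : int) p n : let D p := p.1 - (k%:~R + 2^-1) in
  `|D p| <= 2^-1 ->
  [/\ (iter n attract p).2 = p.2, `|D (iter n attract p)| <= 2^-1 &
    forall t s : R, 0 < s -> `|D p| <= 2^-1 - t -> 0 < t ->
      `|D (iter n attract p)| <= 2^-1 - t /\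
      (`|D (iter n attract p)| <= s \/
       `|D (iter n attract p)| <= 2^-1 - n%:R * (Num.min s t / 2))].
Proof.
move=> D Dp; elim: n => [|n [IH1 IH2 IH3]].
  by split=> // t s s0 h t0; split=> //; right; rewrite mul0r subr0.
have [E1 _ _ E2] := attract_step IH2.
set D' := `|D (iter n attract p)| in E2 IH2 IH3 *.
rewrite iterS /= -/(D _) in E1 E2 *.
have D'0 : 0 <= D' by exact: normr_ge0.
have D'D : `|D (attract (iter n attract p))| <= D'.
  by rewrite E2 minEle; case: ifP; lra.
split; [by rewrite E1|exact: le_trans D'D IH2|].
move=> t s s0 h t0; have [h1 h2] := IH3 t s s0 h t0.
split; first exact: le_trans D'D h1.
case: h2 => h2; first by left; exact: le_trans D'D h2.
have [hs|hs] := leP D' s; first by left; exact: le_trans D'D hs.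
right; rewrite E2 -[n.+1%:R]natr1 mulrDl mul1r; move: h2.
by rewrite !minEle; do 2 case: ifP; move: (n%:R * _) => z; lra.
Qed.

Lemma attract_squeeze (t s : R) : 0 < s -> 0 < t -> exists n : nat,
  forall (k : int) p, `|p.1 - (k%:~R + 2^-1)| <= 2^-1 - t ->
    `|(iter n attract p).1 - (k%:~R + 2^-1)| <= s.
Proof.
move=> s0 t0; have m0 : 0 < Num.min s t / 2 by rewrite divr_gt0 // lt_min s0.
exists (Num.truncn (2^-1 / (Num.min s t / 2))).+1 => k p h.
have h' : `|p.1 - (k%:~R + 2^-1)| <= 2^-1 by lra.
have [_ _ /(_ t s s0 h t0)[_ []//]] := @attract_iter k p
  (Num.truncn (2^-1 / (Num.min s t / 2))).+1 h'.
move=> /le_trans; apply; apply: le_trans (ltW s0).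
by rewrite subr_le0 -ler_pdivrMr // ltW // truncnS_gt.
Qed.

Lemma attract_close n p : `|iter n attract p - p| <= 1.
Proof.
have /andP[f1 f2] := floorP p.1.
have [|E D _] := @attract_iter (Num.floor p.1) p n.
  by rewrite ler_norml; apply/andP; split; lra.
rewrite plane_norm_le /= E subrr normr0 ler01 andbT.
by move: D; rewrite !ler_norml => /andP[d1 d2]; apply/andP; split; lra.
Qed.

Definition clamp (N y : R) : R := Num.max (- N) (Num.min N y).

Lemma clamp_lip (N x y : R) : 0 <= N -> `|clamp N x - clamp N y| <= `|x - y|.
Proof.
move=> N0; wlog : x y / x <= y => [h|].
  have [/h//|/ltW/h] := leP x y; by rewrite distrC (distrC x).
move=> xy; rewrite [leRHS]ler0_norm ?subr_le0 // ler_norml /clamp.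
by case: (leP N x) => ?; case: (leP N y) => ?; case: (leP (- N) N) => ?;
  case: (leP (- N) x) => ?; case: (leP (- N) y) => ?; lra.
Qed.

(** The clamp keeps the shear close to the identity. *)
Lemma shear_bilip (N k : R) : 0 <= N -> 0 <= k < 1 ->
  exists g, bilip (fun p => p + (k * clamp N p.2, 0)) g.
Proof.
move=> N0 k01; have /andP[k0 _] := k01; apply: (contraction_bilip k01) => p q.
rewrite plane_norm_le /= subrr normr0 mulr_ge0 // andbT -mulrBr normrM.
rewrite (ger0_norm k0) ler_wpM2l //; apply: le_trans (clamp_lip _ _ N0) _.
exact: plane_norm2 (p - q).
Qed.

Lemma region1 c p : region [fset c]%fset p ->
  c.1%:~R < p.1 < c.1%:~R + 1 /\ c.2%:~R < p.2 < c.2%:~R + 1.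
Proof.
move=> cp; have fc := floor_cell p; have := cp _ fc; rewrite inE => /eqP E.
rewrite E in fc; have /andP[/andP[a1 a2] /andP[b1 b2]] := fc.
have no d : d != c -> ~~ in_cell d p.
  by apply: contraNN => /cp; rewrite inE.
have := no (c.1 - 1, c.2); have := no (c.1 + 1, c.2).
have := no (c.1, c.2 - 1); have := no (c.1, c.2 + 1).
rewrite /in_cell /unit1 /= !intrD !intrN !mulr1z a1 a2 b1 b2 /= !andbT.
have e1 (k e : int) (l : int) : e != 0 -> (k + e, l) != (k, l).
  by move=> e0; rewrite xpair_eqE -[X in _ == X]addr0 (inj_eq (addrI _)) (negPf e0).
have e2 (k e : int) (l : int) : e != 0 -> (l, k + e) != (l, k).
  move=> e0; rewrite xpair_eqE -[X in _ && (_ == X)]addr0 (inj_eq (addrI _)).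
  by rewrite (negPf e0) andbF.
rewrite [c in _ != c]surjective_pairing !e1 ?e2 // => /(_ isT) h1 /(_ isT) h2.
by move=> /(_ isT) h3 /(_ isT) h4; lra.
Qed.

Lemma open_cells_margin C : compact C ->
  (forall p, C p -> exists c, region [fset c]%fset p) ->
  exists2 t, 0 < t & forall c p, C p -> region [fset c]%fset p ->
    c.1%:~R + t <= p.1 <= c.1%:~R + 1 - t /\
    c.2%:~R + t <= p.2 <= c.2%:~R + 1 - t.
Proof.
move=> cC Creg; pose O := \bigcup_(c in [set: cell]) region (R:=R) [fset c]%fset.
have oO : open O by apply: bigcup_open => c _; exact: region_open.
have CO : C `<=` O by move=> p /Creg[c cp]; exists c.
have [r r0 rO] := compact_collar cC oO CO; exists r => // c p Cp cp.
have [p1 p2] := region1 cp.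
have bad1 (k : int) : r <= `|p.1 - k%:~R|.
  rewrite leNgt; apply/negP => h.
  have [] : O (k%:~R, p.2).
    by apply: (rO p) => //; rewrite plane_norm_lt /= h subrr normr0.
  move=> d _ /region1[/= /andP[d1 d2] _]; move: d1 d2.
  by rewrite -intrD1 !ltr_int; clear; lia.
have bad2 (k : int) : r <= `|p.2 - k%:~R|.
  rewrite leNgt; apply/negP => h.
  have [] : O (p.1, k%:~R).
    by apply: (rO p) => //; rewrite plane_norm_lt /= h subrr normr0 r0.
  move=> d _ /region1[/= _ /andP[d1 d2]]; move: d1 d2.
  by rewrite -intrD1 !ltr_int; clear; lia.
have := bad1 c.1; have := bad1 (c.1 + 1); have := bad2 c.2; have := bad2 (c.2 + 1).
rewrite !intrD1; move: p1 p2 => /andP[p11 p12] /andP[p21 p22].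
rewrite ler0_norm; last lra.
rewrite ger0_norm; last lra.
rewrite ler0_norm; last lra.
rewrite ger0_norm; last lra.
by lra.
Qed.

(** Squeeze the columns to thin strips around their centre lines, then shear.  The
    shear moves points by at most a quarter, so the first coordinate determines
    the column; within a column it determines the height up to less than the
    margin [t] that the points keep from the sides of their cells, hence the
    cell. *)
Lemma grid_separate C (M : nat) : compact C ->
  (forall a c, link (touch C) a c ->
    (absz (c.1 - a.1)%R <= M)%N /\ (absz (c.2 - a.2)%R <= M)%N) ->
  exists g g', [/\ bilip g g', forall p, `|g p - p| <= M%:R * 2 + 3 &
    forall p q, C p -> C q -> (g p).1 = (g q).1 -> `|p - q| <= M%:R * 4 + 3].
Proof.
move=> cC linkM; have [g [g' [gg' gclose gcell]]] := grid_isolate cC linkM.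
have cg : continuous g by case: gg' => _ _ [k _ /lip_continuous].
have cgC : compact (g @` C).
  by apply: continuous_compact cC; exact: continuous_subspaceT.
have [_ [p Cp <-]|t t0 gt] := open_cells_margin cgC; first exact: gcell.
have [N hN] := compact_bound cgC.
have N0 : 0 <= N%:R :> R by [].
(* the slope of the shear, and the half-width [s] of the strips *)
pose k : R := (4 * (N%:R + 1))^-1.
have k0 : 0 < k by rewrite invr_gt0; lra.
have k1 : k < 1 by rewrite invf_lt1; lra.
have kN y : `|y| <= N%:R -> `|k * y| <= 4^-1.
  move=> yN; rewrite normrM (gtr0_norm k0) mulrC /k ler_pdivrMr; lra.
pose s := k * Num.min t 2^-1 / 4.
have t20 : 0 < Num.min t 2^-1 <= 2^-1 by rewrite lt_min t0 ge_min lexx orbT /=; lra.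
have kt : 0 < k * Num.min t 2^-1 by rewrite mulr_gt0 //; case/andP: t20.
have s0 : 0 < s by rewrite divr_gt0.
have s8 : s <= 8^-1.
  have /andP[_ t2] := t20; have := ler_wpM2l (ltW k0) t2; rewrite /s; lra.
have [n hn] := attract_squeeze s0 t0.
have [a' aa'] := attract_bilip.
have [|h' hh'] := @shear_bilip N%:R k N0; first by rewrite ltW.
pose h p := p + (k * clamp N%:R p.2, 0) : plane.
have clampN y : `|clamp N%:R y| <= N%:R.
  by rewrite ler_norml /clamp; case: (leP N%:R y) => ?;
    [case: (leP (- N%:R) N%:R)|case: (leP (- N%:R) y)] => ?; lra.
have clampid y : `|y| < N%:R -> clamp N%:R y = y.
  by rewrite ltr_norml /clamp => /andP[y1 y2]; case: (leP N%:R y) => ?;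
    [case: (leP (- N%:R) N%:R)|case: (leP (- N%:R) y)] => ?; lra.
exists (h \o (iter n attract \o g)), ((g' \o iter n a') \o h'); split.
- by apply: bilip_comp => //; apply: bilip_comp => //; exact: bilip_iter.
- move=> p /=; have := gclose p; have := attract_close n (g p).
  have : `|h (iter n attract (g p)) - iter n attract (g p)| <= 4^-1.
    rewrite /h addrAC subrr add0r plane_norm_le /= kN //= normr0; lra.
  have := ler_distD (iter n attract (g p)) (h (iter n attract (g p))) p.
  have := ler_distD (g p) (iter n attract (g p)) p; lra.
- move=> p q Cp Cq /=.
  have [c cp] := gcell _ Cp; have [d dq] := gcell _ Cq.
  have gCp : (g @` C) (g p) by exists p.
  have gCq : (g @` C) (g q) by exists q.
  have [c1 c2] := gt _ _ gCp cp; have [d1 d2] := gt _ _ gCq dq.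
  have near_ (e : int) (x : R) : e%:~R + t <= x <= e%:~R + 1 - t ->
      `|x - (e%:~R + 2^-1)| <= 2^-1 - t.
    by move=> ex; rewrite ler_norml; apply/andP; split; lra.
  have hp := hn _ _ (near_ _ _ c1); have hq := hn _ _ (near_ _ _ d1).
  have half e x : `|x - (e%:~R + 2^-1)| <= 2^-1 - t ->
      `|x - (e%:~R + 2^-1)| <= 2^-1 by lra.
  have [Ep _ _] := @attract_iter c.1 (g p) n (half _ _ (near_ _ _ c1)).
  have [Eq _ _] := @attract_iter d.1 (g q) n (half _ _ (near_ _ _ d1)).
  have := hN _ gCp; have := hN _ gCq.
  rewrite !plane_norm_lt => /andP[_ q2] /andP[_ p2].
  rewrite Ep Eq !clampid //.
  have := kN _ (ltW p2); have := kN _ (ltW q2); rewrite !ler_norml.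
  move: hp hq; rewrite !ler_norml; set P := iter n _ _; set Q := iter n _ _.
  move=> /andP[P1 P2] /andP[Q1 Q2] /andP[kq1 kq2] /andP[kp1 kp2] PQ.
  have cd1 : c.1 = d.1.
    have : c.1%:~R < d.1%:~R + 1 :> R by lra.
    have : d.1%:~R < c.1%:~R + 1 :> R by lra.
    by rewrite -!intrD1 !ltr_int; clear; lia.
  have tt : Num.min t 2^-1 <= t by rewrite ge_min lexx.
  have ktt : k * Num.min t 2^-1 <= k * t by rewrite ler_wpM2l // ltW.
  have key : `|k * ((g p).2 - (g q).2)| < k * t.
    rewrite cd1 in P1 P2; rewrite mulrBr ltr_norml /s in P1 P2 Q1 Q2 *.
    by apply/andP; split; lra.
  have {key} : `|(g p).2 - (g q).2| < t.
    by move: key; rewrite normrM (gtr0_norm k0) ltr_pM2l.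
  rewrite ltr_norml => /andP[y1 y2].
  have cd2 : c.2 = d.2.
    have : c.2%:~R < d.2%:~R + 1 :> R by lra.
    have : d.2%:~R < c.2%:~R + 1 :> R by lra.
    by rewrite -!intrD1 !ltr_int; clear; lia.
  have : `|g p - g q| <= 1.
    rewrite cd1 in c1; rewrite cd2 in c2.
    have aux (e x y : R) : e + t <= x <= e + 1 - t -> e + t <= y <= e + 1 - t ->
        `|x - y| <= 1.
      move=> ex ey; rewrite ler_norml; clear -ex ey t0; lra.
    by rewrite plane_norm_le (aux _ _ _ c1 d1) (aux _ _ _ c2 d2).
  have := gclose p; have := gclose q.
  have := ler_distD (g p) p q; have := ler_distD (g q) (g p) q.
  rewrite (distrC p (g p)); clear; lra.
Qed.

(** Total disconnectedness in a uniform form: partitions into small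
    pieces at a positive distance from each other, recorded by a labelling. *)
Definition totally_split C : Prop := forall e : R, 0 < e ->
  exists (lab : plane -> nat) (d : R), 0 < d /\ forall p q, C p -> C q ->
    (`|p - q| <= d -> lab p = lab q) /\ (lab p = lab q -> `|p - q| <= e).

Lemma totally_split_bilip C g g' : bilip g g' -> totally_split C ->
  totally_split (g @` C).
Proof.
move=> [gK _ [k k0 gk] [l l0 gl]] sC e e0.
have [|lab [d [d0 h]]] := sC (e / k); first exact: divr_gt0.
exists (lab \o g'), (d / l); split; first exact: divr_gt0.
move=> _ _ [p Cp <-] [q Cq <-]; have [h1 h2] := h _ _ Cp Cq; split=> /=.
  rewrite !gK ler_pdivlMr // => pq; apply: h1.
  by have := gl (g p) (g q); rewrite !gK mulrC => /le_trans; apply.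
rewrite !gK => /h2; rewrite ler_pdivlMr // => pq.
by apply: le_trans (gk _ _) _; rewrite mulrC.
Qed.

Lemma scale_bilip (m : R) : 0 < m -> bilip (fun p => m *: p) (fun p => m^-1 *: p).
Proof.
move=> m0; split=> [p|p||]; rewrite ?scalerA ?mulVf ?mulfV ?scale1r ?gt_eqF //.
  by exists m => // p q; rewrite -scalerBr normrZ gtr0_norm.
exists m^-1; rewrite ?invr_gt0 // => p q.
by rewrite -scalerBr normrZ gtr0_norm // invr_gt0.
Qed.

(** Rescale so that cells are smaller than the distance between different pieces
    of a fine partition.  Then linked cells meet the same piece, so clusters are
    hardly larger than pieces. *)
Lemma separating_stage C (e : R) : compact C -> totally_split C -> 0 < e ->
  exists g g', [/\ bilip g g', forall p, `|g p - p| <= e &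
    forall p q, C p -> C q -> (g p).1 = (g q).1 -> `|p - q| <= e].
Proof.
move=> cC sC e0; pose e1 := e / 16; have e10 : 0 < e1 by rewrite divr_gt0.
have [lab [d [d0 hlab]]] := sC _ e10.
pose m := Num.min d e1; have m0 : 0 < m by rewrite lt_min d0.
have md : m <= d by rewrite ge_min lexx.
have me : m <= e1 by rewrite ge_min lexx orbT.
have sb := scale_bilip m0; have sb' := bilip_sym sb.
pose C' := (fun p => m^-1 *: p) @` C.
have cC' : compact C'.
  apply: continuous_compact cC; apply: continuous_subspaceT.
  by case: sb' => _ _ [k _ /lip_continuous].
have C'P p : C' p -> C (m *: p).
  by move=> [q Cq <-]; rewrite scalerA mulfV ?scale1r // gt_eqF.
have normm p : `|m *: p| = m * `|p| by rewrite normrZ gtr0_norm.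
have step p q c : C' p -> C' q -> in_cell c p -> in_cell c q ->
    lab (m *: p) = lab (m *: q).
  move=> Cp Cq /andP[/andP[p1 p2] /andP[p3 p4]] /andP[/andP[q1 q2] /andP[q3 q4]].
  apply: (hlab _ _ (C'P _ Cp) (C'P _ Cq)).1.
  rewrite -scalerBr normm; apply: le_trans md; rewrite ger_pMr //.
  by rewrite plane_norm_le !ler_norml /=; apply/andP; split; lra.
pose M := (Num.truncn (e1 / m)).+2.
have ME : e1 / m + 1 <= M%:R.
  by rewrite /M -natr1 lerD2r ltW // truncnS_gt.
have ME' : M%:R <= e1 / m + 2.
  have : (Num.truncn (e1 / m))%:R <= e1 / m by rewrite truncn_le ltW // divr_gt0.
  by rewrite /M -!natr1; lra.
have linkM a c : link (touch C') a c ->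
    (absz (c.1 - a.1)%R <= M)%N /\ (absz (c.2 - a.2)%R <= M)%N.
  move=> ac.
  have : a = c \/ exists p q, [/\ C' p, C' q, in_cell a p, in_cell c q &
      lab (m *: p) = lab (m *: q)].
    elim: ac => [|b b' _ IH _ [r Cr /andP[rb rb']]]; first by left.
    right; case: IH => [->|[p [q [Cp Cq pa qb E]]]]; first by exists r, r.
    by exists p, r; split=> //; rewrite E; exact: step qb rb.
  case=> [->|[p [q [Cp Cq]]]]; first by rewrite !subrr.
  move=> /andP[pa1 pa2] /andP[qc1 qc2] E.
  have := (hlab _ _ (C'P _ Cp) (C'P _ Cq)).2 E.
  rewrite -scalerBr normm mulrC -ler_pdivlMr // plane_norm_le /=.
  move=> /andP[h1 h2].
  have aux (k l : int) (x y : R) : unit1 k x -> unit1 l y ->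
      `|x - y| <= e1 / m -> (absz (l - k)%R <= M)%N.
    move=> /andP[x1 x2] /andP[y1 y2]; rewrite ler_norml => /andP[h3 h4].
    have : (k <= l + M%:Z)%R && (l <= k + M%:Z)%R.
      by rewrite -!(ler_int R) !intrD; lra.
    by clear; lia.
  by split; [exact: aux pa1 qc1 h1|exact: aux pa2 qc2 h2].
have [g [g' [gg' gclose gsep]]] := grid_separate cC' linkM.
have mM : m * (M%:R * 4 + 3) <= e.
  have : m * (M%:R * 4 + 3) <= m * ((e1 / m + 2) * 4 + 3).
    by rewrite ler_wpM2l ?(ltW m0) //; lra.
  have -> : m * ((e1 / m + 2) * 4 + 3) = 4 * e1 + 11 * m.
    by field; rewrite gt_eqF.
  by rewrite /e1 in me *; lra.
exists ((fun p => m *: p) \o (g \o (fun p => m^-1 *: p))),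
  (((fun p => m *: p) \o g') \o (fun p => m^-1 *: p)); split.
- by apply: bilip_comp => //; exact: bilip_comp.
- move=> p /=; have {2}-> : p = m *: (m^-1 *: p).
    by rewrite scalerA mulfV ?scale1r // gt_eqF.
  rewrite -scalerBr normm; apply: le_trans mM; rewrite ler_wpM2l ?(ltW m0) //.
  apply: le_trans (gclose _) _.
  by have : 0 <= M%:R :> R by []; lra.
- move=> p q Cp Cq /= /(mulfI (lt0r_neq0 m0)) h.
  have C'p : C' (m^-1 *: p) by exists p.
  have C'q : C' (m^-1 *: q) by exists q.
  have := gsep _ _ C'p C'q h; rewrite -scalerBr normrZ gtr0_norm ?invr_gt0 //.
  by rewrite mulrC ler_pdivrMr // mulrC => /le_trans; apply.
Qed.
End Stage.

(** * Flattening totally disconnected compact sets *)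

Section Flatten.
Variable R : realType.
Local Notation plane := (R * R)%type.
Implicit Types (p q w : plane) (C V T : set plane).

Lemma compact_positive (X : topologicalType) (T : set X) (f : X -> R) :
  compact T -> continuous f -> (forall x, T x -> 0 < f x) ->
  exists2 r, 0 < r & forall x, T x -> r < f x.
Proof.
move=> /compact_near_coveringP cT cf f0.
have := cT R (0 : R)^'+ (fun r t => r < f t) _.
case.
  move=> t /f0 ft; have ft2 : 0 < f t / 2 by rewrite divr_gt0.
  exists ([set z | f t / 2 < f z], [set r : R | r < f t / 2]) => /=.
    split; last exact: nbhs_right_lt.
    have /cvgrPdist_lt/(_ _ ft2) := cf t.
    by apply: filterS => z; rewrite ltr_norml => /andP[h1 h2] /=; lra.
  by move=> [z r] /= [h1 h2]; exact: lt_trans h2 h1.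
move=> r /= r0 h; exists (r / 2); first by rewrite divr_gt0.
have r2 : 0 < r / 2 by rewrite divr_gt0.
by apply: h => //; rewrite /ball /= sub0r normrN gtr0_norm //; lra.
Qed.

Lemma injective_margin C (f : plane -> R) (e : R) : compact C ->
  continuous f -> 0 < e ->
  (forall p q, C p -> C q -> f p = f q -> `|p - q| <= e) ->
  exists2 r, 0 < r & forall p q, C p -> C q -> `|f p - f q| <= r -> `|p - q| <= 2 * e.
Proof.
move=> cC cf e0 fC.
pose T : set (plane * plane) := (C `*` C) `&` [set x | 2 * e <= `|x.1 - x.2|].
have cT : compact T.
  apply: compact_closedI; first exact: compact_setX.
  apply: (@preimage_closed _ _ (fun x : plane * plane => `|x.1 - x.2|)
    [set y | 2 * e <= y]); last exact: closed_ge.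
  move=> x _; apply: (@continuous_comp _ _ _ (fun x : plane * plane => x.1 - x.2)
    (fun z : plane => `|z|)); last exact: norm_continuous.
  by apply: cvgB; [exact: cvg_fst|exact: cvg_snd].
have [|x [[C1 C2] h]|r r0 rT] :=
    @compact_positive _ T (fun x => `|f x.1 - f x.2|) cT.
- move=> x; apply: (@continuous_comp _ _ _ (fun x : plane * plane => f x.1 - f x.2)
    (fun z : R => `|z|)); last exact: norm_continuous.
  apply: cvgB.
    by apply: (@continuous_comp _ _ _ (fst : plane * plane -> plane) f);
      [exact: cvg_fst|exact: cf].
  by apply: (@continuous_comp _ _ _ (snd : plane * plane -> plane) f);
    [exact: cvg_snd|exact: cf].
- rewrite normr_gt0 subr_eq0; apply/eqP => /(fC _ _ C1 C2).
  by rewrite /= in h; lra.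
- exists r => // p q Cp Cq fr; rewrite leNgt; apply/negP => h.
  have /rT : T (p, q) by split=> //=; exact: ltW.
  by rewrite /= ltNge fr.
Qed.

(** A homeomorphism, its inverse, and a bound for the total distance by which the
    later ones may still differ from it. *)
Definition embedding_stage : Type :=
  {x : (plane -> plane) * (plane -> plane) * R | bilip x.1.1 x.1.2 /\ 0 < x.2}.

(** The new bound [e'] is so small that two points of [C] which the previous
    homeomorphism sends more than [2 * 2^-1 ^+ n] apart will have distinct first
    coordinates even in the limit. *)
Definition refines C (n : nat) (x y : embedding_stage) : Prop :=
  let: (G, G', e) := sval x in let: (H, H', e') := sval y in
  [/\ forall p, `|H p - G p| <= e / 2, forall p, `|H' p - G' p| <= 2^-1 ^+ n,
      e' <= e / 2 &
      forall p q, C p -> C q -> `|(H p).1 - (H q).1| <= 2 * e' ->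
        `|G p - G q| <= 2 * 2^-1 ^+ n].

Lemma refines_ex C n x : compact C -> totally_split C ->
  exists y, refines C n x y.
Proof.
move=> cC sC; case: x => -[[G G'] e] /= [b e0].
have [GK G'K [k k0 Gk] [l l0 Gl]] := b.
have cG : continuous G := lip_continuous Gk.
have cGC : compact (G @` C).
  by apply: continuous_compact cC; exact: continuous_subspaceT.
have h2 : 0 < 2^-1 ^+ n :> R by rewrite exprn_gt0 // invr_gt0.
pose d := Num.min (e / 2) (Num.min (2^-1 ^+ n) (2^-1 ^+ n / l)).
have d0 : 0 < d by rewrite !lt_min !divr_gt0 // h2.
have d1 : d <= e / 2 by rewrite ge_min lexx.
have d2 : d <= 2^-1 ^+ n by rewrite !ge_min lexx !orbT.
have d3 : d <= 2^-1 ^+ n / l by rewrite !ge_min lexx !orbT.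
have [g [g' [gg' gd gC]]] := separating_stage cGC (totally_split_bilip b sC) d0.
have [gK g'K [m m0 gm] _] := gg'.
have cg1 : continuous (fun p => (g p).1).
  move=> p; apply: (@continuous_comp _ _ _ g fst); first exact: (lip_continuous gm).
  exact: cvg_fst.
have [r r0 hr] := injective_margin cGC cg1 d0 gC.
pose e' := Num.min (e / 2) (r / 2).
have e'0 : 0 < e' by rewrite lt_min !divr_gt0.
have b' : bilip (g \o G, G' \o g', e').1.1 (g \o G, G' \o g', e').1.2.
  exact: bilip_comp.
exists (exist _ (g \o G, G' \o g', e') (conj b' e'0)); split=> /=.
- by move=> p; exact: le_trans (gd _) d1.
- move=> p; apply: le_trans (Gl _ _) _; rewrite mulrC -ler_pdivlMr //.
  by apply: le_trans d3; have := gd (g' p); rewrite g'K distrC.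
- by rewrite ge_min lexx.
- move=> p q Cp Cq h; have e'r : e' <= r / 2 by rewrite ge_min lexx orbT.
  have Gp : (G @` C) (G p) by exists p.
  have Gq : (G @` C) (G q) by exists q.
  have := hr _ _ Gp Gq; move: h; move: (`|_|) => z zr /(_ _); move: (`|_|) => t.
  by have h : z <= r by [lra]; move=> /(_ h); lra.
Qed.

Lemma halves_small (e : R) : 0 < e -> exists N, 2^-1 ^+ N < e.
Proof.
move=> e0; have : (fun n => 2^-1 ^+ n) @ \oo --> (0 : R).
  by apply: cvg_expr; rewrite ger0_norm //; lra.
move=> /cvgrPdist_lt/(_ _ e0)[N _ hN]; exists N; have := hN N (leqnn _).
by rewrite sub0r normrN; exact: le_lt_trans (ler_norm _).
Qed.

(** The limit of a sequence of refinements.  Both the maps and their inverses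
    converge uniformly, so the limit is a homeomorphism; two points with the same
    first coordinate in the limit are arbitrarily close at all stages. *)
Theorem flatten_totally_split C : compact C -> totally_split C ->
  exists h h' : plane -> plane, [/\ cancel h h', cancel h' h, continuous h,
    continuous h' & forall p q, C p -> C q -> (h p).1 = (h q).1 -> p = q].
Proof.
move=> cC sC.
have step (n : nat) := choice (fun x => @refines_ex C n x cC sC).
pose next n := projT1 (step n).
have nextP n y : refines C n y (next n y) by exact: projT2 (step n) y.
pose start : (plane -> plane) * (plane -> plane) * R := (id, id, 1).
have x0 : bilip start.1.1 start.1.2 /\ 0 < start.2.
  by split=> //; exact: bilip_id.
pose x := fix x n : embedding_stage :=
  if n is n'.+1 then next n' (x n') else exist _ start x0.
pose G n := (sval (x n)).1.1; pose G' n := (sval (x n)).1.2.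
pose e n := (sval (x n)).2.
have b n : bilip (G n) (G' n) by case: (svalP (x n)).
have e0 n : 0 < e n by case: (svalP (x n)).
have xP n : [/\ forall p, `|G n.+1 p - G n p| <= e n / 2,
    forall p, `|G' n.+1 p - G' n p| <= 2^-1 ^+ n, e n.+1 <= e n / 2 &
    forall p q, C p -> C q -> `|(G n.+1 p).1 - (G n.+1 q).1| <= 2 * e n.+1 ->
      `|G n p - G n q| <= 2 * 2^-1 ^+ n].
  have := nextP n (x n); rewrite /refines /G /G' /e /=.
  by case: (sval (x n)) => -[? ?] ?; case: (sval (next n (x n))) => -[? ?] ?.
have eh n : e n <= 2^-1 ^+ n.
  elim: n => [|n IH]; first by rewrite expr0.
  by have [_ _ h _] := xP n; rewrite exprS; lra.
have h0 n : 0 < 2^-1 ^+ n :> R by rewrite exprn_gt0 // invr_gt0.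
have GG n m p : (n <= m)%N -> `|G m p - G n p| <= e n.
  move=> /subnK <-; apply: (@le_trans _ _ (e n - e (m - n + n)%N)); last first.
    by rewrite gerBl ltW.
  elim: (m - n)%N => [|k IH]; first by rewrite !subrr normr0.
  have [h _ h' _] := xP (k + n)%N; have := h p.
  by have := ler_distD (G (k + n)%N p) (G (k.+1 + n)%N p) (G n p); rewrite -addSn in h' *; lra.
have G'G' n m p : (n <= m)%N -> `|G' m p - G' n p| <= 2 * 2^-1 ^+ n.
  move=> /subnK <-.
  apply: (@le_trans _ _ (2 * 2^-1 ^+ n - 2 * 2^-1 ^+ (m - n + n)%N)); last first.
    by rewrite gerBl mulr_ge0 // ltW.
  elim: (m - n)%N => [|k IH]; first by rewrite !subrr normr0.
  have [_ h _ _] := xP (k + n)%N; have := h p.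
  have := ler_distD (G' (k + n)%N p) (G' (k.+1 + n)%N p) (G' n p).
  by rewrite addSn exprS; lra.
have small (eps : R) : 0 < eps -> exists N, e N < eps.
  by move=> /halves_small[N hN]; exists N; exact: le_lt_trans (eh N) hN.
have small2 (eps : R) : 0 < eps -> exists N, 2 * 2^-1 ^+ N < eps.
  move=> eps0; have [|N hN] := @halves_small (eps / 2); first by rewrite divr_gt0.
  by exists N; lra.
have [h hP] := choice (fun p => plane_cauchy_limit small (fun n m nm => GG n m p nm)).
have [h' h'P] := choice (fun p => plane_cauchy_limit small2 (fun n m nm => G'G' n m p nm)).
have unif (u : nat -> plane -> plane) (f : plane -> plane) (d : nat -> R) :
    (forall eps : R, 0 < eps -> exists N, d N < eps) -> (forall n, continuous (u n)) ->
    (forall p n, `|f p - u n p| <= d n) -> continuous f.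
  move=> ds cu fu p; apply/plane_continuousP => eps eps0.
  have eps3 : 0 < eps / 3 by rewrite divr_gt0.
  have [N hN] := ds _ eps3.
  have [r r0 hr] := iffLR (plane_continuousP (u N) p) (cu N p) _ eps3.
  exists r => // q /hr pq; have := fu p N; have := fu q N; rewrite (distrC (f q)).
  have := ler_distD (u N p) (f p) (f q); have := ler_distD (u N q) (u N p) (f q).
  by lra.
have ch : continuous h.
  apply: (unif G _ e small _ hP) => n; by case: (b n) => _ _ [k _ /lip_continuous].
have ch' : continuous h'.
  apply: (unif G' _ _ small2 _ h'P) => n; by case: (b n) => _ _ _ [k _ /lip_continuous].
have limit (f : plane -> plane) (u : nat -> plane) (z l : plane) (d d' : nat -> R) :
    (forall eps : R, 0 < eps -> exists N, forall n, (N <= n)%N -> d n < eps) ->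
    (forall eps : R, 0 < eps -> exists N, forall n, (N <= n)%N -> d' n < eps) ->
    continuous f -> (forall n, `|z - u n| <= d n) ->
    (forall n, `|f (u n) - l| <= d' n) -> f z = l.
  move=> ds ds' cf zu fl; apply/eqP; rewrite -subr_eq0 -normr_le0 leNgt.
  apply/negP => l0; have l2 : 0 < `|f z - l| / 2 by rewrite divr_gt0.
  have [r r0 hr] := iffLR (plane_continuousP f z) (cf z) _ l2.
  have [N hN] := ds _ r0; have [N' hN'] := ds' _ l2.
  have := hN (maxn N N') (leq_maxl _ _); have := hN' (maxn N N') (leq_maxr _ _).
  set m := maxn N N' => dm' dm; have := hr _ (le_lt_trans (zu m) dm).
  by have := fl m; have := ler_distD (f (u m)) (f z) l; lra.
have hmon n m : (n <= m)%N -> 2^-1 ^+ m <= 2^-1 ^+ n :> R.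
  by move=> nm; apply: ler_wiXn2l => //; lra.
have small' (eps : R) : 0 < eps -> exists N, forall n, (N <= n)%N -> e n < eps.
  move=> /halves_small[N hN]; exists N => n /hmon; have := eh n; lra.
have small2' (eps : R) : 0 < eps -> exists N, forall n, (N <= n)%N -> 2 * 2^-1 ^+ n < eps.
  by move=> /small2[N hN]; exists N => n /hmon; lra.
exists h, h'; split=> //.
- move=> p; apply: (limit h' (fun n => G n p) _ _ e (fun n => 2 * 2^-1 ^+ n)) => // n.
  by have := h'P (G n p) n; case: (b n) => ->.
- move=> p; apply: (limit h (fun n => G' n p) _ _ (fun n => 2 * 2^-1 ^+ n) e) => // n.
  by have := hP (G' n p) n; case: (b n) => _ ->.
- move=> p q Cp Cq hpq.
  have hK : cancel h h'.
    move=> z; apply: (limit h' (fun n => G n z) _ _ e (fun n => 2 * 2^-1 ^+ n)) => // n.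
    by have := h'P (G n z) n; case: (b n) => ->.
  apply: (can_inj hK); apply/eqP; rewrite -subr_eq0 -normr_le0 leNgt.
  apply/negP => l0; have [|N hN] := @halves_small (`|h p - h q| / 4).
    by rewrite divr_gt0.
  have [_ _ eN sep] := xP N.
  have : `|(G N.+1 p).1 - (G N.+1 q).1| <= 2 * e N.+1.
    have := le_trans (plane_norm1 _) (hP p N.+1).
    have := le_trans (plane_norm1 _) (hP q N.+1).
    rewrite /= hpq (distrC _ (G N.+1 p).1).
    by have := ler_distD (h q).1 (G N.+1 p).1 (G N.+1 q).1; lra.
  move=> /(sep _ _ Cp Cq) GN; have := hP p N; have := hP q N.
  have := ler_distD (G N p) (h p) (h q); have := ler_distD (G N q) (G N p) (h q).
  by rewrite (distrC (h q)); have := eh N; lra.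
Qed.
End Flatten.

(** * Embeddings of the Cantor space *)

Section CantorSplit.
Variable R : realType.
Local Notation plane := (R * R)%type.
Local Notation cantor := cantor_space.
Implicit Types (x y : cantor) (f : cantor -> plane).

Definition agree n x y : Prop := forall k, (k < n)%N -> x k = y k.

Lemma bit_nbhs (k : nat) x : nbhs x [set y : cantor | y k = x k].
Proof.
have := @proj_continuous nat (fun=> bool) k x.
by move=> /(_ [set x k]); apply; rewrite /nbhs /= /principal_filter /=.
Qed.

Lemma bit_differ_closed k : closed [set z : cantor * cantor | z.1 k <> z.2 k].
Proof.
rewrite -[X in closed X]setCK; apply: open_closedC; rewrite openE => -[x y] /=.
move=> /contrapT xy.
exists ([set x' : cantor | x' k = x k], [set y' : cantor | y' k = y k]) => /=.
  by split; exact: bit_nbhs.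
by move=> [x' y'] /= [-> ->].
Qed.

Lemma disagree_closed n : closed [set z : cantor * cantor | ~ agree n z.1 z.2].
Proof.
elim: n => [|n IH].
  rewrite (_ : mkset _ = set0) ?eqEsubset; first exact: closed0.
  by split=> z //=; apply.
rewrite (_ : mkset _ = [set z : cantor * cantor | ~ agree n z.1 z.2] `|`
    [set z : cantor * cantor | z.1 n <> z.2 n]).
  by apply: closedU => //; exact: bit_differ_closed.
apply/seteqP; split=> z /=.
  move=> h; have [zn|zn] := pselect (agree n z.1 z.2); [right|by left] => e.
  by apply: h => k; rewrite ltnS leq_eqVlt => /orP[/eqP->//|]; exact: zn.
case=> h a; apply: h; last exact: a.
by move=> k kn; apply: a; exact: ltnW.
Qed.

Lemma cantor2_compact : compact [set: cantor * cantor].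
Proof.
have -> : [set: cantor * cantor] = [set: cantor] `*` [set: cantor].
  by apply/seteqP; split.
by apply: compact_setX; exact: cantor_space_compact.
Qed.

Lemma embed_dist_continuous f : continuous f ->
  continuous (fun z : cantor * cantor => `|f z.1 - f z.2|).
Proof.
move=> cf z; apply: (@continuous_comp _ _ _
    (fun z : cantor * cantor => f z.1 - f z.2) (fun p : plane => `|p|)); last first.
  exact: norm_continuous.
apply: cvgB.
  by apply: (@continuous_comp _ _ _ (fst : cantor * cantor -> cantor) f);
    [exact: cvg_fst|exact: cf].
by apply: (@continuous_comp _ _ _ (snd : cantor * cantor -> cantor) f);
  [exact: cvg_snd|exact: cf].
Qed.

(** Uniform continuity of the inverse of an embedding, and in the next lemma of
    the embedding itself, in terms of common initial segments. *)
Lemma embed_inv_unif f n : continuous f -> injective f ->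
  exists2 d : R, 0 < d & forall x y, `|f x - f y| <= d -> agree n x y.
Proof.
move=> cf fi.
have cT : compact [set z : cantor * cantor | ~ agree n z.1 z.2].
  by apply: subclosed_compact cantor2_compact _ => //; exact: disagree_closed.
have [z /= zn|d d0 dT] := compact_positive cT (embed_dist_continuous cf).
  rewrite normr_gt0 subr_eq0; apply/eqP => /fi E; apply: zn => k _.
  by rewrite E.
exists d => // x y xy; apply: contrapT => h.
by have := dT (x, y) h; rewrite /= ltNge xy.
Qed.

Lemma embed_unif f (e : R) : continuous f -> 0 < e ->
  exists n, forall x y, agree n x y -> `|f x - f y| <= e.
Proof.
move=> cf e0.
pose T : set (cantor * cantor) := [set z | e <= `|f z.1 - f z.2|].
have cT : compact T.
  apply: subclosed_compact cantor2_compact _ => //.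
  apply: (@preimage_closed _ _ (fun z : cantor * cantor => `|f z.1 - f z.2|)
    [set y | e <= y]); last exact: closed_ge.
  by move=> z _; exact: embed_dist_continuous.
have /compact_near_coveringP := cT.
move=> /(_ nat \oo (fun n z => ~ agree n z.1 z.2))[].
  move=> [x y] /= h.
  have [k xyk] : exists k, x k <> y k.
    apply: contrapT => hk; move: h; rewrite /T /=; have -> : x = y.
      by apply/funext => k; apply: contrapT => h; apply: hk; exists k.
    by rewrite subrr normr0; lra.
  exists ([set z : cantor * cantor | z.1 k = x k /\ z.2 k = y k],
    [set n | (k < n)%N]) => /=.
    split; last by exists k.+1.
    exists ([set x' : cantor | x' k = x k], [set y' : cantor | y' k = y k]) => //=.
    by split; exact: bit_nbhs.
  move=> [[x' y'] n] /= [[xk yk] kn] /(_ k kn); rewrite /= xk yk.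
  exact: xyk.
move=> n _ hn; exists n => x y a; rewrite leNgt; apply/negP => h.
by apply: (hn n (leqnn n) (x, y)) => //=; exact: ltW.
Qed.

Lemma embed_totally_split f : continuous f -> injective f ->
  totally_split (range f).
Proof.
move=> cf fi e e0; have [n hn] := embed_unif cf e0.
have [d d0 hd] := embed_inv_unif n cf fi.
have [g gf] : exists g : plane -> cantor, cancel f g.
  have /choice[g gP] : forall p, exists x, range f p -> f x = p.
    move=> p; have [[x _ <-]|h] := pselect (range f p); first by exists x.
    by exists point.
  by exists g => x; apply: fi; apply: gP; exists x.
have codeP x y : choice.pickle [seq x k | k <- iota 0 n] = choice.pickle [seq y k | k <- iota 0 n]
    <-> agree n x y.
  split=> [/(pcan_inj (@choice.pickleK _))/eq_in_map h k kn|h].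
    by apply: h; rewrite mem_iota.
  by congr choice.pickle; apply/eq_in_map => k; rewrite mem_iota => /h.
exists (fun p => choice.pickle [seq g p k | k <- iota 0 n]), d; split=> //.
move=> _ _ [x _ <-] [y _ <-]; rewrite !gf codeP; split; first exact: hd.
exact: hn.
Qed.

Lemma embed_compact f : continuous f -> compact (range f).
Proof.
move=> cf; apply: continuous_compact; last exact: cantor_space_compact.
exact: continuous_subspaceT.
Qed.

Lemma cantor_setP (K : set plane) : is_cantor_set K ->
  exists f : cantor -> plane, [/\ continuous f, injective f & range f = K].
Proof.
move=> [[h h' hK h'K ch ch']].
exists (fun x => set_val (h x)); split.
- move=> x; apply: (@continuous_comp _ _ _ h (set_val : K -> plane)).
    exact: ch.
  exact: initial_continuous.
- move=> x y /val_inj E; by apply: (can_inj hK).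
- apply/seteqP; split=> [_ [x _ <-]|p Kp]; first exact: set_valP.
  exists (h' (exist _ p (mem_set Kp))) => //; by rewrite h'K.
Qed.
End CantorSplit.

(** * Rational functionals on the real line *)

Section Hamel.
Variable R : realType.
Implicit Types (s : seq (rat * R)) (B : set R) (b x y : R) (P : pred R).

(** A list stands for a formal rational combination of real numbers.  It may
    repeat a number, whose coefficient is then the total [weight]. *)
Definition lincomb s : R := \sum_(c <- s) ratr c.1 * c.2.

Definition weight P s : rat := \sum_(c <- s | P c.2) c.1.

Definition over B s : Prop := forall c, c \in s -> B c.2.

Definition independent B : Prop := forall s, over B s -> lincomb s = 0 ->
  forall b, weight (pred1 b) s = 0.

Definition negate s : seq (rat * R) := [seq (- c.1, c.2) | c <- s].

Lemma comb_cat s t : lincomb (s ++ t) = lincomb s + lincomb t.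
Proof. exact: big_cat. Qed.

Lemma comb_negate s : lincomb (negate s) = - lincomb s.
Proof.
rewrite /lincomb big_map /= -sumrN; apply: eq_bigr => c _.
by rewrite rmorphN mulNr.
Qed.

Lemma weight_cat P s t : weight P (s ++ t) = weight P s + weight P t.
Proof. exact: big_cat. Qed.

Lemma weight_negate P s : weight P (negate s) = - weight P s.
Proof. by rewrite /weight big_map /= -sumrN. Qed.

Lemma over_cat B s t : over B s -> over B t -> over B (s ++ t).
Proof. by move=> sB tB c; rewrite mem_cat => /orP[/sB|/tB]. Qed.

Lemma over_negate B s : over B s -> over B (negate s).
Proof. by move=> sB _ /mapP[c cs ->]; exact: sB cs. Qed.

Lemma group_by (V : nmodType) s (F : rat * R -> V) :
  \sum_(c <- s) F c =
  \sum_(b <- undup [seq c.2 | c <- s]) \sum_(c <- s | c.2 == b) F c.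
Proof.
rewrite (exchange_big_dep xpredT) //= big_seq [RHS]big_seq.
apply: eq_bigr => c cs; rewrite (big_rem c.2) /=; last first.
  by rewrite mem_undup map_f.
rewrite eqxx big1_seq ?addr0 // => b /andP[/eqP <-].
by rewrite mem_rem_uniq ?undup_uniq // !inE eqxx.
Qed.

Lemma weight_group P s : weight P s =
  \sum_(b <- undup [seq c.2 | c <- s] | P b) weight (pred1 b) s.
Proof.
rewrite /weight big_mkcond group_by [RHS]big_mkcond; apply: eq_bigr => b _.
case: ifP => Pb; first by apply: eq_bigr => c /eqP ->; rewrite Pb.
by rewrite big1 // => c /eqP ->; rewrite Pb.
Qed.

Lemma comb_group s : lincomb s =
  \sum_(b <- undup [seq c.2 | c <- s]) ratr (weight (pred1 b) s) * b.
Proof.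
rewrite /lincomb group_by; apply: eq_bigr => b _.
rewrite /weight rmorph_sum mulr_suml; apply: eq_bigr => c /eqP <- //.
Qed.

Lemma weight0 P s : (forall b, weight (pred1 b) s = 0) -> weight P s = 0.
Proof. by move=> s0; rewrite weight_group big1. Qed.

Lemma weight_eq B P s t : independent B -> over B s -> over B t ->
  lincomb s = lincomb t -> weight P s = weight P t.
Proof.
move=> iB sB tB E; apply/eqP; rewrite -subr_eq0 -weight_negate -weight_cat.
apply/eqP/weight0/iB; first by apply: over_cat => //; exact: over_negate.
by rewrite comb_cat comb_negate E subrr.
Qed.

Lemma chain_finite (F : set (set R)) s (B0 : set R) : total_on F subset ->
  F !=set0 -> over (\bigcup_(A in F) A `|` B0) s ->
  exists2 A, F A & over (A `|` B0) s.
Proof.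
move=> Ft [A0 FA0]; elim: s => [|c s IH] sF; first by exists A0.
have [|A FA As] := IH; first by move=> d ds; apply: sF; rewrite inE ds orbT.
have [[A' FA' A'c]|B0c] := sF c (mem_head _ _); last first.
  by exists A => // d; rewrite inE => /orP[/eqP->|/As//]; right.
have [AA'|A'A] := Ft _ _ FA FA'.
  exists A' => // d; rewrite inE => /orP[/eqP->|/As[/AA'|]]; by [left|right].
by exists A => // d; rewrite inE => /orP[/eqP->|/As//]; left; exact: A'A.
Qed.

Lemma comb_filter s x :
  lincomb s = ratr (weight (pred1 x) s) * x + lincomb [seq c <- s | c.2 != x].
Proof.
rewrite /lincomb (bigID (fun c : rat * R => c.2 == x)) /= big_filter; congr (_ + _).
by rewrite /weight rmorph_sum mulr_suml; apply: eq_bigr => c /eqP ->.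
Qed.

(** A maximal set among those that are independent together with 1. *)
Lemma hamel_basis : exists B : set R, [/\ B 1, independent B &
  forall x, exists2 s, over B s & lincomb s = x].
Proof.
pose ind := [set A : set R | independent (A `|` [set 1])].
have [|A [Aind Amax]] := @Zorn_bigcup R ind.
  move=> F Find Ft s sF s0 b.
  have [F0|F0] := pselect (F !=set0); last first.
    have i1 : independent [set 1 : R].
      move=> t t1 t0 c; rewrite /weight; move: t0; rewrite /lincomb.
      have E d : d \in t -> d.2 = 1 by exact: t1.
      rewrite big_seq (eq_bigr (fun d => ratr d.1)); last first.
        by move=> d /E ->; rewrite mulr1.
      rewrite -big_seq -rmorph_sum => /eqP; rewrite fmorph_eq0 => /eqP t0.
      have [<-|c1] := eqVneq 1 c.
        rewrite big_seq_cond (eq_bigl (fun d => d \in t)) -?big_seq //.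
        by move=> d; apply: andb_idr => /E -> /=; rewrite eqxx.
      rewrite big_seq_cond big1 // => d /andP[/E -> /eqP h].
      by rewrite h eqxx in c1.
    apply: i1 s0 _ => c /sF[[A0 FA0]|//]; exfalso; apply: F0; by exists A0.
  by have [A FA As] := chain_finite Ft F0 sF; exact: Find FA _ As s0 _.
exists (A `|` [set 1]); split=> //; first by right.
move=> x; apply: contrapT => nx.
have xA : ~ (A `|` [set 1]) x.
  move=> Ax; apply: nx; exists [:: (1, x)].
    by move=> c; rewrite inE => /eqP ->.
  by rewrite /lincomb big_seq1 rmorph1 mul1r.
have : ind (x |` A).
  move=> s sA s0 b.
  pose t := [seq c <- s | c.2 != x].
  have tA : over (A `|` [set 1]) t.
    move=> c; rewrite mem_filter => /andP[cx /sA[[h|h]|h]]; [|by left|by right].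
    by rewrite h eqxx in cx.
  have := comb_filter s x; rewrite s0 -/t => E.
  have [q0|q0] := eqVneq (weight (pred1 x) s) 0; last first.
    exfalso; apply: nx; set q := weight _ _ in q0 E.
    exists [seq (- q^-1 * c.1, c.2) | c <- t].
      by move=> _ /mapP[c ct ->]; exact: tA ct.
    rewrite /lincomb big_map /= (eq_bigr (fun c => ratr (- q^-1) * (ratr c.1 * c.2))).
      rewrite -mulr_sumr -/(lincomb t); move/esym/eqP: E; rewrite addr_eq0.
      move=> /eqP/(congr1 -%R); rewrite opprK => <-; rewrite rmorphN fmorphV.
      by rewrite mulrNN mulKf // fmorph_eq0.
    by move=> c _; rewrite rmorphM mulrA.
  have [->//|bx] := eqVneq b x.
  have t0 : lincomb t = 0 by move: E; rewrite q0 rmorph0 mul0r add0r.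
  rewrite -(Aind _ tA t0 b) /t /weight big_filter_cond; apply: eq_bigl => c /=.
  by case: eqVneq => [->|]; rewrite ?andbT ?andbF.
apply: Amax; split; first by move=> y Ay; right.
by move=> /(_ x) h; apply: xA; left; apply: h; left.
Qed.

(** The first functional is the coordinate at the basis element 1, and each other
    one sums the coordinates at the further basis elements in a rational interval.
    Given a combination and a basis element in it, some rational interval isolates
    that element from the others, so the functionals detect its coefficient. *)
Lemma separating_functionals : exists l : nat -> R -> rat,
  [/\ forall n x y, l n (x + y) = l n x + l n y, l 0%N 1 = 1,
      forall n, l n.+1 1 = 0 & forall x, (forall n, l n x = 0) -> x = 0].
Proof.
have [B [B1 iB sB]] := hamel_basis.
have /choice[s sP] : forall x, exists s, over B s /\ lincomb s = x.
  by move=> x; have [s] := sB x; exists s.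
pose I n : pred R := if choice.unpickle n is Some (p, q) then
  [pred b | (ratr (p : rat) < b < ratr (q : rat)) && (b != 1)] else pred0.
pose P n : pred R := if n is n'.+1 then I n' else pred1 1.
exists (fun n x => weight (P n) (s x)).
have one n : weight (P n) (s 1) = weight (P n) [:: (1, 1)].
  have [s1 E] := sP 1; apply: weight_eq iB s1 _ _.
    by move=> c; rewrite inE => /eqP ->.
  by rewrite E /lincomb big_seq1 rmorph1 mul1r.
have I1 n : I n 1 = false.
  by rewrite /I; case: choice.unpickle => // -[p q] /=; rewrite eqxx andbF.
split.
- move=> n x y; rewrite -weight_cat.
  have [sx Ex] := sP x; have [sy Ey] := sP y; have [sxy E] := sP (x + y).
  apply: weight_eq iB sxy _ _; first exact: over_cat.
  by rewrite comb_cat Ex Ey E.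
- by rewrite one /weight big_cons big_nil /= eqxx addr0.
- by move=> n; rewrite one /weight big_cons big_nil /= I1.
- move=> x x0; have [sx Ex] := sP x; rewrite -Ex comb_group.
  rewrite big_seq big1 // => b bs; suff -> : weight (pred1 b) (s x) = 0.
    by rewrite rmorph0 mul0r.
  have [->|b1] := eqVneq b 1; first exact: (x0 0%N).
  set u := undup _ in bs.
  have [p [q [pb bq pq]]] : exists p q : rat, [/\ ratr p < b, b < ratr q &
      forall c, c \in u -> ratr p < c < ratr q -> c = b].
    elim: (u) => [|c v [p [q [pb bq pq]]]].
      have [|p] := @rat_in_itvoo R (b - 1) (b); first by rewrite gtrBl.
      have [|q] := @rat_in_itvoo R (b) (b + 1); first by rewrite ltrDl.
      rewrite !in_itv /= => /andP[q1 _] /andP[_ p1].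
      by exists p, q; split.
    have [cb|cb|->] := ltgtP c b; last first.
    - by exists p, q; split=> // d; rewrite inE => /orP[/eqP->//|]; exact: pq.
    - have [|q'] := @rat_in_itvoo R (b) (Num.min c (ratr q)).
        by rewrite lt_min cb bq.
      rewrite in_itv /= lt_min => /andP[bq' /andP[q'c q'q]].
      exists p, q'; split=> // d; rewrite inE => /orP[/eqP->|dv] /andP[pd dq].
        by have := lt_trans dq q'c; rewrite ltxx.
      by apply: pq => //; rewrite pd (lt_trans dq).
    - have [|p'] := @rat_in_itvoo R (Num.max c (ratr p)) (b).
        by rewrite gt_max cb pb.
      rewrite in_itv /= gt_max => /andP[/andP[cp' pp'] p'b].
      exists p', q; split=> // d; rewrite inE => /orP[/eqP->|dv] /andP[pd dq].
        by have := lt_trans cp' pd; rewrite ltxx.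
      by apply: pq => //; rewrite dq (lt_trans pp').
  have := x0 (choice.pickle (p, q)).+1.
  rewrite weight_group -/u /P /I choice.pickleK /= (big_rem b) //= pb bq b1 /=.
  rewrite big1_seq ?addr0 // => c /andP[/andP[cpq c1]].
  rewrite mem_rem_uniq ?undup_uniq // !inE => /andP[cb cu].
  by rewrite (pq c cu cpq) eqxx in cb.
Qed.
End Hamel.

(** * Countable dense orders *)

Section BackAndForth.
Implicit Types X Y : Type.
Local Notation In := List.In.

Lemma In_map X Y (f : X -> Y) (l : seq X) (y : Y) :
  In y (map f l) <-> exists2 x, In x l & f x = y.
Proof.
elim: l => [|x l IH] /=; first by split=> // -[].
split=> [[<-|/IH[z zl <-]]|[z [->|zl] E]]; first by exists x; auto.
- by exists z; auto.
- by left.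
- by right; apply/IH; exists z.
Qed.

Definition dense_order X (lt : X -> X -> Prop) : Prop :=
  [/\ forall x, ~ lt x x, forall x y z, lt x y -> lt y z -> lt x z,
      forall x y, lt x y \/ x = y \/ lt y x,
      forall x y, lt x y -> exists2 z, lt x z & lt z y &
      forall x, (exists y, lt x y) /\ (exists y, lt y x)].

Lemma dense_max X (lt : X -> X -> Prop) (a : X) (A : list X) : dense_order lt ->
  exists m, In m (a :: A) /\ forall b, In b (a :: A) -> b = m \/ lt b m.
Proof.
move=> [irr tr tot _ _]; elim: A a => [|b A IH] a.
  by exists a; split=> [|b [->|//]]; left.
have [m [mA mb]] := IH b; have [am|[am|ma]] := tot a m.
- exists m; split; first by right.
  by move=> c [<-|/mb//]; right.
- exists m; split; first by right.
  by move=> c [<-|/mb//]; left.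
- exists a; split; first by left.
  move=> c [<-|/mb[->|cm]]; [by left|by right|right; exact: tr cm ma].
Qed.

Lemma dense_min X (lt : X -> X -> Prop) (a : X) (A : list X) : dense_order lt ->
  exists m, In m (a :: A) /\ forall b, In b (a :: A) -> b = m \/ lt m b.
Proof.
move=> [irr tr tot d e].
have := @dense_max X (fun x y => lt y x) a A; apply.
split=> //.
- by move=> x y z yx zy; exact: tr zy yx.
- by move=> x y; case: (tot x y) => [|[]]; auto.
- by move=> x y yx; have [z] := d _ _ yx; exists z.
- by move=> x; have [? ?] := e x.
Qed.

Lemma dense_between X (lt : X -> X -> Prop) (x0 : X) (A B : list X) :
  dense_order lt -> (forall a b, In a A -> In b B -> lt a b) ->
  exists z, (forall a, In a A -> lt a z) /\ (forall b, In b B -> lt z b).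
Proof.
move=> dX; have [irr tr tot d e] := dX.
case: A => [|a A]; case: B => [|b B] AB.
- by exists x0.
- have [m [mB mb]] := dense_min b B dX; have [_ [z zm]] := e m.
  by exists z; split=> // c /mb[->//|mc]; exact: tr zm mc.
- have [m [mA mb]] := dense_max a A dX; have [[z zm] _] := e m.
  by exists z; split=> // c /mb[->//|mc]; exact: tr mc zm.
- have [m [mA ma]] := dense_max a A dX; have [n [nB nb]] := dense_min b B dX.
  have [z mz zn] := d _ _ (AB _ _ mA nB); exists z; split.
    by move=> c /ma[->//|cm]; exact: tr cm mz.
  by move=> c /nb[->//|nc]; exact: tr zn nc.
Qed.

Definition partial_iso X Y (ltX : X -> X -> Prop) (ltY : Y -> Y -> Prop)
    (l : list (X * Y)) : Prop :=
  forall p q, In p l -> In q l -> ltX p.1 q.1 <-> ltY p.2 q.2.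

Lemma partial_iso_extend X Y (ltX : X -> X -> Prop) (ltY : Y -> Y -> Prop)
    (y0 : Y) (l : list (X * Y)) (x : X) :
  dense_order ltX -> dense_order ltY -> partial_iso ltX ltY l ->
  exists y, partial_iso ltX ltY ((x, y) :: l).
Proof.
move=> dX dY gl; have [irrX trX totX _ _] := dX; have [irrY trY totY _ _] := dY.
have [[p pl px]|nx] := pselect (exists2 p, In p l & p.1 = x).
  exists p.2; rewrite -px -surjective_pairing => q r [<-|ql] [<-|rl];
  by apply: gl.
pose A := [seq p.2 | p <- l & `[< ltX p.1 x >]].
pose B := [seq p.2 | p <- l & `[< ltX x p.1 >]].
have inA a : In a A <-> exists2 p, In p l & ltX p.1 x /\ p.2 = a.
  rewrite /A; elim: (l) => [|p l' IH] /=; first by split=> // -[].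
  case: asboolP => px /=.
    split; first by case=> [<-|/IH[q ql [qx qa]]]; [exists p|exists q]; auto.
    case=> q [<-|ql] [qx qa]; first by left.
    by right; apply/IH; exists q.
  split; first by case/IH => q ql [qx qa]; exists q; auto.
  by case=> q [<-|ql] [qx qa] //; apply/IH; exists q.
have inB a : In a B <-> exists2 p, In p l & ltX x p.1 /\ p.2 = a.
  rewrite /B; elim: (l) => [|p l' IH] /=; first by split=> // -[].
  case: asboolP => px /=.
    split; first by case=> [<-|/IH[q ql [qx qa]]]; [exists p|exists q]; auto.
    case=> q [<-|ql] [qx qa]; first by left.
    by right; apply/IH; exists q.
  split; first by case/IH => q ql [qx qa]; exists q; auto.
  by case=> q [<-|ql] [qx qa] //; apply/IH; exists q.
have [|y [yA yB]] := @dense_between Y ltY y0 A B dY.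
  move=> a b /inA[p pl [px <-]] /inB[q ql [qx <-]].
  by apply/gl => //; exact: trX px qx.
have side p : In p l -> (ltX p.1 x /\ ltY p.2 y) \/ (ltX x p.1 /\ ltY y p.2).
  move=> pl; case: (totX p.1 x) => [px|[px|px]].
  - by left; split=> //; apply/yA/inA; exists p.
  - by exfalso; apply: nx; exists p.
  - by right; split=> //; apply/yB/inB; exists p.
exists y => p q [<-|pl] [<-|ql] /=; last exact: gl.
- by split=> [/irrX|/irrY].
- case: (side _ ql) => -[h1 h2]; last by split.
  split=> h; first by case: (irrX _ (trX _ _ _ h h1)).
  by case: (irrY _ (trY _ _ _ h h2)).
- case: (side _ pl) => -[h1 h2]; first by split.
  split=> h; first by case: (irrX _ (trX _ _ _ h h1)).
  by case: (irrY _ (trY _ _ _ h h2)).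
Qed.

(** Cantor's theorem: extend partial isomorphisms alternately to the next element
    of either enumeration. *)
Theorem cantor_back_and_forth X Y (ltX : X -> X -> Prop) (ltY : Y -> Y -> Prop)
    (eX : nat -> X) (eY : nat -> Y) :
  (forall x, exists n, eX n = x) -> (forall y, exists n, eY n = y) ->
  dense_order ltX -> dense_order ltY ->
  exists f : X -> Y, (forall y, exists x, f x = y) /\
    forall x x', ltX x x' <-> ltY (f x) (f x').
Proof.
move=> sX sY dX dY.
have [irrX _ totX _ _] := dX; have [irrY _ totY _ _] := dY.
have step (n : nat) : forall l, exists l', partial_iso ltX ltY l ->
    [/\ partial_iso ltX ltY l', forall p, In p l -> In p l',
        exists y, In (eX n, y) l' & exists x, In (x, eY n) l'].
  move=> l; have [gl|gl] := pselect (partial_iso ltX ltY l); last first.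
    by exists l => /gl.
  have [y gy] := partial_iso_extend (eY 0%N) (eX n) dX dY gl.
  set l1 := (eX n, y) :: l in gy.
  have g1 : partial_iso ltY ltX [seq (p.2, p.1) | p <- l1].
    by move=> _ _ /In_map[p pl <-] /In_map[q ql <-] /=; split=> /gy;
      apply.
  have [x gx] := partial_iso_extend (eX 0%N) (eY n) dY dX g1.
  exists ((x, eY n) :: l1) => _; split.
  - move=> p q pl ql.
    have sw (r : X * Y) : In r ((x, eY n) :: l1) ->
        In (r.2, r.1) ((eY n, x) :: [seq (p.2, p.1) | p <- l1]).
      case=> [<-|rl]; first by left.
      by right; apply/In_map; exists r.
    by have := gx _ _ (sw _ pl) (sw _ ql) => /= h; split=> /h.
  - by move=> p pl; right; right.
  - by exists y; right; left.
  - by exists x; left.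
have [next nextP] := choice (fun nl : nat * list (X * Y) => step nl.1 nl.2).
pose l := fix l n := if n is n'.+1 then next (n', l n') else [::].
have gl n : partial_iso ltX ltY (l n).
  elim: n => [|n IH]; first by move=> p q [].
  by have [] := nextP (n, l n) IH.
have lS n : [/\ forall p, In p (l n) -> In p (l n.+1),
    exists y, In (eX n, y) (l n.+1) & exists x, In (x, eY n) (l n.+1)].
  by have [] := nextP (n, l n) (gl n).
have lmon n m p : (n <= m)%N -> In p (l n) -> In p (l m).
  move=> /subnK <-; elim: (m - n)%N => // k IH /IH.
  by have [h _ _] := lS (k + n)%N; exact: h.
have /choice[f fP] : forall x, exists y, exists n, In (x, y) (l n).
  move=> x; have [n <-] := sX x; have [_ [y hy] _] := lS n.
  by exists y, n.+1.
have iso p q n m : In p (l n) -> In q (l m) -> ltX p.1 q.1 <-> ltY p.2 q.2.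
  by move=> /(lmon _ (maxn n m)) pl /(lmon _ (maxn n m)) ql; apply: (gl (maxn n m));
    [apply: pl; exact: leq_maxl|apply: ql; exact: leq_maxr].
have mono x x' : ltX x x' <-> ltY (f x) (f x').
  have [n hn] := fP x; have [m hm] := fP x'.
  exact: (iso (x, f x) (x', f x') n m).
exists f; split=> // y; have [n <-] := sY y.
have [_ _ [x hx]] := lS n; exists x; have [m hm] := fP x.
have := iso _ _ _ _ hx hm; have := iso _ _ _ _ hm hx => /= h1 h2.
case: (totY (f x) (eY n)) => [/h1/irrX//|[//|/h2/irrX//]].
Qed.

Lemma countable_enum X (g : X -> nat) (x0 : X) : injective g ->
  exists e : nat -> X, forall x, exists n, e n = x.
Proof.
move=> gi; have /choice[e eP] : forall n, exists x, (exists x', g x' = n) -> g x = n.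
  move=> n; have [[x' <-]|h] := pselect (exists x', g x' = n); first by exists x'.
  by exists x0.
by exists e => x; exists (g x); apply/gi/eP; exists x.
Qed.
End BackAndForth.

(** * Gaps of a Cantor set in the line *)

Lemma sval_inj (T : Type) (P : T -> Prop) : injective (@sval T P).
Proof. by move=> [x p] [y q] /= E; subst y; rewrite (Prop_irrelevance p q). Qed.

Section GapIndex.

(** A countable dense order with an action of [Q * Q^N] by automorphisms.  The first
    factor translates the first component.  The fibers are a least point followed
    by countably many copies of [rat], each translated by its own factor. *)
Definition gapindex : Type := (rat * option (nat * rat))%type.

Definition lt_fiber (w w' : option (nat * rat)) : Prop :=
  match w, w' with
  | None, Some _ => True
  | Some a, Some b => (a.1 < b.1)%N \/ (a.1 = b.1 /\ a.2 < b.2)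
  | _, None => False
  end.

Definition lt_index (i j : gapindex) : Prop :=
  i.1 < j.1 \/ (i.1 = j.1 /\ lt_fiber i.2 j.2).

Lemma lt_fiber_irr w : ~ lt_fiber w w.
Proof. by case: w => [[n q]|] //= -[|[_]]; rewrite ?ltnn ?ltxx. Qed.

Lemma lt_fiber_trans a b c : lt_fiber a b -> lt_fiber b c -> lt_fiber a c.
Proof.
case: a => [[n q]|]; case: b => [[m r]|]; case: c => [[k s]|] //=.
move=> [h1|[-> h1]] [h2|[<- h2]].
- by left; exact: ltn_trans h1 h2.
- by left.
- by left.
- by right; split=> //; exact: lt_trans h1 h2.
Qed.

Lemma lt_fiber_total a b : lt_fiber a b \/ a = b \/ lt_fiber b a.
Proof.
case: a => [[n q]|]; case: b => [[m r]|] //=; auto.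
have [h|h|->] := ltngtP n m; auto.
by have [h|h|->] := ltgtP q r; auto.
Qed.

Lemma lt_index_irr i : ~ lt_index i i.
Proof. by case=> [|[_ /lt_fiber_irr]]; rewrite ?ltxx. Qed.

Lemma lt_index_trans i j k : lt_index i j -> lt_index j k -> lt_index i k.
Proof.
case: i j k => [p a] [q b] [r c]; rewrite /lt_index /=.
move=> [h1|[-> h1]] [h2|[<- h2]].
- by left; exact: lt_trans h1 h2.
- by left.
- by left.
- by right; split=> //; exact: lt_fiber_trans h1 h2.
Qed.

Lemma lt_index_total i j : lt_index i j \/ i = j \/ lt_index j i.
Proof.
case: i j => [p a] [q b]; rewrite /lt_index /=.
have [h|h|->] := ltgtP p q; auto.
by case: (lt_fiber_total a b) => [|[->|]]; auto.
Qed.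

(** A fundamental domain of the unit translation.  Its least point is left out so
    that there are no end points: it will correspond to the gap between two
    consecutive translates of the Cantor set. *)
Definition in_domain (i : gapindex) : Prop :=
  0 <= i.1 < 1 /\ i <> (0, None).

Definition domain : Type := {i : gapindex | in_domain i}.

Lemma domain_dense : dense_order (fun i j : domain => lt_index (sval i) (sval j)).
Proof.
split.
- by move=> i; exact: lt_index_irr.
- by move=> i j k; exact: lt_index_trans.
- move=> i j; case: (lt_index_total (sval i) (sval j)) => [|[E|]]; auto.
  by right; left; exact: sval_inj E.
- move=> [[p a] [/= /andP[p0 p1] hp]] [[q b] [/= /andP[q0 q1] hq]] [/= pq|/= [pq ab]].
    have d : in_domain ((p + q) / 2, None).
      by split=> /=; [lra|case; lra].
    by exists (exist _ _ d); left => /=; lra.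
  subst q; case: a b ab hp hq => [[n r]|] [[m s]|] //= h hp hq.
    case: h => [nm|[<- rs]].
      have d : in_domain (p, Some (m, s - 1)) by split=> //=; rewrite p0.
      by exists (exist _ _ d); right; split=> //=; [left|right; split=> //; lra].
    have d : in_domain (p, Some (n, (r + s) / 2)) by split=> //=; rewrite p0.
    by exists (exist _ _ d); right; split=> //=; right; split=> //; lra.
  have d : in_domain (p, Some (m, s - 1)) by split=> //=; rewrite p0.
  by exists (exist _ _ d); right; split=> //=; right; split=> //; lra.
- move=> [[p a] [/= /andP[p0 p1] hp]]; split.
    have d : in_domain ((p + 1) / 2, None).
      by split=> /=; [lra|case; lra].
    by exists (exist _ _ d); left => /=; lra.
  case: a hp => [[n r]|] hp.
    have d : in_domain (p, Some (n, r - 1)) by split=> //=; rewrite p0.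
    by exists (exist _ _ d); right; split=> //=; right; split=> //; lra.
  have p0' : 0 < p by rewrite lt_neqAle p0 andbT; apply/eqP => p0'; apply: hp; rewrite -p0'.
  have d : in_domain (p / 2, None) by split=> /=; [lra|case; lra].
  by exists (exist _ _ d); left => /=; lra.
Qed.

Lemma domain_enum : exists e : nat -> domain, forall i, exists n, e n = i.
Proof.
have d : in_domain (2^-1, None) by split=> //=; case; lra.
apply: (@countable_enum domain (fun i => choice.pickle (sval i)) (exist _ _ d)).
by move=> i j /(pcan_inj (@choice.pickleK _)) E; exact: sval_inj E.
Qed.
End GapIndex.

Section Gaps.
Variable R : realType.
Variable C : set R.
Hypothesis C01 : forall c, C c -> 0 < c < 1.
Hypothesis C_closed : closed C.
Hypothesis C_neq0 : C !=set0.
Hypothesis C_perfect : forall c e, C c -> 0 < e ->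
  exists2 c', C c' & c' <> c /\ `|c - c'| < e.
Hypothesis C_thin : forall a b, a < b -> exists2 z, a < z < b & ~ C z.

Lemma closed_has_max (A : set R) (b : R) : closed A -> A !=set0 ->
  (forall x, A x -> x <= b) -> exists2 m, A m & forall x, A x -> x <= m.
Proof.
move=> cA A0 Ab; have sA : has_sup A by split=> //; exists b.
exists (sup A); last by move=> x Ax; exact: ub_le_sup sA.2 _ Ax.
apply: contrapT => nA; have oA : open (~` A) by exact: closed_openC.
have /(@nbhs_ballP R R)[e /= e0 eA] : nbhs (sup A) (~` A).
  by rewrite openE in oA; exact: oA.
have [x Ax xs] := sup_adherent e0 sA.
apply: (eA x _ Ax); rewrite /ball /= ger0_norm; first by lra.
by rewrite subr_ge0; exact: ub_le_sup sA.2 _ Ax.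
Qed.

Lemma closed_has_min (A : set R) (b : R) : closed A -> A !=set0 ->
  (forall x, A x -> b <= x) -> exists2 m, A m & forall x, A x -> m <= x.
Proof.
move=> cA [a Aa] Ab.
have [||x|m mA hm] := @closed_has_max [set x | A (- x)] (- b).
- by apply: (@preimage_closed _ _ (fun x : R => - x) A) => // x _; exact: oppr_continuous.
- by exists (- a); rewrite /= opprK.
- by move=> /Ab; rewrite lerNr.
- exists (- m) => // x Ax; rewrite lerNl; apply: hm; by rewrite /= opprK.
Qed.

Definition is_gap (p : R * R) : Prop :=
  [/\ C p.1, C p.2, p.1 < p.2 & forall z, p.1 < z < p.2 -> ~ C z].

Lemma gap_around (a b z : R) : C a -> C b -> a < z -> z < b -> ~ C z ->
  exists p, [/\ is_gap p, p.1 < z < p.2, a <= p.1 & p.2 <= b].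
Proof.
move=> Ca Cb az zb nz.
have [|||u [/= Cu uz] um] := @closed_has_max (C `&` [set x | x <= z]) z.
- by apply: closedI => //; exact: closed_le.
- by exists a; split=> //; exact: ltW.
- by move=> x [].
have [|||v [/= Cv zv] vm] := @closed_has_min (C `&` [set x | z <= x]) z.
- by apply: closedI => //; exact: closed_ge.
- by exists b; split=> //; exact: ltW.
- by move=> x [].
have uz' : u < z.
  by rewrite lt_neqAle uz andbT; apply/eqP => E; apply: nz; rewrite -E.
have zv' : z < v.
  by rewrite lt_neqAle zv andbT; apply/eqP => E; apply: nz; rewrite E.
exists (u, v); split=> /=.
- split=> //=; first exact: lt_trans zv'.
  move=> y /andP[uy yv] Cy; have [yz|zy] := leP y z.
    by have := um _ (conj Cy yz); lra.
  by have := vm _ (conj Cy (ltW zy)); lra.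
- by rewrite uz' zv'.
- by apply: um; split=> //; exact: ltW.
- by apply: vm; split=> //; exact: ltW.
Qed.

(** A common end of two gaps would be an isolated point. *)
Lemma gap_isolated p q : is_gap p -> is_gap q -> p.2 <> q.1.
Proof.
move=> [p1 p2 pl pn] [q1 q2 ql qn] E.
have [|c' Cc' [cn]] := C_perfect (e := Num.min (p.2 - p.1) (q.2 - q.1)) p2.
  by rewrite lt_min !subr_gt0 pl.
rewrite lt_min ltr_norml => /andP[/andP[h1 h2] h3].
move: h3; rewrite ltr_norml => /andP[h3 h4].
have [h|h|//] := ltgtP c' p.2; first by apply: pn Cc'; lra.
by apply: qn Cc'; rewrite -E; lra.
Qed.

Lemma gap_lt p q : is_gap p -> is_gap q -> p.1 < q.1 -> p.2 < q.1.
Proof.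
move=> gp gq pq; rewrite lt_neqAle; apply/andP; split.
  by apply/eqP; exact: gap_isolated.
rewrite leNgt; apply/negP => h; have [_ _ _ pn] := gp; have [q1 _ _ _] := gq.
by apply: pn q1; rewrite pq.
Qed.

Lemma gap_eq p q : is_gap p -> is_gap q -> p.1 = q.1 -> p = q.
Proof.
move=> [p1 p2 pl pn] [q1 q2 ql qn] E.
rewrite [p]surjective_pairing [q]surjective_pairing E; congr pair.
have [h|h|//] := ltgtP p.2 q.2; exfalso.
  by apply: qn p2; rewrite -E pl.
by apply: pn q2; rewrite E ql.
Qed.

Lemma C_bounds : exists m M : R, [/\ C m, C M, m < M,
  forall c, C c -> m <= c <= M & forall p, is_gap p -> m < p.1 /\ p.2 < M].
Proof.
have [x /C01 /andP[]|m Cm hm] := @closed_has_min C 0 C_closed C_neq0.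
  by move=> /ltW.
have [x /C01 /andP[_]|M CM hM] := @closed_has_max C 1 C_closed C_neq0.
  by move=> /ltW.
have mM : m < M.
  have [c Cc [cm _]] := C_perfect Cm ltr01.
  apply: lt_le_trans (hM _ Cc); rewrite lt_neqAle (hm _ Cc) andbT.
  by apply/eqP => E; apply: cm.
exists m, M; split=> // [c Cc|p [p1 p2 pl pn]]; first by rewrite hm // hM.
split; rewrite lt_neqAle ?(hm _ p1) ?(hM _ p2) andbT; apply/eqP => E.
  have [|c Cc [cm]] := C_perfect (e := p.2 - p.1) Cm; first by rewrite subr_gt0.
  rewrite ltr_norml => /andP[h1 h2]; apply: (pn _ _ Cc); rewrite -E in h1 h2 *.
  have := hm _ Cc; rewrite le_eqVlt => /orP[/eqP h|->/=]; last lra.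
  by rewrite h in cm.
have [|c Cc [cm]] := C_perfect (e := p.2 - p.1) CM; first by rewrite subr_gt0.
rewrite ltr_norml => /andP[h1 h2]; apply: (pn _ _ Cc); rewrite E in h1 h2 *.
have := hM _ Cc; rewrite le_eqVlt => /orP[/eqP h|->/=]; last lra.
by rewrite h in cm.
Qed.

Definition gap : Type := {p : R * R | is_gap p}.

(** Between two points of the set there is a gap, by thinness; and the extreme
    points of the set, like any other, are not isolated, so no gap is extreme. *)
Lemma gap_dense :
  dense_order (fun p q : gap => (sval p).1 < (sval q).1) /\ inhabited gap.
Proof.
have [m [M [Cm CM mM Cb gb]]] := C_bounds.
have new (a b : R) : C a -> C b -> a < b ->
    exists p : gap, a <= (sval p).1 /\ (sval p).2 <= b.
  move=> Ca Cb' ab; have [z /andP[az zb] nz] := C_thin ab.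
  have [p [gp _ h1 h2]] := gap_around Ca Cb' az zb nz.
  by exists (exist _ p gp).
split; last by have [p _] := new _ _ Cm CM mM.
split.
- by move=> p; rewrite ltxx.
- by move=> p q r; exact: lt_trans.
- move=> p q; have [h|h|h] := ltgtP (sval p).1 (sval q).1; auto.
  by right; left; apply: sval_inj; apply: gap_eq => //; exact: svalP.
- move=> [p gp] [q gq] /= pq; have [p1 p2 pl pn] := gp; have [q1 q2 ql qn] := gq.
  have [[r gr] /= [h1 h2]] := new _ _ p2 q1 (gap_lt gp gq pq).
  by exists (exist _ r gr) => /=; have [_ _ rl _] := gr; lra.
- move=> [p gp]; have [p1 p2 pl pn] := gp; have [mp pM] := gb _ gp; split.
    have [[r gr] /= [h1 h2]] := new _ _ p2 CM pM.
    by exists (exist _ r gr) => /=; lra.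
  have [[r gr] /= [h1 h2]] := new _ _ Cm p1 mp.
  by exists (exist _ r gr) => /=; have [_ _ rl _] := gr; lra.
Qed.

Lemma gap_enum : exists e : nat -> gap, forall p, exists n, e n = p.
Proof.
have [_ [p0]] := gap_dense.
have /choice[r rP] : forall p : gap, exists r : rat,
    (sval p).1 < ratr r < (sval p).2.
  move=> [p gp] /=; have [_ _ pl _] := gp.
  have [r] := rat_in_itvoo pl; rewrite in_itv /= => h.
  by exists r.
apply: (@countable_enum gap (fun p => choice.pickle (r p)) p0).
move=> p q /(pcan_inj (@choice.pickleK _)) E; apply: sval_inj.
have /andP[p1 p2] := rP p; have /andP[q1 q2] := rP q; rewrite E in p1 p2.
apply: gap_eq; [exact: svalP|exact: svalP|].
have [h|h|//] := ltgtP (sval p).1 (sval q).1.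
  by have := gap_lt (svalP p) (svalP q) h; lra.
by have := gap_lt (svalP q) (svalP p) h; lra.
Qed.

Definition shift_index (k : int) (i : gapindex) : gapindex := (i.1 + k%:Q, i.2).

(** The gaps of the periodic set [C + Z], indexed equivariantly by [gapindex], with
    end points [u i] and [v i].  Back and forth matches the fundamental domain with
    the bounded gaps of [C]; the rest follows by periodicity. *)
Theorem gap_system : exists u v : gapindex -> R,
  [/\ forall i, u i < v i, forall i j, lt_index i j -> v i < u j,
      forall k i, u (shift_index k i) = u i + k%:~R /\
        v (shift_index k i) = v i + k%:~R,
      forall a b, a < b -> exists i z, a < z < b /\ u i <= z <= v i &
      [/\ forall i, exists k : int, C (u i - k%:~R),
          forall c i, C c -> ~ u i < c < v i &
          forall z, (forall i, ~ u i < z < v i) ->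
            exists k : int, C (z - k%:~R)]].
Proof.
have [m [M [Cm CM mM Cb gb]]] := C_bounds.
have [/andP[m0 m1] /andP[M0 M1]] := (C01 Cm, C01 CM).
have [gd _] := gap_dense; have [eG heG] := gap_enum; have [eD heD] := domain_enum.
have [f [fsurj fmono]] := cantor_back_and_forth heD heG domain_dense gd.
have /choice[g gP] : forall i : gapindex, exists p : R * R,
    (forall h : in_domain i, p = sval (f (exist _ i h))) /\
    (~ in_domain i -> p = (M - 1, m)).
  move=> i; have [h|h] := pselect (in_domain i); last by exists (M - 1, m).
  exists (sval (f (exist _ i h))); split=> // h'.
  by rewrite (Prop_irrelevance h h').
pose fr (i : gapindex) : gapindex := (i.1 - (Num.floor i.1)%:Q, i.2).
have frD i : 0 <= (fr i).1 < 1.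
  have := ge_floor i.1; have := lt_succ_floor i.1; rewrite /fr /=.
  by rewrite intrD1; lra.
have dom i : 0 <= i.1 < 1 -> (i = (0, None) /\ g i = (M - 1, m)) \/
    exists2 h : in_domain i, g i = sval (f (exist _ i h)) & is_gap (g i).
  move=> i01; have [->|i0] := pselect (i = (0, None)).
    by left; split=> //; apply: (gP _).2 => -[].
  right; have h : in_domain i by [].
  by exists h; rewrite ((gP _).1 h) //; exact: svalP.
have gin i : 0 <= i.1 < 1 -> M - 1 <= (g i).1 < M /\ m <= (g i).2 < M.
  move=> /dom[[_ ->] /=|[_ _ gi]]; first by split; lra.
  by have := gb _ gi; have [_ _ gl _] := gi; lra.
have glt i : 0 <= i.1 < 1 -> (g i).1 < (g i).2.
  by move=> /dom[[_ ->] /=|[_ _ []]//]; lra.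
have gord i j : 0 <= i.1 < 1 -> 0 <= j.1 < 1 -> lt_index i j -> (g i).2 < (g j).1.
  move=> i01 j01 ij; case: (dom j j01) => [[jE _]|[hj gj Gj]].
    exfalso; move: ij i01; rewrite jE /lt_index /=; case=> [|[_]]; first lra.
    by case: (i.2).
  case: (dom i i01) => [[_ ->]|[hi gi Gi]]; first by case: (gb _ Gj).
  by apply: gap_lt => //; rewrite gi gj; exact/fmono.
pose u i := (g (fr i)).1 + (Num.floor i.1)%:~R.
pose v i := (g (fr i)).2 + (Num.floor i.1)%:~R.
have floorE (k : int) (q : rat) : 0 <= q < 1 -> Num.floor (q + k%:Q) = k.
  move=> q01; apply: floor_def; rewrite intrD1; lra.
have uv_shift k i : u (shift_index k i) = u i + k%:~R /\
    v (shift_index k i) = v i + k%:~R.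
  have E : Num.floor (shift_index k i).1 = Num.floor i.1 + k.
    rewrite /shift_index /=.
    have -> : i.1 + k%:Q = (fr i).1 + (Num.floor i.1 + k)%:Q.
      by rewrite /fr /= intrD addrA subrK.
    by rewrite floorE.
  have E' : fr (shift_index k i) = fr i.
    by rewrite /fr E /shift_index /= intrD opprD addrACA subrr addr0.
  by rewrite /u /v E E' intrD !addrA.
have uv_dom i : 0 <= i.1 < 1 -> u i = (g i).1 /\ v i = (g i).2.
  move=> i01; have E : Num.floor i.1 = 0.
    by have := floorE 0 i.1 i01; rewrite addr0.
  by rewrite /u /v /fr E subr0 !addr0 -surjective_pairing.
have C_out c i : C c -> ~ u i < c < v i.
  move=> Cc /andP[uc cv]; have cb := Cb _ Cc; have c01 := C01 Cc.
  have := frD i; move: uc cv; rewrite /u /v; set k := Num.floor _.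
  move=> uc cv /[dup] fi /dom[[_ E]|[_ _ Gi]].
    move: uc cv; rewrite E /= => uc cv.
    have k0 : (k < 1)%R by rewrite -(ltr_int R); lra.
    have k1 : (0 < k)%R by rewrite -(ltr_int R); lra.
    by move: k0 k1; clear; lia.
  have [/C01 g1 /C01 g2 gl gn] := Gi.
  have k0 : (k < 1)%R by rewrite -(ltr_int R); lra.
  have k1 : (-1 < k)%R by rewrite -(ltr_int R) mulrN1z; lra.
  have k00 : k = 0 by move: k0 k1; clear; lia.
  by apply: (gn _ _ Cc); move: uc cv; rewrite k00 !addr0 => -> ->.
have C_in z : (forall i, ~ u i < z < v i) -> exists k : int, C (z - k%:~R).
  move=> hz; pose k := Num.floor (z - M) + 1.
  have kz : M - 1 <= z - k%:~R < M.
    have := ge_floor (z - M); have := lt_succ_floor (z - M).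
    by rewrite /k !intrD1; lra.
  have zk i : 0 <= i.1 < 1 -> ~ (g i).1 < z - k%:~R < (g i).2.
    move=> /uv_dom[ui vi] h; apply: (hz (shift_index k i)).
    by have [-> ->] := uv_shift k i; rewrite ui vi; lra.
  have h0 : ~ M - 1 < z - k%:~R < m.
    have d0 : 0 <= ((0, None) : gapindex).1 < 1 by [].
    by have := zk (0, None) d0; rewrite (gP (0, None)).2 // => -[].
  have [E|zM] := eqVneq (z - k%:~R) (M - 1).
    exists (k - 1); rewrite intrD mulrN1z opprD opprK addrA E.
    by rewrite subrK.
  have mz : m <= z - k%:~R.
    rewrite leNgt; apply/negP => h; apply: h0; rewrite h andbT.
    by rewrite lt_neqAle eq_sym zM; case/andP: kz.
  exists k; apply: contrapT => nC.
  have mz' : m < z - k%:~R.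
    by rewrite lt_neqAle mz andbT; apply/eqP => E; apply: nC; rewrite -E.
  have zM' : z - k%:~R < M by case/andP: kz.
  have [p [Gp pz _ _]] := gap_around Cm CM mz' zM' nC.
  have [[i hi] fi] := fsurj (exist _ p Gp).
  apply: (zk i); first by case: (hi).
  by rewrite ((gP i).1 hi) fi.
exists u, v; split=> //.
- by move=> i; rewrite /u /v ltrD2r glt.
- move=> i j ij.
  have ff : (Num.floor i.1 <= Num.floor j.1)%R.
    by apply: le_floor; case: ij => [/ltW//|[-> _]].
  have [E|fne] := eqVneq (Num.floor i.1) (Num.floor j.1).
    rewrite /u /v E ltrD2r; apply: gord => //; case: ij => [h|[h1 h2]].
      by left; rewrite /fr /= E ltrD2r.
    by right; rewrite /fr /= E h1.
  have fl : (Num.floor i.1 + 1 <= Num.floor j.1)%R by move: ff fne; clear; lia.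
  move: fl; rewrite -(ler_int R) intrD1 /u /v.
  by have := gin _ (frD i); have := gin _ (frD j); lra.
- move=> a b ab; apply: contrapT => h.
  have hz z : a < z < b -> exists k : int, C (z - k%:~R).
    move=> zab; apply: C_in => i /andP[h1 h2]; apply: h; exists i, z.
    by split=> //; rewrite !ltW.
  pose z0 := (a + b) / 2; pose n := Num.floor z0.
  have /andP[n1 n2] : n%:~R <= z0 < n%:~R + 1.
    by rewrite ge_floor -intrD1 lt_succ_floor.
  have z0ab : a < z0 < b by rewrite /z0; lra.
  have [|y /andP[y1 y2] ny] := @C_thin (z0 - n%:~R) (Num.min b (n%:~R + 1) - n%:~R).
    by rewrite ltrD2r lt_min n2 andbT; case/andP: z0ab.
  move: y2; rewrite ltrBrDr lt_min => /andP[yb yn].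
  have [|k Ck] := hz (y + n%:~R); first by lra.
  apply: ny; suff -> : y = y + n%:~R - k%:~R by [].
  have kn : k = n.
    have := C01 Ck => ck.
    have k1 : (k < n + 1)%R by rewrite -(ltr_int R) intrD1; lra.
    have k2 : (n < k + 1)%R by rewrite -(ltr_int R) intrD1; lra.
    by move: k1 k2; clear; lia.
  by rewrite kn addrK.
- split=> // i; rewrite /u; case: (dom _ (frD i)) => [[_ ->]|[_ _ [h _ _ _]]] /=.
    exists (Num.floor i.1 - 1); rewrite intrD mulrN1z.
    by have -> : M - 1 + (Num.floor i.1)%:~R - ((Num.floor i.1)%:~R - 1) = M by ring.
  by exists (Num.floor i.1); rewrite addrK.
Qed.
End Gaps.

(** * Action of the real line on the gaps *)

Section CircleAction.
Variable R : realType.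

Section Translation.
Variable l : nat -> R -> rat.
Hypothesis lD : forall n x y, l n (x + y) = l n x + l n y.
Implicit Types (x y : R) (i j : gapindex).

(** [R] translates the rotation coordinate by [l 0] and the [n]-th copy of the
    rationals by [l n.+1]. *)
Definition act x i : gapindex :=
  (i.1 + l 0%N x, omap (fun a : nat * rat => (a.1, a.2 + l a.1.+1 x)) i.2).

Lemma actD x y i : act (x + y) i = act x (act y i).
Proof.
have E (a b c : rat) : a + (b + c) = a + c + b by rewrite addrAC addrA.
by case: i => [p [[n q]|]]; rewrite /act /= !lD !E.
Qed.

Lemma functional0 n : l n 0 = 0.
Proof. by apply: (addIr (l n 0)); rewrite -lD !add0r. Qed.

Lemma act0 i : act 0 i = i.
Proof. by case: i => [p [[n q]|]]; rewrite /act /= !functional0 !addr0. Qed.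

Lemma act_lt x i j : lt_index i j -> lt_index (act x i) (act x j).
Proof.
case: i j => [p a] [q b]; rewrite /lt_index /act /= => -[pq|[-> ab]].
  by left; rewrite ltrD2r.
right; split=> //; case: a b ab => [[n r]|] [[m s]|] //= [nm|[-> rs]].
  by left.
by right; rewrite ltrD2r.
Qed.
End Translation.

(** A monotone map whose values include a dense set has no jumps, so it is
    determined by its values on the dense set. *)
Lemma monotone_eq (F G : R -> R) (E : set R) :
  (forall a b, a < b -> exists2 e, E e & a < e < b) ->
  (forall x y, x <= y -> F x <= F y) -> (forall x y, x <= y -> G x <= G y) ->
  (forall e, E e -> F e = G e) -> (forall e, E e -> exists2 d, E d & F d = e) ->
  F =1 G.
Proof.
move=> dE mF mG FG FE x.
have [h|h|//] := ltgtP (F x) (G x); exfalso.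
  have [e Ee /andP[e1 e2]] := dE _ _ h; have [d Ed de] := FE _ Ee.
  have [dx|xd] := leP d x; first by have := mF _ _ dx; rewrite de; lra.
  by have := mG _ _ (ltW xd); rewrite -(FG d Ed) de; lra.
have [e Ee /andP[e1 e2]] := dE _ _ h; have [d Ed de] := FE _ Ee.
have [dx|xd] := leP d x; first by have := mG _ _ dx; rewrite -(FG d Ed) de; lra.
by have := mF _ _ (ltW xd); rewrite de; lra.
Qed.

(** The map [F x] sends the gap of index [i] affinely onto the gap of index
    [act l x i], and extends monotonically to the line.  If it fixes [C] modulo the
    integers, then [act l x i] is a translate of [i] by an integer for all [i];
    reading off the coordinates of the indices, [l 0 x] is an integer [k] and all
    other functionals vanish at [x], as they do at [k]. *)
Theorem circle_action (C : set R) :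
  (forall c, C c -> 0 < c < 1) -> closed C -> C !=set0 ->
  (forall c e, C c -> 0 < e -> exists2 c', C c' & c' <> c /\ `|c - c'| < e) ->
  (forall a b, a < b -> exists2 z, a < z < b & ~ C z) ->
  exists F : R -> R -> R,
  [/\ forall x y z, F (x + y) z = F x (F y z), forall z, F 1 z = z + 1,
      forall x y z, y < z -> F x y < F x z,
      forall x c, C c -> exists k : int, C (F x c - k%:~R) &
      forall x, (forall c, C c -> exists k : int, F x c = c + k%:~R) ->
        exists k : int, x = k%:~R].
Proof.
move=> C01 Ccl C0 Cp Ct.
have [u [v [uv uvlt uvsh dense [Cu Cout Cin]]]] := gap_system C01 Ccl C0 Cp Ct.
have [l [lD l01 ln1 lsep]] := separating_functionals R.
pose pt i (t : R) := u i + t * (v i - u i).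
have ptuv i t : 0 <= t <= 1 -> u i <= pt i t <= v i.
  move=> /andP[t0 t1]; have := uv i; rewrite /pt => h; apply/andP; split.
    by rewrite lerDl mulr_ge0 // subr_ge0 ltW.
  have : t * (v i - u i) <= 1 * (v i - u i) by rewrite ler_wpM2r // subr_ge0 ltW.
  by lra.
have uvpt i z : u i <= z <= v i -> exists2 t, 0 <= t <= 1 & pt i t = z.
  move=> /andP[uz zv]; have d0 : 0 < v i - u i by rewrite subr_gt0.
  exists ((z - u i) / (v i - u i)); last by rewrite /pt divfK ?gt_eqF //; ring.
  by rewrite divr_ge0 ?subr_ge0 ?(ltW (uv i)) //= ler_pdivrMr // mul1r lerD2r.
have ptE i j t s : 0 <= t <= 1 -> 0 <= s <= 1 -> pt i t <= pt j s ->
    lt_index i j \/ (i = j /\ t <= s).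
  move=> t01 s01 h; have := ptuv i t t01; have := ptuv j s s01.
  case: (lt_index_total i j) => [|[E|/uvlt]]; [by left| |lra].
  move=> _ _; right; split=> //; move: h; rewrite /pt E lerD2l ler_pM2r //.
  by rewrite subr_gt0.
have Ept i j t s : 0 <= t <= 1 -> 0 <= s <= 1 ->
    lt_index i j \/ (i = j /\ t <= s) -> pt i t <= pt j s.
  move=> t01 s01 [/uvlt|[-> ts]].
    by have := ptuv i t t01; have := ptuv j s s01; lra.
  by rewrite /pt lerD2l ler_wpM2r // subr_ge0 ltW.
pose E : set R := [set z | exists i, u i <= z <= v i].
have dE a b : a < b -> exists2 e, E e & a < e < b.
  by move=> /dense[i [z [h1 h2]]]; exists z => //; exists i.
(* extend the action on the closed gaps, whose union [E] is dense, by suprema *)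
pose S x z : set R := [set w | exists i t, [/\ 0 <= t <= 1, pt i t <= z &
   w = pt (act l x i) t]].
pose F x z := sup (S x z).
have actpt x i j t s : 0 <= t <= 1 -> 0 <= s <= 1 -> pt i t <= pt j s ->
    pt (act l x i) t <= pt (act l x j) s.
  move=> t01 s01 /(ptE _ _ _ _ t01 s01) h; apply: Ept => //.
  by case: h => [/(act_lt l x)|[-> ts]]; [left|right].
have below z : exists i t, 0 <= t <= 1 /\ pt i t <= z.
  have [|i [w [wz /uvpt[t t01 tw]]]] := dense (z - 1) z; first lra.
  by exists i, t; rewrite tw; split=> //; lra.
have above z : exists i t, 0 <= t <= 1 /\ z <= pt i t.
  have [|i [w [wz /uvpt[t t01 tw]]]] := dense z (z + 1); first lra.
  by exists i, t; rewrite tw; split=> //; lra.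
have supS x z : has_sup (S x z).
  split.
    by have [i [t [t01 iz]]] := below z; exists (pt (act l x i) t), i, t.
  have [j [s [s01 zj]]] := above z; exists (pt (act l x j) s).
  by move=> _ [i [t [t01 iz ->]]]; apply: actpt => //; exact: le_trans zj.
have mF x y z : y <= z -> F x y <= F x z.
  move=> yz; apply: ge_sup; first by case: (supS x y).
  move=> w [i [t [t01 iy ->]]]; apply: ub_le_sup; first by case: (supS x z).
  by exists i, t; split=> //; exact: le_trans yz.
have Fpt x i t : 0 <= t <= 1 -> F x (pt i t) = pt (act l x i) t.
  move=> t01; apply/eqP; rewrite eq_le; apply/andP; split.
    apply: ge_sup; first by case: (supS x (pt i t)).
    by move=> _ [j [s [s01 ji ->]]]; exact: actpt.
  apply: ub_le_sup; first by case: (supS x (pt i t)).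
  by exists i, t.
have FE x e : E e -> E (F x e).
  by move=> [i /uvpt[t t01 <-]]; rewrite Fpt //; exists (act l x i); exact: ptuv.
have F0 z : F 0 z = z.
  move: z; apply: (@monotone_eq (F 0) id E) => //; first exact: mF.
    by move=> e [i /uvpt[t t01 <-]]; rewrite Fpt // act0.
  by move=> e Ee; exists e => //; case: Ee => i /uvpt[t t01 <-]; rewrite Fpt // act0.
have FEE x e : E e -> exists2 d, E d & F x d = e.
  move=> [i /uvpt[t t01 <-]]; exists (pt (act l (- x) i) t).
    by exists (act l (- x) i); exact: ptuv.
  by rewrite Fpt // -actD // subrr act0.
have FD x y z : F (x + y) z = F x (F y z).
  move: z; apply: (@monotone_eq (F (x + y)) (F x \o F y) E) => //.
  - exact: mF.
  - by move=> a b ab; apply/mF/mF.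
  - by move=> e [i /uvpt[t t01 <-]] /=; rewrite !Fpt // actD.
  - exact: FEE.
have F1 z : F 1 z = z + 1.
  move: z; apply: (@monotone_eq (F 1) (fun z => z + 1) E) => //.
  - exact: mF.
  - by move=> a b ab; rewrite lerD2r.
  - move=> e [i /uvpt[t t01 <-]]; rewrite Fpt //.
    have -> : act l 1 i = shift_index 1 i.
      case: i => [p [[n q]|]]; rewrite /act /shift_index /= l01 //.
      by rewrite ln1 addr0.
    by rewrite /pt; have [-> ->] := uvsh 1 i; rewrite mulr1z; ring.
  - exact: FEE.
have Finj x : injective (F x).
  by move=> y z E'; rewrite -[y]F0 -[z]F0 -(addNr x) !FD E'.
have sF x y z : y < z -> F x y < F x z.
  move=> yz; rewrite lt_neqAle mF ?ltW // andbT; apply/eqP => /Finj E'.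
  by rewrite E' ltxx in yz.
have ltF x y z : F x y < F x z -> y < z.
  by rewrite !ltNge; apply: contra => /mF.
have Fgap x i : F x (u i) = u (act l x i) /\ F x (v i) = v (act l x i).
  have p0 j : pt j 0 = u j by rewrite /pt mul0r addr0.
  have p1 j : pt j 1 = v j by rewrite /pt mul1r addrC subrK.
  by rewrite -!p0 -!p1 !Fpt // ?lexx ?ler01.
have Fper x k z : F x (z + k%:~R) = F x z + k%:~R.
  have up y : F x (y + 1) = F x y + 1 by rewrite -!F1 -!FD addrC.
  have nat_ (n : nat) y : F x (y + n%:R) = F x y + n%:R.
    by elim: n => [|n IH]; rewrite ?addr0 // -natr1 !addrA up IH.
  case: k => n; first exact: nat_.
  rewrite NegzE intrN; apply: (addIr n.+1%:R).
  by rewrite -nat_ !subrK.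
exists F; split=> //.
- move=> x c Cc; apply: Cin => i /andP[h1 h2].
  apply: (Cout c (act l (- x) i) Cc).
  have [a b] := Fgap x (act l (- x) i).
  rewrite -(actD lD) subrr (act0 lD) in a b.
  by rewrite -a -b in h1 h2; rewrite (ltF _ _ _ h1) (ltF _ _ _ h2).
- move=> x Fx.
  have Fu i : exists k : int, act l x i = shift_index k i.
    have [k' Ck'] := Cu i; have [k Fk] := Fx _ Ck'.
    exists k; have : u (act l x i) = u (shift_index k i).
      have [-> _] := uvsh k i; have [<- _] := Fgap x i.
      have := Fper x k' (u i - k'%:~R); rewrite subrK => ->.
      by rewrite Fk; ring.
    case: (lt_index_total (act l x i) (shift_index k i)) => [h|[//|h]] e.
      by move: (uvlt _ _ h) (uv (act l x i)); rewrite e => h1 h2; have := lt_trans h2 h1; rewrite ltxx.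
    by move: (uvlt _ _ h) (uv (shift_index k i)); rewrite e => h1 h2; have := lt_trans h2 h1; rewrite ltxx.
  have [k hk] := Fu (0, None); exists k.
  have lk : l 0%N x = k%:Q by case: hk; rewrite !add0r.
  apply/eqP; rewrite -subr_eq0; apply/eqP/lsep => n.
  have lint m (j : int) : l m j%:~R = l m 1 *~ j.
    have nat_ (q : nat) : l m q%:R = l m 1 *+ q.
      by elim: q => [|q IH]; rewrite ?functional0 // -natr1 lD IH mulrSr.
    case: j => q; first exact: nat_.
    apply: (addIr (l m q.+1%:R)); rewrite -lD NegzE intrN addNr functional0 // nat_.
    by rewrite mulrNz addNr.
  have lN m y : l m (- y) = - l m y.
    by apply: (addIr (l m y)); rewrite -lD !addNr functional0.
  rewrite lD lN lint; case: n => [|n]; first by rewrite l01 lk subrr.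
  rewrite ln1 mul0rz subr0.
  by have [k' []] := Fu (0, Some (n, 0)); rewrite !add0r.
Qed.
End CircleAction.

(** * Winding numbers *)

Section Winding.
Variable R : realType.
Local Notation plane := (R * R)%type.
Implicit Types (p q v w : plane) (g h : R -> plane) (n : int) (t : R).

Definition clamp01 (t : R) : R := Num.max 0 (Num.min 1 t).

Lemma clamp01_in t : 0 <= clamp01 t <= 1.
Proof.
rewrite /clamp01; case: (leP 1 t) => ?; first by rewrite maxEle ler01 ler01 lexx.
by case: (leP 0 t) => ?; lra.
Qed.

Lemma clamp01_id t : 0 <= t <= 1 -> clamp01 t = t.
Proof.
move=> /andP[t0 t1]; rewrite /clamp01 minEle; case: ifP => h.
  have -> : t = 1 by apply/eqP; rewrite eq_le t1.
  by rewrite maxEle ler01.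
by rewrite maxEle t0.
Qed.

Lemma clamp01_continuous : continuous clamp01.
Proof.
move=> t; apply/cvgrPdist_lt => e e0; near=> s.
apply: (@le_lt_trans _ _ `|t - s|); last by near: s; exact: cvgr_dist_lt.
have aux x y : x <= y -> `|clamp01 x - clamp01 y| <= `|x - y|.
  move=> xy; rewrite [leRHS]ler0_norm ?subr_le0 // ler_norml /clamp01.
  by case: (leP 1 x) => ?; case: (leP 1 y) => ?;
    rewrite ?(max_r (@ler01 R)); try lra;
    case: (leP 0 x) => ?; try case: (leP 0 y) => ?; lra.
have [/aux//|/ltW/aux] := leP t s; by rewrite distrC (distrC s).
Unshelve. all: by end_near. Qed.

Lemma within_clamp (X : topologicalType) (f : R -> X) :
  {within `[0, 1], continuous f} -> continuous (f \o clamp01).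
Proof.
move=> cf; apply/continuous_subspace_setT.
have cl : {within [set: R], continuous clamp01}.
  by apply: continuous_subspaceT; exact: clamp01_continuous.
apply: (@within_continuous_comp_homo R R X setT `[0, 1] clamp01 f _ cl cf).
by move=> t _; rewrite /= in_itv /= clamp01_in.
Qed.

Lemma winds_ext g h p n : (forall t, 0 <= t <= 1 -> g t = h t) ->
  winds g p n -> winds h p n.
Proof.
move=> gh [r [theta [ct rt tn]]]; exists r, theta; split=> // t t01.
by rewrite -gh //; exact: rt.
Qed.

Lemma winds_translate g p n : winds g p n <-> winds (fun t => g t - p) 0 n.
Proof.
split=> -[r [th [ct rt tn]]]; exists r, th; split=> // t /rt[r0 E]; split=> //.
  by rewrite E [LHS]surjective_pairing /=; congr pair; ring.
rewrite -[g t](subrK p) E [LHS]surjective_pairing /=; congr pair; ring.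
Qed.

(** Two continuous arguments have a difference with cosine 1; if its total
    variation were not zero, it would pass through a value with cosine -1. *)
Lemma winds_unique g p n m : winds g p n -> winds g p m -> n = m.
Proof.
move=> [r [th [ct rt tn]]] [r' [th' [ct' rt' tn']]].
pose d t := th t - th' t.
have cd : {within `[0, 1], continuous d}.
  by move=> t; apply: cvgB; [exact: ct|exact: ct'].
have d1 t : 0 <= t <= 1 -> cos (d t) = 1.
  move=> t01; have [r0 E] := rt t t01; have [r'0 E'] := rt' t t01.
  have [E1 E2] : r t * cos (th t) = r' t * cos (th' t) /\
      r t * sin (th t) = r' t * sin (th' t).
    by move: E; rewrite E' => -[] /addrI -> /addrI ->.
  have rr : r t = r' t.
    have := cos2Dsin2 (th t); have := cos2Dsin2 (th' t) => h1 h2.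
    have : (r t * cos (th t)) ^+ 2 + (r t * sin (th t)) ^+ 2 =
       (r' t * cos (th' t)) ^+ 2 + (r' t * sin (th' t)) ^+ 2 by rewrite E1 E2.
    rewrite !exprMn -!mulrDr h1 h2 !mulr1 => /eqP.
    by rewrite eqrXn2 ?ltW // => /eqP.
  have r'n : r' t != 0 by rewrite gt_eqF.
  rewrite rr in E1 E2; have {}E1 := mulfI r'n E1; have {}E2 := mulfI r'n E2.
  by rewrite /d cosB E1 E2 -!expr2 cos2Dsin2.
have dn : d 1 - d 0 = 2 * pi * (n - m)%:~R.
  rewrite /d intrB mulrBr -tn -tn'; lra.
apply/eqP; rewrite -subr_eq0; apply/negPn/negP => nm.
have pi0 := pi_gt0 R.
have [v v01 dv] : exists2 v : R, Num.min (d 0) (d 1) <= v <= Num.max (d 0) (d 1)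
    & v = d 0 + pi \/ v = d 0 - pi.
  have [h|h] : (1 <= n - m)%R \/ (n - m <= -1)%R by move: nm; clear; lia.
    exists (d 0 + pi); last by left.
    have : 1 <= (n - m)%:~R :> R by rewrite -[1]/(1%:~R) ler_int.
    move=> k1; have : 2 * pi * 1 <= 2 * pi * (n - m)%:~R :> R.
      by rewrite ler_wpM2l // mulr_ge0 // ltW.
    by rewrite -dn minEle maxEle; case: ifP; lra.
  exists (d 0 - pi); last by right.
  have : (n - m)%:~R <= -1 :> R by rewrite -[-1]/((-1)%:~R) ler_int.
  move=> k1; have : 2 * pi * (n - m)%:~R <= 2 * pi * -1 :> R.
    by rewrite ler_wpM2l // mulr_ge0 // ltW.
  by rewrite -dn minEle maxEle; case: ifP; lra.
have [c c01 dc] := IVT ler01 cd v01.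
move: c01; rewrite in_itv /= => /d1; rewrite dc.
have := d1 0; rewrite lexx ler01 => /(_ isT) d0.
by case: dv => ->; [rewrite cosD|rewrite cosB]; rewrite cospi sinpi d0; lra.
Qed.

Definition dot v w : R := v.1 * w.1 + v.2 * w.2.
Definition cross v w : R := v.1 * w.2 - v.2 * w.1.

Lemma dot_continuous (X : topologicalType) (f g : X -> plane) : continuous f ->
  continuous g -> continuous (fun x => dot (f x) (g x)).
Proof.
move=> cf cg x.
have c1 (h : X -> plane) : continuous h -> (fst \o h) @ x --> (h x).1.
  by move=> ch; apply: continuous_comp; [exact: ch|exact: cvg_fst].
have c2 (h : X -> plane) : continuous h -> (snd \o h) @ x --> (h x).2.
  by move=> ch; apply: continuous_comp; [exact: ch|exact: cvg_snd].
by apply: cvgD; apply: cvgM; [exact: c1|exact: c1|exact: c2|exact: c2].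
Qed.

Lemma cross_continuous (X : topologicalType) (f g : X -> plane) : continuous f ->
  continuous g -> continuous (fun x => cross (f x) (g x)).
Proof.
move=> cf cg x.
have c1 (h : X -> plane) : continuous h -> (fst \o h) @ x --> (h x).1.
  by move=> ch; apply: continuous_comp; [exact: ch|exact: cvg_fst].
have c2 (h : X -> plane) : continuous h -> (snd \o h) @ x --> (h x).2.
  by move=> ch; apply: continuous_comp; [exact: ch|exact: cvg_snd].
by apply: cvgB; apply: cvgM; [exact: c1|exact: c2|exact: c2|exact: c1].
Qed.

Lemma atan_polar (a b : R) : 0 < a -> exists2 r, 0 < r &
  a = r * cos (atan (b / a)) /\ b = r * sin (atan (b / a)).
Proof.
move=> a0; have c0 : 0 < cos (atan (b / a)).
  by rewrite cos_atan invr_gt0 sqrtr_gt0 ltr_pwDl // sqr_ge0.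
exists (a / cos (atan (b / a))); first exact: divr_gt0.
rewrite divfK ?gt_eqF //; split=> //.
have := atanK (b / a); rewrite /tan => h.
by rewrite mulrAC -mulrA h mulrC divfK // gt_eqF.
Qed.

(** When two vectors stay within a quarter turn of each other, the angle from one
    to the other is a continuous periodic function, an arc tangent. *)
Lemma winds_step g h n : continuous g -> continuous h -> g 0 = g 1 -> h 0 = h 1 ->
  (forall t, 0 < dot (g t) (h t)) -> winds g 0 n -> winds h 0 n.
Proof.
move=> cg ch g01 h01 gh [r [th [ct rt tn]]].
pose phi t := atan (cross (g t) (h t) / dot (g t) (h t)).
have cphi : continuous phi.
  move=> t; apply: continuous_comp; last exact: continuous_atan.
  apply: cvgM; first exact: cross_continuous.
  by apply: cvgV; [rewrite gt_eqF|exact: dot_continuous].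
have /choice[k kP] : forall t, exists k, 0 < k /\
    (dot (g t) (h t) = k * cos (phi t) /\ cross (g t) (h t) = k * sin (phi t)).
  by move=> t; have [k k0 hk] := atan_polar (cross (g t) (h t)) (gh t); exists k.
exists (fun t => k t / r t), (fun t => th t + phi t); split.
- move=> t; apply: cvgD; first exact: ct.
  by apply: continuous_subspaceT cphi t.
- move=> t /rt[r0 gE]; have [k0 [dE cE]] := kP t; split; first exact: divr_gt0.
  rewrite cosD sinD.
  move: dE cE; rewrite /dot /cross gE /= !add0r.
  have := cos2Dsin2 (th t).
  set c := cos (th t); set s := sin (th t); set C := cos (phi t); set S := sin (phi t).
  move: (h t) => [x y] /= cs dE cE.
  have rn : r t != 0 by rewrite gt_eqF.
  have kC : k t / r t * C = x * c + y * s.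
    by rewrite mulrAC -dE; field.
  have kS : k t / r t * S = c * y - s * x.
    by rewrite mulrAC -cE; field.
  congr pair.
    transitivity (c * (k t / r t * C) - s * (k t / r t * S)); last by ring.
    rewrite kC kS; transitivity (x * (c ^+ 2 + s ^+ 2)); last by ring.
    by rewrite cs mulr1.
  transitivity (s * (k t / r t * C) + c * (k t / r t * S)); last by ring.
  rewrite kC kS; transitivity (y * (c ^+ 2 + s ^+ 2)); last by ring.
  by rewrite cs mulr1.
- by rewrite -tn /phi -g01 -h01; lra.
Qed.

Lemma continuous_pair (X Y Z : topologicalType) (f : X -> Y) (k : X -> Z) (x : X) :
  {for x, continuous f} -> {for x, continuous k} ->
  {for x, continuous (fun x => (f x, k x))}.
Proof.
by move=> cf ck; exact: (@cvg_pair _ _ _ (nbhs x) (nbhs (f x)) (nbhs (k x)) _ _ _ f k).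
Qed.

Lemma locally_constant (P : R -> Prop) :
  (forall s, exists2 d, 0 < d & forall s', `|s - s'| < d -> P s' <-> P s) ->
  P 0 -> P 1.
Proof.
move=> loc P0; apply: contrapT => P1.
pose f s : R := if `[< P s >] then 1 else 0.
have cf : continuous f.
  move=> s; apply/cvgrPdist_lt => e e0; have [d d0 hd] := loc s.
  near=> s'; suff -> : f s' = f s by rewrite subrr normr0.
  have /hd h : `|s - s'| < d by near: s'; exact: cvgr_dist_lt.
  by rewrite /f; congr (if _ then _ else _); exact: asbool_equiv_eq.
have f0 : f 0 = 1 by rewrite /f asboolT.
have f1 : f 1 = 0 by rewrite /f asboolF.
have [||c _] := @IVT R f 0 1 2^-1 ler01.
- exact: continuous_subspaceT.
- by rewrite f0 f1 minEle maxEle ler10; lra.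
- by rewrite /f; case: ifP; lra.
Unshelve. all: by end_near. Qed.

(** By compactness of the parameter interval of the loop, nearby loops of the
    homotopy stay within a quarter turn of each other. *)
Lemma winds_homotopy (v : R * R -> plane) n : continuous v ->
  (forall s t, v (s, t) <> 0) -> (forall s, v (s, 0) = v (s, 1)) ->
  winds (fun t => v (0, t)) 0 n -> winds (fun t => v (1, t)) 0 n.
Proof.
move=> cv v0 v01.
have cvs s : continuous (fun t => v (s, t)).
  move=> t; apply: (@continuous_comp _ _ _ (fun t : R => (s, t)) v); last exact: cv.
  by apply: continuous_pair; [exact: cvg_cst|exact: cvg_id].
pose vc s t := v (s, clamp01 t).
have cvc s : continuous (vc s).
  move=> t; apply: (@continuous_comp _ _ _ clamp01 (fun t => v (s, t))).
    exact: clamp01_continuous.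
  exact: cvs.
have vcE s : winds (vc s) 0 n <-> winds (fun t => v (s, t)) 0 n.
  by split; apply: winds_ext => t /clamp01_id; rewrite /vc => ->.
have vc01 s : vc s 0 = vc s 1.
  by rewrite /vc !clamp01_id ?lexx ?ler01.
have step s s' : (forall t, 0 <= t <= 1 -> 0 < dot (v (s, t)) (v (s', t))) ->
    winds (vc s) 0 n -> winds (vc s') 0 n.
  move=> h; apply: winds_step => // t; rewrite /vc; apply: h; exact: clamp01_in.
suff h : winds (vc 0) 0 n -> winds (vc 1) 0 n by rewrite -!vcE.
apply: (@locally_constant (fun s => winds (vc s) 0 n)) => s.
have dotC x y : dot x y = dot y x by rewrite /dot [x.1 * _]mulrC [x.2 * _]mulrC.
have /compact_near_coveringP cI := @segment_compact R 0 1.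
have : \forall s' \near s, `[0, 1]%classic `<=` (fun t => 0 < dot (v (s, t)) (v (s', t))).
  apply: (cI R (nbhs s) (fun s' t => 0 < dot (v (s, t)) (v (s', t))) _) => t _.
  pose w (x : R * R) := dot (v (s, x.1)) (v (x.2, x.1)).
  have cw : continuous w.
    apply: dot_continuous => x.
      apply: (@continuous_comp _ _ _ fst (fun t => v (s, t))); last exact: cvs.
      exact: cvg_fst.
    apply: (@continuous_comp _ _ _ (fun x : R * R => (x.2, x.1)) v); last exact: cv.
    by apply: continuous_pair; [exact: cvg_snd|exact: cvg_fst].
  have w0 : 0 < w (t, s).
    rewrite /w /= /dot; have := v0 s t; move: (v (s, t)) => [a b] /= ab.
    rewrite -!expr2 lt_neqAle addr_ge0 ?sqr_ge0 // andbT eq_sym.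
    rewrite paddr_eq0 ?sqr_ge0 // !sqrf_eq0; apply/negP => /andP[/eqP a0 /eqP b0].
    by apply: ab; rewrite a0 b0.
  have /cvgrPdist_lt/(_ _ w0) := cw (t, s).
  apply: filterS => x; rewrite ltr_norml => /andP[h1 h2] /=.
  by rewrite -[dot _ _]/(w x); lra.
move=> /(@nbhs_ballP R R)[d /= d0 hd]; exists d => // s' ss'; split; apply: step => t t01.
  by rewrite dotC; apply: hd => //=; rewrite in_itv.
by apply: hd => //=; rewrite in_itv.
Qed.

(** By injectivity, [F s (g t) - F s p] is a homotopy of non-zero vectors. *)
Lemma winds_isotopy (F : R -> plane -> plane) g p n :
  continuous (fun x : R * plane => F x.1 x.2) ->
  (forall s, injective (F s)) -> {within `[0, 1], continuous g} -> g 0 = g 1 ->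
  (forall t, 0 <= t <= 1 -> g t <> p) ->
  winds (fun t => F 0 (g t)) (F 0 p) n <-> winds (fun t => F 1 (g t)) (F 1 p) n.
Proof.
move=> cF Fi cg g01 gp.
have ccg := within_clamp cg.
have cl t : 0 <= t <= 1 -> g (clamp01 t) = g t by move=> /clamp01_id ->.
have main (a b : R) : winds (fun t => F a (g t)) (F a p) n ->
    winds (fun t => F b (g t)) (F b p) n.
  move=> /winds_translate h; apply/winds_translate.
  pose sg s := a + s * (b - a).
  pose v (x : R * R) := F (sg x.1) (g (clamp01 x.2)) - F (sg x.1) p.
  have csg : continuous (fun x : R * R => sg x.1).
    move=> x; apply: cvgD; first exact: cvg_cst.
    by apply: cvgM; [exact: cvg_fst|exact: cvg_cst].
  have cv : continuous v.
    move=> x; apply: cvgB.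
      apply: (@continuous_comp _ _ _ (fun x : R * R => (sg x.1, g (clamp01 x.2)))
        (fun x : R * plane => F x.1 x.2)); last exact: cF.
      apply: continuous_pair; first exact: csg.
      apply: (@continuous_comp _ _ _ snd (g \o clamp01)); [exact: cvg_snd|exact: ccg].
    apply: (@continuous_comp _ _ _ (fun x : R * R => (sg x.1, p))
      (fun x : R * plane => F x.1 x.2)); last exact: cF.
    by apply: continuous_pair; [exact: csg|exact: cvg_cst].
  have := @winds_homotopy v n cv.
  have sg0 : sg 0 = a by rewrite /sg mul0r addr0.
  have sg1 : sg 1 = b by rewrite /sg mul1r addrC subrK.
  rewrite /v /= sg0 sg1 => hv.
  apply: (winds_ext (g := fun t => F b (g (clamp01 t)) - F b p)).
    by move=> t /cl ->.
  apply: hv; last by apply: winds_ext h => t /cl ->.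
    move=> s t /eqP; rewrite subr_eq0 => /eqP/Fi; apply: gp; exact: clamp01_in.
  by move=> s; rewrite !cl ?lexx ?ler01 // g01.
by split; exact: main.
Qed.

Definition ellipse (a b : R) (c : plane) (t : R) : plane :=
  (c.1 + a * cos (2 * pi * t), c.2 + b * sin (2 * pi * t)).

Lemma ellipse_continuous a b c : continuous (ellipse a b c).
Proof.
move=> t; have ca : (fun t : R => 2 * pi * t) @ t --> 2 * pi * t.
  by apply: cvgM; [exact: cvg_cst|exact: cvg_id].
apply: (@continuous_pair R R R (fun t => c.1 + a * cos (2 * pi * t))
  (fun t => c.2 + b * sin (2 * pi * t)) t); (apply: cvgD; first exact: cvg_cst);
  (apply: cvgM; first exact: cvg_cst).
  by apply: (@continuous_comp _ _ _ (fun t : R => 2 * pi * t) (@cos R));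
    [exact: ca|exact: continuous_cos].
by apply: (@continuous_comp _ _ _ (fun t : R => 2 * pi * t) (@sin R));
  [exact: ca|exact: continuous_sin].
Qed.

Lemma ellipse_loop a b c : ellipse a b c 0 = ellipse a b c 1.
Proof. by rewrite /ellipse mulr0 mulr1 mulr_natl cos2pi sin2pi cos0 sin0. Qed.

(** Compare the circle with the loop of outward normals of the ellipse, and this
    loop with the ellipse seen from [p]: the latter scalar product is positive by
    convexity. *)
Lemma winds_ellipse_in a b c p : 0 < a -> 0 < b ->
  ((p.1 - c.1) / a) ^+ 2 + ((p.2 - c.2) / b) ^+ 2 < 1 -> winds (ellipse a b c) p 1.
Proof.
move=> a0 b0 hp; apply/winds_translate.
have ce := @ellipse_continuous a b c.
have h1 : winds (ellipse 1 1 0) 0 1.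
  exists (fun=> 1), (fun t => 2 * pi * t); split.
  - apply: continuous_subspaceT => t.
    by apply: cvgM; [exact: cvg_cst|exact: cvg_id].
  - by move=> t _; split.
  - by rewrite mulr0 subr0.
have h2 : winds (ellipse a^-1 b^-1 0) 0 1.
  apply: winds_step h1; try exact: ellipse_continuous; try exact: ellipse_loop.
  move=> t; rewrite /dot /ellipse /= !add0r !mul1r.
  have := cos2Dsin2 (2 * pi * t); set x := cos _; set y := sin _ => xy.
  rewrite mulrCA [y * _]mulrCA -!expr2.
  have [x0|x0] := eqVneq x 0.
    by rewrite x0 expr0n /= mulr0 add0r; rewrite x0 expr0n /= add0r in xy; rewrite xy mulr1 invr_gt0.
  apply: ltr_pwDl; first by rewrite mulr_gt0 ?invr_gt0 // exprn_even_gt0.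
  by rewrite mulr_ge0 ?sqr_ge0 // invr_ge0 ltW.
apply: winds_step h2; try exact: ellipse_continuous; try exact: ellipse_loop.
- by move=> t; apply: cvgB; [exact: ce|exact: cvg_cst].
- by rewrite ellipse_loop.
move=> t; rewrite /dot /ellipse /= !add0r.
have := cos2Dsin2 (2 * pi * t); set x := cos _; set y := sin _ => xy.
move: hp; set u := (p.1 - c.1) / a; set v := (p.2 - c.2) / b => uv.
have -> : a^-1 * x * (c.1 + a * x - p.1) + b^-1 * y * (c.2 + b * y - p.2) =
    (x ^+ 2 + y ^+ 2) - (x * u + y * v).
  by rewrite /u /v; field; rewrite !gt_eqF.
rewrite xy; have := sqr_ge0 (x - u); have := sqr_ge0 (y - v).
by rewrite !sqrrB; lra.
Qed.

(** The ellipse stays on one side of the vertical line through [p]. *)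
Lemma winds_ellipse_out a b c p : 0 < a -> a < `|p.1 - c.1| ->
  winds (ellipse a b c) p 0.
Proof.
move=> a0 hp; apply/winds_translate.
have ce := @ellipse_continuous a b c.
pose e : plane := (c.1 - p.1, 0).
have e0 : e.1 != 0 by rewrite /= -normr_gt0 distrC; exact: lt_trans hp.
have he : winds (fun=> e) 0 0.
  have cst (th : R) : cos th = Num.sg e.1 -> sin th = 0 -> winds (fun=> e) 0 0.
    move=> cth sth; exists (fun=> `|e.1|), (fun=> th); split.
    - by apply: continuous_subspaceT => t; exact: cvg_cst.
    - by move=> t _; rewrite normr_gt0 cth sth mulr0 !add0r mulrC -numEsg.
    - by rewrite subrr mulr0z mulr0.
  have [h|h|h] := ltgtP e.1 0.
  - by apply: (cst pi); rewrite ?cospi ?sinpi // ltr0_sg.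
  - by apply: (cst 0); rewrite ?cos0 ?sin0 // gtr0_sg.
  - by rewrite h eqxx in e0.
apply: winds_step he => //.
- by move=> t; exact: cvg_cst.
- by move=> t; apply: cvgB; [exact: ce|exact: cvg_cst].
- by rewrite ellipse_loop.
move=> t; rewrite /dot /ellipse /= mul0r addr0.
set x := cos _; have : `|x| <= 1 by exact: cos_max.
rewrite ler_norml => /andP[x1 x2].
have h1 : a * x <= a by rewrite ger_pMr.
have h2 : - a <= a * x by have := ler_wpM2l (ltW a0) x1; lra.
have -> : c.1 + a * x - p.1 = (c.1 - p.1) + a * x by ring.
move: hp; have [h|h] := leP p.1 c.1.
  by rewrite ler0_norm ?subr_le0 // => hp; apply: mulr_gt0; lra.
by rewrite gtr0_norm ?subr_gt0 // => hp; rewrite nmulr_rgt0; lra.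
Qed.
End Winding.

(** * Radial extension of circle maps *)

Section Cone.
Variable R : realType.
Local Notation plane := (R * R)%type.
Implicit Types (p q : plane) (F G : R -> R) (k : int).

(** The universal cover of the unit circle. *)
Definition circ (t : R) : plane := (cos (2 * pi * t), sin (2 * pi * t)).

Definition radius p : R := Num.sqrt (p.1 ^+ 2 + p.2 ^+ 2).

Lemma circ1 t : circ (t + 1) = circ t.
Proof.
rewrite /circ mulrDr mulr1 cosD sinD mulr_natl cos2pi sin2pi.
by congr pair; ring.
Qed.

Lemma circ_int t k : circ (t + k%:~R) = circ t.
Proof.
have nat_ (n : nat) s : circ (s + n%:R) = circ s.
  by elim: n s => [|n IH] s; rewrite ?addr0 // -natr1 addrA circ1.
case: k => n; first exact: nat_.
rewrite NegzE intrN; transitivity (circ (t - n.+1%:R + n.+1%:R)).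
  by rewrite nat_.
by rewrite subrK.
Qed.

Lemma circ_eq s t : circ s = circ t -> exists k, s = t + k%:~R.
Proof.
case=> E1 E2; pose d := s - t; pose k := Num.floor d; pose f := d - k%:~R.
have /andP[f0 f1] : 0 <= f < 1.
  by have := ge_floor d; have := lt_succ_floor d; rewrite /f intrD1 -/k; lra.
have pi0 := pi_gt0 R.
have cf : cos (2 * pi * f) = 1.
  have := circ_int f k; rewrite /f subrK /circ => -[<- _].
  rewrite /d mulrBr cosB E1 E2; have := cos2Dsin2 (2 * pi * t); lra.
have f00 : f = 0.
  have [h|h] := leP f 2^-1.
    have : 2 * pi * f = 0.
      apply: cos_inj; rewrite ?in_itv /= ?lexx ?cf ?cos0 ?(ltW pi0) //.
      by rewrite mulr_ge0 ?mulr_ge0 ?(ltW pi0) //=; nra.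
    by move=> /eqP; rewrite !mulf_eq0 gt_eqF // (gt_eqF pi0) /= => /eqP.
  have : 2 * pi * (1 - f) = 0.
    apply: cos_inj; rewrite ?in_itv /= ?lexx ?cos0 ?(ltW pi0) //.
      by rewrite mulr_ge0 ?mulr_ge0 ?(ltW pi0) ?subr_ge0 ?(ltW f1) //=; nra.
    rewrite mulrBr mulr1 cosB mulr_natl cos2pi sin2pi -mulr_natl cf; lra.
  by move=> /eqP; rewrite !mulf_eq0 gt_eqF // (gt_eqF pi0) /= subr_eq0; lra.
by exists k; move: f00; rewrite /f /d; lra.
Qed.

Lemma radius_ge0 p : 0 <= radius p. Proof. exact: sqrtr_ge0. Qed.

Lemma radius_circ (r t : R) : 0 <= r -> radius (r *: circ t) = r.
Proof.
move=> r0; rewrite /radius /= /GRing.scale /= !exprMn -mulrDr cos2Dsin2 mulr1.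
by rewrite sqrtr_sqr ger0_norm.
Qed.

Lemma radius0 p : radius p = 0 -> p = 0.
Proof.
move=> /eqP; rewrite sqrtr_eq0 => h.
have : (p.1 ^+ 2 + p.2 ^+ 2) == 0 by rewrite eq_le h addr_ge0 ?sqr_ge0.
rewrite paddr_eq0 ?sqr_ge0 // !sqrf_eq0 => /andP[/eqP p1 /eqP p2].
by rewrite [p]surjective_pairing p1 p2.
Qed.

Lemma polar_ex p : exists t, p = radius p *: circ t.
Proof.
have := radius_ge0 p; rewrite le_eqVlt => /orP[/eqP/esym/radius0 ->|r0].
  by exists 0; rewrite {1}/radius expr0n /= addr0 sqrtr0 scale0r.
have rn : radius p != 0 by rewrite gt_eqF.
have rr : p.1 ^+ 2 + p.2 ^+ 2 = radius p ^+ 2.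
  by rewrite sqr_sqrtr // addr_ge0 // sqr_ge0.
pose x := p.1 / radius p.
have x2 : x ^+ 2 = 1 - (p.2 / radius p) ^+ 2.
  apply/eqP; rewrite /x -subr_eq0 opprB addrA; apply/eqP.
  transitivity ((p.1 ^+ 2 + p.2 ^+ 2) / radius p ^+ 2 - 1); first by field.
  by rewrite rr mulfV ?subrr // expf_neq0.
have x1 : -1 <= x <= 1.
  rewrite -ler_norml -(@ler_sqr _ `|x|) ?nnegrE //.
  rewrite expr1n real_normK ?num_real // x2 gerBl sqr_ge0 //.
have pi0 : pi != 0 :> R by rewrite gt_eqF // pi_gt0.
have px : p.1 = radius p * x by rewrite mulrC divfK.
have sx : Num.sqrt (1 - x ^+ 2) = `|p.2| / radius p.
  rewrite x2 opprB addrC subrK sqrtr_sqr normrM (@ger0_norm _ (radius p)^-1) //.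
  by rewrite invr_ge0 ltW.
have [p2|p2] := leP 0 p.2.
  exists (acos x / (2 * pi)); rewrite /circ.
  rewrite (_ : 2 * pi * (acos x / (2 * pi)) = acos x); last by rewrite mulrC divfK ?mulf_neq0 ?pnatr_eq0.
  rewrite acosK ?in_itv // sin_acos // sx ger0_norm //.
  rewrite [LHS]surjective_pairing; congr pair; first exact: px.
  by rewrite /GRing.scale /= mulrC divfK.
exists (- acos x / (2 * pi)); rewrite /circ.
rewrite (_ : 2 * pi * (- acos x / (2 * pi)) = - acos x); last by rewrite mulrC divfK ?mulf_neq0 ?pnatr_eq0.
rewrite cosN sinN acosK ?in_itv // sin_acos // sx ltr0_norm //.
rewrite [LHS]surjective_pairing; congr pair; first exact: px.
by rewrite mulNr opprK /GRing.scale /= mulrC divfK.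
Qed.

(** Lifts of orientation preserving homeomorphisms of the circle. *)
Definition circle_lift F : Prop :=
  (forall x y, x < y -> F x < F y) /\ forall x, F (x + 1) = F x + 1.

Lemma lift_int F x k : circle_lift F -> F (x + k%:~R) = F x + k%:~R.
Proof.
move=> [_ F1].
have nat_ (n : nat) y : F (y + n%:R) = F y + n%:R.
  by elim: n => [|n IH]; rewrite ?addr0 // -natr1 !addrA F1 IH.
case: k => n; first exact: nat_.
by rewrite NegzE intrN; apply: (addIr n.+1%:R); rewrite -nat_ !subrK.
Qed.

Definition angle p : R := sval (cid (polar_ex p)).

Lemma angleP p : p = radius p *: circ (angle p).
Proof. exact: svalP (cid (polar_ex p)). Qed.

(** The radial extension of a circle map with lift [F]; the choice of [angle] is
    immaterial by periodicity. *)
Definition cone F p : plane := radius p *: circ (F (angle p)).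

Lemma coneE F (r t : R) : circle_lift F -> 0 <= r ->
  cone F (r *: circ t) = r *: circ (F t).
Proof.
move=> lF r0; rewrite /cone radius_circ //.
have [->|rn] := eqVneq r 0; first by rewrite !scale0r.
have := angleP (r *: circ t); rewrite radius_circ // => E.
have [k ->] : exists k, angle (r *: circ t) = t + k%:~R.
  apply: circ_eq; have := congr1 (fun p => r^-1 *: p) E.
  by rewrite !scalerA mulVf // !scale1r => /esym.
by rewrite lift_int // circ_int.
Qed.

Lemma cone_comp F G p : circle_lift F -> circle_lift G ->
  cone F (cone G p) = cone (F \o G) p.
Proof. by move=> lF lG; rewrite {2}/cone coneE // radius_ge0. Qed.

Lemma cone_id p : cone id p = p.
Proof. by rewrite /cone -angleP. Qed.

Lemma cone_eq F G p : (forall x, exists k, F x = G x + k%:~R) -> cone F p = cone G p.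
Proof. by move=> h; rewrite /cone; have [k ->] := h (angle p); rewrite circ_int. Qed.

Lemma lift_inj F : circle_lift F -> injective F.
Proof.
by move=> [mF _] x y E; have [/mF|/mF|//] := ltgtP x y; rewrite E ltxx.
Qed.

Lemma cone_inj F : circle_lift F -> injective (cone F).
Proof.
move=> lF p q; rewrite [p]angleP [q]angleP !coneE ?radius_ge0 // => E.
have rE : radius p = radius q.
  by have := congr1 radius E; rewrite !radius_circ ?radius_ge0.
move: E; rewrite rE; have [->|rn] := eqVneq (radius q) 0; first by rewrite !scale0r.
move=> E; have /circ_eq[k h] : circ (F (angle p)) = circ (F (angle q)).
  have := congr1 (fun p => (radius q)^-1 *: p) E.
  by rewrite !scalerA mulVf // !scale1r.
have -> : angle p = angle q + k%:~R.
  by apply: (lift_inj lF); rewrite h lift_int.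
by rewrite circ_int.
Qed.

Lemma radius_continuous : continuous radius.
Proof.
move=> p; apply: (@continuous_comp _ _ _ (fun p : plane => p.1 ^+ 2 + p.2 ^+ 2)
  (@Num.sqrt R)); last exact: sqrt_continuous.
by apply: cvgD; rewrite !expr2; apply: cvgM; [exact: cvg_fst|exact: cvg_fst|
  exact: cvg_snd|exact: cvg_snd].
Qed.

Lemma circ_continuous : continuous circ.
Proof.
move=> t; have ca : (fun t : R => 2 * pi * t) @ t --> 2 * pi * t.
  by apply: cvgM; [exact: cvg_cst|exact: cvg_id].
apply: (@continuous_pair R R R (fun t => cos (2 * pi * t))
  (fun t => sin (2 * pi * t)) t).
  by apply: (@continuous_comp _ _ _ (fun t : R => 2 * pi * t) (@cos R));
    [exact: ca|exact: continuous_cos].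
by apply: (@continuous_comp _ _ _ (fun t : R => 2 * pi * t) (@sin R));
  [exact: ca|exact: continuous_sin].
Qed.

Lemma radius_norm p : `|p| <= radius p.
Proof.
have aux (x y : R) : `|x| <= Num.sqrt (x ^+ 2 + y ^+ 2).
  by rewrite -sqrtr_sqr ler_wsqrtr // lerDl sqr_ge0.
by rewrite plane_norm_le /radius aux addrC aux.
Qed.

(** At the origin because the radius is preserved; near any other point because
    the angle can be chosen continuously, by an arc tangent. *)
Lemma cone_continuous (F : R -> R -> R) : (forall s, circle_lift (F s)) ->
  continuous (fun x : R * R => F x.1 x.2) ->
  continuous (fun x : R * plane => cone (F x.1) x.2).
Proof.
move=> lF cF [s0 p0].
have csnd (Z : topologicalType) (f : plane -> Z) (x : R * plane) :
    {for x.2, continuous f} -> {for x, continuous (fun x : R * plane => f x.2)}.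
  by move=> cf; apply: continuous_comp; [exact: cvg_snd|exact: cf].
have [p00|p0n] := eqVneq p0 0.
  apply/cvgrPdist_lt => e e0 /=; rewrite p00.
  have -> : cone (F s0) 0 = 0.
    by rewrite /cone {1}/radius expr0n /= addr0 sqrtr0 scale0r.
  have r0 : radius (0 : plane) = 0 by rewrite /radius expr0n /= addr0 sqrtr0.
  have cr : (fun x : R * plane => radius x.2) @ (s0, 0 : plane) --> radius (0 : plane).
    exact: (csnd _ radius (s0, 0) (@radius_continuous _)).
  move/cvgrPdist_lt: cr => /(_ _ e0); rewrite r0; apply: filterS => x.
  rewrite !sub0r !normrN ger0_norm ?radius_ge0 //; apply: le_lt_trans.
  by apply: le_trans (radius_norm _) _; rewrite radius_circ ?radius_ge0.
pose t0 := angle p0.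
pose a p := dot (circ t0) p; pose b p := cross (circ t0) p.
have ca : continuous a by apply: dot_continuous => x; [exact: cvg_cst|exact: cvg_id].
have cb : continuous b by apply: cross_continuous => x; [exact: cvg_cst|exact: cvg_id].
have ap0 : 0 < a p0.
  have -> : a p0 = radius p0.
    rewrite /a {1}[p0]angleP -/t0 /dot /circ /= /GRing.scale /=.
    rewrite (mulrCA (cos _)) (mulrCA (sin _)) -mulrDr -!expr2 cos2Dsin2.
    by rewrite mulr1.
  rewrite lt_neqAle radius_ge0 andbT eq_sym.
  by apply: contra_neq p0n => /radius0.
pose psi p := t0 + atan (b p / a p) / (2 * pi).
have pi0 : pi != 0 :> R by rewrite gt_eqF // pi_gt0.
have coneP s p : 0 < a p -> cone (F s) p = radius p *: circ (F s (psi p)).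
  move=> ap; have [r r0 [Ea Eb]] := atan_polar (b p) ap.
  have pE : p = r *: circ (psi p).
    rewrite /circ /psi mulrDr (_ : 2 * pi * (_ / (2 * pi)) = atan (b p / a p)); last first.
      by rewrite mulrC divfK ?mulf_neq0 ?pnatr_eq0.
    rewrite cosD sinD [LHS]surjective_pairing /GRing.scale /=.
    have cs := cos2Dsin2 (2 * pi * t0).
    set C := cos (2 * pi * t0) in cs *; set S := sin (2 * pi * t0) in cs *.
    have aE : a p = C * p.1 + S * p.2 by [].
    have bE : b p = C * p.2 - S * p.1 by [].
    congr pair.
      transitivity (C * (r * cos (atan (b p / a p))) - S * (r * sin (atan (b p / a p)))).
        rewrite -Ea -Eb aE bE; transitivity ((C ^+ 2 + S ^+ 2) * p.1); last by ring.
        by rewrite cs mul1r.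
      by rewrite /= /GRing.scale /=; ring.
    transitivity (S * (r * cos (atan (b p / a p))) + C * (r * sin (atan (b p / a p)))).
      rewrite -Ea -Eb aE bE; transitivity ((C ^+ 2 + S ^+ 2) * p.2); last by ring.
      by rewrite cs mul1r.
    by rewrite /= /GRing.scale /=; ring.
  have -> : radius p = r by rewrite {1}pE radius_circ // ltW.
  by rewrite {1}pE coneE // ltW.
have psi_c : {for p0, continuous psi}.
  apply: cvgD; first exact: cvg_cst.
  apply: cvgM; last exact: cvg_cst.
  apply: (@continuous_comp _ _ _ (fun p => b p / a p) (@atan R)); last exact: continuous_atan.
  apply: cvgM; first exact: cb.
  by apply: cvgV; [rewrite gt_eqF|exact: ca].
rewrite /continuous_at /= (coneP _ _ ap0).
have near_pos : \forall x \near (s0, p0), 0 < a x.2.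
  have cax : (fun x : R * plane => a x.2) @ (s0, p0) --> a p0.
    exact: (csnd _ a (s0, p0) (ca _)).
  move/cvgrPdist_lt: cax => /(_ _ ap0); apply: filterS => x.
  by rewrite ltr_norml => /andP[h1 h2]; lra.
have lim_ : (fun x : R * plane => radius x.2 *: circ (F x.1 (psi x.2))) @ (s0, p0) -->
    radius p0 *: circ (F s0 (psi p0)).
  apply: cvgZ.
    exact: (csnd _ radius (s0, p0) (@radius_continuous _)).
  have cpsi : {for (s0, p0), continuous (fun x : R * plane => (x.1, psi x.2))}.
    apply: continuous_pair; first exact: cvg_fst.
    exact: (csnd _ psi (s0, p0) psi_c).
  have cFpsi : {for (s0, p0), continuous (fun x : R * plane => F x.1 (psi x.2))}.
    exact: (@continuous_comp _ _ _ (fun x : R * plane => (x.1, psi x.2))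
      (fun x : R * R => F x.1 x.2) (s0, p0) cpsi (cF _)).
  exact: (@continuous_comp _ _ _ (fun x : R * plane => F x.1 (psi x.2)) circ
    (s0, p0) cFpsi (@circ_continuous _)).
apply: cvg_trans lim_; apply: near_eq_cvg.
by apply: filterS near_pos => x /coneP ->.
Qed.
End Cone.

(** * Moving a Cantor set to the circle *)

Section NormalPosition.
Variable R : realType.
Local Notation plane := (R * R)%type.
Local Notation cantor := cantor_space.
Implicit Types (x y : cantor) (f : cantor -> plane) (c : cantor -> R).

Lemma continuous_fst (T : topologicalType) (u : T -> plane) : continuous u ->
  continuous (fun t => (u t).1).
Proof. by move=> cu t; apply: (@continuous_comp _ _ _ u fst); [exact: cu|exact: cvg_fst]. Qed.

Lemma continuous_snd (T : topologicalType) (u : T -> plane) : continuous u ->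
  continuous (fun t => (u t).2).
Proof. by move=> cu t; apply: (@continuous_comp _ _ _ u snd); [exact: cu|exact: cvg_snd]. Qed.

Lemma on_axis c : continuous c -> continuous (fun x => (c x, 0) : plane).
Proof. by move=> cc x; apply: continuous_pair; [exact: cc|exact: cvg_cst]. Qed.

Lemma line_inv_unif c n : continuous c -> injective c ->
  exists2 d : R, 0 < d & forall x y, `|c x - c y| <= d -> agree n x y.
Proof.
move=> cc ci; have [|d d0 hd] := embed_inv_unif n (on_axis cc).
  by move=> x y [] /ci.
exists d => // x y h; apply: hd; rewrite plane_norm_le /= h subrr normr0.
exact: ltW.
Qed.

Lemma line_unif c (e : R) : continuous c -> 0 < e ->
  exists n, forall x y, agree n x y -> `|c x - c y| <= e.
Proof.
move=> cc e0; have [n hn] := embed_unif (on_axis cc) e0.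
by exists n => x y /hn; rewrite plane_norm_le => /andP[].
Qed.

Lemma line_closed c : continuous c -> closed (range c).
Proof.
move=> cc; apply: compact_closed; first exact: Rhausdorff.
apply: continuous_compact; last exact: cantor_space_compact.
exact: continuous_subspaceT.
Qed.

Lemma line_bound c : continuous c -> exists2 M, 0 < M & forall x, `|c x| < M.
Proof.
move=> cc; have [N hN] := compact_bound (embed_compact (on_axis cc)).
exists (N%:R + 1) => [|x]; first by rewrite ltr_wpDl ?ler0n.
have /hN : range (fun x => (c x, 0) : plane) (c x, 0) by exists x.
by rewrite plane_norm_lt /= => /andP[+ _]; clear; lra.
Qed.

(** Change a single bit, far enough along the sequence. *)
Lemma line_perfect c (e : R) x : continuous c -> injective c -> 0 < e ->
  exists2 y, c y <> c x & `|c x - c y| < e.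
Proof.
move=> cc ci e0; have e2 : 0 < e / 2 by lra.
have [n hn] := line_unif cc e2.
exists (fun k => if k == n then ~~ x n else x k).
  by move/ci/(congr1 (fun z : cantor => z n)); rewrite eqxx; case: (x n).
apply: le_lt_trans (hn _ _ _) _; last lra.
by move=> k kn; rewrite ltn_eqF.
Qed.

(** A coordinate of the Cantor set would be a non-constant locally constant
    function on an interval contained in its image. *)
Lemma line_thin c (a b : R) : continuous c -> injective c -> a < b ->
  exists2 z, a < z < b & ~ range c z.
Proof.
move=> cc ci ab; apply: contrapT => H.
have sub z : a < z < b -> exists x, c x = z.
  move=> h; apply: contrapT => h'; apply: H; exists z => // -[x _ E].
  by apply: h'; exists x.
pose p := a + (b - a) / 3; pose q := a + (b - a) * 2 / 3.
have [|x cx] := sub p; first by rewrite /p; lra.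
have [|y cy] := sub q; first by rewrite /q; lra.
have xy : x <> y by move=> E; move: cx; rewrite E cy /p /q; lra.
have [k xyk] : exists k, x k <> y k.
  by apply: contrapT => h; apply: xy; apply/funext => k; apply: contrapT => h'; apply: h; exists k.
have [d d0 hd] := line_inv_unif k.+1 cc ci.
pose sg (s : R) := p + clamp01 s * (q - p).
pose P (s : R) := forall z, c z = sg s -> z k = x k.
have sgab s : a < sg s < b.
  have /andP[h0 h1] := clamp01_in s; rewrite /sg /p /q.
  by move: (clamp01 s) h0 h1 => t t0 t1; nra.
have csg : continuous sg.
  move=> s; apply: cvgD; first exact: cvg_cst.
  by apply: cvgM; [exact: clamp01_continuous|exact: cvg_cst].
have loc s : exists2 e, 0 < e & forall s', `|s - s'| < e -> P s' <-> P s.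
  have /cvgrPdist_lt/(_ _ d0)/(@nbhs_ballP R R)[e /= e0 he] := csg s.
  exists e => // s' /he; rewrite /= => h.
  have [z1 z1E] := sub _ (sgab s); have [z2 z2E] := sub _ (sgab s').
  have zz : z1 k = z2 k.
    by apply: (hd z1 z2); rewrite ?z1E ?z2E ?ltnSn // ltW.
  split=> hP z Ez.
    have -> : z = z1 by apply: ci; rewrite Ez.
    by rewrite zz; exact: hP.
  have -> : z = z2 by apply: ci; rewrite Ez.
  by rewrite -zz; exact: hP.
have := locally_constant loc; rewrite /P /sg !clamp01_id ?lexx ?ler01 //.
rewrite mul0r addr0 mul1r addrC subrK => h; apply: xyk; symmetry; apply: h => //.
by move=> z; rewrite -cx => /ci ->.
Qed.

(** The ends of the interval exist by thinness, and their distances to the set are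
    positive as it is closed. *)
Lemma line_separate c x y : continuous c -> injective c -> x <> y ->
  exists a b r, [/\ a < c x < b, 0 < r, ~ (a <= c y <= b) &
    forall z, r <= `|a - c z| /\ r <= `|b - c z|].
Proof.
move=> cc ci xy.
have [a [b [ha hb aC bC]]] : exists a b, [/\ a < c x < b, ~ (a <= c y <= b),
    ~ range c a & ~ range c b].
  have cxy : c x != c y by apply/eqP => /ci.
  have [h|h|h] := ltgtP (c x) (c y); last by rewrite h eqxx in cxy.
    have [a /andP[a1 a2] aC] := @line_thin c (c x - 1) (c x) cc ci ltac:(lra).
    have [b /andP[b1 b2] bC] := @line_thin c (c x) (c y) cc ci h.
    by exists a, b; split=> //; lra.
  have [a /andP[a1 a2] aC] := @line_thin c (c y) (c x) cc ci h.
  have [b /andP[b1 b2] bC] := @line_thin c (c x) (c x + 1) cc ci ltac:(lra).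
  by exists a, b; split=> //; lra.
have margin z : ~ range c z -> exists2 r, 0 < r & forall w, r <= `|z - c w|.
  move=> zC; have : nbhs z (~` range c).
    by apply: open_nbhs_nbhs; split=> //; exact/closed_openC/line_closed.
  move=> /(@nbhs_ballP R R)[r r0 hr]; exists r => // w; rewrite leNgt.
  by apply/negP => /(hr (c w)); apply; exists w.
have [r1 r10 h1] := margin _ aC; have [r2 r20 h2] := margin _ bC.
exists a, b, (Num.min r1 r2); split=> //; first by rewrite lt_min r10.
by move=> z; rewrite !ge_min h1 h2 orbT.
Qed.

(** Once the Cantor set projects injectively to the first axis, rescale it so that
    the projection lies between -1 and 1.  The vertical distance to the half circle
    is then a function of the first coordinate, and a Tietze extension of that
    function defines a shear that puts the set on the half circle. *)
Theorem circular_position f : continuous f -> injective f ->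
  exists h h' : plane -> plane, exists c : cantor -> R,
  [/\ [/\ cancel h h', cancel h' h, continuous h & continuous h'],
      continuous c, injective c, forall x, 0 < c x < 2^-1 &
      forall x, h (f x) = circ (c x)].
Proof.
move=> cf fi.
have [h [h' [hK h'K ch ch' hfl]]] := flatten_totally_split (embed_compact cf)
  (embed_totally_split cf fi).
pose X x := (h (f x)).1; pose Y x := (h (f x)).2.
have chf : continuous (h \o f) by move=> x; apply: continuous_comp; [exact: cf|exact: ch].
have cX : continuous X := continuous_fst chf.
have cY : continuous Y := continuous_snd chf.
have iX : injective X.
  by move=> x y E; apply: fi; apply: hfl => //.
have [A A0 hA] := line_bound cX.
have X1 x : -1 < X x / A < 1.
  by rewrite -ltr_norml normrM normfV (gtr0_norm A0) ltr_pdivrMr ?mul1r.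
pose c x := acos (X x / A) / (2 * pi).
have pi0 := pi_gt0 R.
have pin : 2 * pi != 0 :> R by rewrite mulf_neq0 ?gt_eqF.
have cE x : 2 * pi * c x = acos (X x / A) by rewrite mulrC divfK.
have circE x : circ (c x) = (X x / A, Num.sqrt (1 - (X x / A) ^+ 2)).
  have /andP[h1 h2] := X1 x.
  by rewrite /circ cE acosK ?sin_acos ?in_itv /= ?ltW.
have cc : continuous c.
  move=> x; apply: cvgM; last exact: cvg_cst.
  apply: (@continuous_comp _ _ _ (fun x => X x / A) (@acos R)).
    by apply: cvgM; [exact: cX|exact: cvg_cst].
  exact: continuous_acos.
have ci : injective c.
  move=> x y E; have := circE x; rewrite E circE => -[E1 _]; apply: iX.
  by apply/esym/(mulIf _ E1); rewrite invr_neq0 // gt_eqF.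
have c01 x : 0 < c x < 2^-1.
  have /andP[h1 h2] := X1 x; apply/andP; split.
    by rewrite divr_gt0 ?mulr_gt0 // acos_gt0 // ltW.
  rewrite ltr_pdivrMr ?mulr_gt0 // mulrA mulVf ?mul1r //.
  by rewrite acos_ltpi // h1 ltW.
pose psi x := Num.sqrt (1 - (X x / A) ^+ 2) - Y x.
have ccirc : continuous (@circ R \o c).
  by move=> x; apply: continuous_comp; [exact: cc|exact: circ_continuous].
have ccc : continuous (fun x => (circ (c x)).2).
  by move=> x; exact: (continuous_snd ccirc).
have psiE : psi = (fun x => (circ (c x)).2 - Y x).
  by apply/funext => x; rewrite circE.
have cpsi : continuous psi.
  by rewrite psiE => x; apply: cvgB; [exact: ccc|exact: cY].
have [M M0 hM] := line_bound cpsi.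
have /choice[iv ivP] : forall z, exists x, range X z -> X x = z.
  move=> z; have [[x _ <-]|hz] := pselect (range X z); first by exists x.
  by exists point.
have ivX x : iv (X x) = x by apply: iX; apply: ivP; exists x.
have wc : {within range X, continuous (psi \o iv : R -> R^o)}.
  apply/subspace_continuousP => _ [x _ <-]; apply/cvgrPdist_le => e e0.
  have [n hn] := line_unif cpsi e0.
  have [d d0 hd] := line_inv_unif n cX iX.
  suff : \forall z \near X x, range X z -> `|(psi \o iv) (X x) - (psi \o iv) z| <= e by [].
  apply/(@nbhs_ballP R R); exists d => // z /= zd [y _ E]; subst z.
  by rewrite !ivX; apply: hn; apply: hd; exact: ltW.
have [|g [gE cg _]] := continuous_bounded_extension (@pseudometric_normal R R)
    (line_closed cX) M0 wc.
  by move=> _ [x _ <-]; rewrite /= ivX ltW.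
pose k (p : plane) : plane := (p.1 / A, p.2 + g p.1).
pose k' (p : plane) : plane := (p.1 * A, p.2 - g (p.1 * A)).
have An : A != 0 by rewrite gt_eqF.
have kK : cancel k k' by move=> [u v]; rewrite /k /k' /= divfK // addrK.
have k'K : cancel k' k by move=> [u v]; rewrite /k /k' /= mulfK // subrK.
have ck : continuous k.
  move=> p; apply: (@continuous_pair plane R R (fun p => p.1 / A)
    (fun p => p.2 + g p.1) p).
    by apply: cvgM; [exact: cvg_fst|exact: cvg_cst].
  apply: cvgD; first exact: cvg_snd.
  by apply: (@continuous_comp _ _ _ fst g); [exact: cvg_fst|exact: cg].
have ck' : continuous k'.
  move=> p; have cm : {for p, continuous (fun p : plane => p.1 * A)}.
    by apply: cvgM; [exact: cvg_fst|exact: cvg_cst].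
  apply: (@continuous_pair plane R R (fun p => p.1 * A)
    (fun p => p.2 - g (p.1 * A)) p) => //.
  apply: cvgB; first exact: cvg_snd.
  by apply: (@continuous_comp _ _ _ (fun p : plane => p.1 * A) g); [exact: cm|exact: cg].
exists (k \o h), (h' \o k'), c; split=> //.
  split; [exact: can_comp|exact: can_comp| |].
    by move=> p; apply: continuous_comp; [exact: ch|exact: ck].
  by move=> p; apply: continuous_comp; [exact: ck'|exact: ch'].
move=> x; rewrite circE /k /=; congr pair.
rewrite -/(X x) -(gE (X x)); last by rewrite inE; exists x.
by rewrite /= ivX /psi addrC subrK.
Qed.

End NormalPosition.

(** * Loops separating the points of the Cantor set *)

Section Separate.
Variable R : realType.
Local Notation plane := (R * R)%type.
Local Notation cantor := cantor_space.
Implicit Types (x y : cantor) (c : cantor -> R).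

Lemma half_circle (t : R) : 0 < t < 2^-1 ->
  0 < (circ t).2 /\ (circ t).1 ^+ 2 + (circ t).2 ^+ 2 = 1.
Proof.
move=> /andP[t0 t1]; split; last exact: cos2Dsin2.
have pi0 := pi_gt0 R; apply: sin_gt0_pi; apply/andP; split.
  by rewrite !mulr_gt0.
by rewrite mulrAC -ltr_pdivlMr // divff ?gt_eqF // -ltr_pdivlMl // mulr1.
Qed.

Lemma half_circle_inj c : injective c -> (forall x, 0 < c x < 2^-1) ->
  injective (fun x => (circ (c x)).1).
Proof.
move=> ci c01 x y; rewrite /circ /= => E; apply: ci.
have pi0 := pi_gt0 R.
have H z : 2 * pi * c z \in `[0, pi].
  have /andP[h0 h1] := c01 z; rewrite in_itv /=; apply/andP; split.
    by rewrite !mulr_ge0 // ltW.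
  rewrite mulrAC -ler_pdivlMr // divff ?gt_eqF //.
  by rewrite -ler_pdivlMl // mulr1 ltW.
have := cos_inj (H x) (H y) E; apply: mulfI.
by rewrite mulf_neq0 // gt_eqF.
Qed.

(** Take an interval that separates the first coordinates, and the ellipse over it.
    If the ellipse is tall enough, then a point of the circle lies inside as soon
    as its first coordinate is in the interval and away from the ends, which is
    the case for all points of the Cantor set over the interval. *)
Lemma ellipse_separates c x y : continuous c -> injective c ->
  (forall x, 0 < c x < 2^-1) -> x <> y ->
  exists g : R -> plane, [/\ continuous g, g 0 = g 1,
    forall t z, g t <> circ (c z), winds g (circ (c x)) 1 &
    winds g (circ (c y)) 0].
Proof.
move=> cc ci c01 xy; pose X z := (circ (c z)).1; pose Y z := (circ (c z)).2.
have ccirc : continuous (@circ R \o c).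
  by move=> z; apply: continuous_comp; [exact: cc|exact: circ_continuous].
have cX : continuous X := continuous_fst ccirc.
have [a [b [r [/andP[ax xb] r0 yab hr]]]] :=
  line_separate cX (half_circle_inj ci c01) xy.
pose m := (a + b) / 2; pose A := (b - a) / 2.
have A0 : 0 < A by rewrite /A; lra.
(* the inverse of the height: [(1 - rho)^2 + rho^2 < 1] *)
pose rho := Num.min (r / A) 2^-1.
have rho0 : 0 < rho by rewrite lt_min divr_gt0 // invr_gt0 ltr0n.
have rho2 : rho <= 2^-1 by rewrite ge_min lexx orbT.
have rhoA : rho * A <= r.
  by rewrite -ler_pdivlMr // ge_min lexx.
have inside z : a <= X z <= b ->
    ((X z - m) / A) ^+ 2 + ((Y z - 0) / rho^-1) ^+ 2 < 1.
  move=> /andP[z1 z2]; have [h1 h2] := hr z.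
  have [Y0 XY] := half_circle (c01 z); rewrite -/(X z) -/(Y z) in Y0 XY.
  rewrite ler0_norm in h1; last by rewrite subr_le0.
  rewrite ger0_norm in h2; last by rewrite subr_ge0.
  have u1 : `|(X z - m) / A| <= 1 - rho.
    rewrite normrM normfV (gtr0_norm A0) ler_pdivrMr // mulrBl mul1r.
    rewrite ler_norml /m /A in rhoA *; lra.
  have u2 : ((X z - m) / A) ^+ 2 <= (1 - rho) ^+ 2.
    by rewrite -real_normK ?num_real // ler_sqr ?nnegrE //; lra.
  have v2 : ((Y z - 0) / rho^-1) ^+ 2 <= rho ^+ 2.
    rewrite subr0 invrK exprMn -[leRHS]mul1r ler_wpM2r ?sqr_ge0 //.
    by have := sqr_ge0 (X z); lra.
  apply: le_lt_trans (lerD u2 v2) _.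
  have : rho * rho <= rho * 2^-1 by rewrite ler_pM2l.
  by rewrite !expr2; lra.
have outside z : ~ (a <= X z <= b) -> A < `|X z - m|.
  move=> h; have [hz|hz] := leP a (X z).
    have hz' : b < X z by rewrite ltNge; apply/negP => hz'; apply: h; rewrite hz.
    by apply: lt_le_trans (ler_norm _); rewrite /A /m; lra.
  rewrite -normrN; apply: lt_le_trans (ler_norm _); rewrite /A /m; lra.
exists (ellipse A rho^-1 (m, 0)); split.
- exact: ellipse_continuous.
- exact: ellipse_loop.
- move=> t z E.
  have e1 : X z - m = A * cos (2 * pi * t) by rewrite /X -E /=; ring.
  have e2 : Y z - 0 = rho^-1 * sin (2 * pi * t) by rewrite /Y -E /=; ring.
  have [zab|zab] := pselect (a <= X z <= b).
    have := inside z zab; rewrite e1 e2 mulrAC mulfV ?gt_eqF // mul1r.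
    by rewrite [_ * sin _]mulrC mulfK ?invr_neq0 ?gt_eqF // cos2Dsin2 ltxx.
  have := outside z zab; rewrite e1 normrM gtr0_norm // ltNge.
  by rewrite -[leRHS]mulr1 ler_pM2l // cos_max.
- apply: winds_ellipse_in; rewrite ?invr_gt0 //; apply: inside.
  by rewrite ltW //= ltW.
- by apply: winds_ellipse_out => //; apply: outside.
Qed.

End Separate.

(** * Action on the plane *)

Section PlaneAction.
Variable R : realType.
Local Notation plane := (R * R)%type.
Local Notation cantor := cantor_space.

Lemma increasing_continuous (f g : R -> R) : (forall x y, x < y -> f x < f y) ->
  cancel g f -> continuous f.
Proof.
move=> fm gK x; apply/cvgrPdist_lt => e e0.
have lt_refl y z : f y < f z -> y < z.
  move=> h; rewrite ltNge; apply/negP; rewrite le_eqVlt => /orP[/eqP E|/fm].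
    by rewrite E ltxx in h.
  by rewrite ltNge ltW.
have ux : g (f x - e) < x by apply: lt_refl; rewrite gK; lra.
have xv : x < g (f x + e) by apply: lt_refl; rewrite gK; lra.
near=> y; rewrite ltr_norml.
have /fm : g (f x - e) < y by near: y; exact: lt_nbhsr.
have /fm : y < g (f x + e) by near: y; exact: lt_nbhsl.
by rewrite !gK; lra.
Unshelve. all: by end_near. Qed.

(** The straight line isotopy from the identity to [F], constant outside of the
    unit interval. *)
Definition slide (F : R -> R) (s z : R) : R :=
  (1 - clamp01 s) * z + clamp01 s * F z.

Lemma slide_lift F s : circle_lift F -> circle_lift (slide F s).
Proof.
move=> [Fm F1]; have /andP[s0 s1] := clamp01_in s; split=> [x y xy|x]; last first.
  by rewrite /slide F1; ring.
have xFy := Fm _ _ xy; rewrite /slide.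
have [E|sn] := eqVneq (clamp01 s) 1; first by rewrite E subrr !mul0r !mul1r !add0r.
have : 0 < 1 - clamp01 s by rewrite subr_gt0 lt_neqAle sn.
move: (clamp01 s) s0 s1 {sn} => t t0 t1 tp.
by apply: ltr_leD; [rewrite ltr_pM2l|rewrite ler_wpM2l // ltW].
Qed.

Lemma slide_continuous F : continuous F ->
  continuous (fun x : R * R => slide F x.1 x.2).
Proof.
move=> cF x.
have cl : {for x, continuous (fun x : R * R => clamp01 x.1)}.
  apply: (@continuous_comp _ _ _ fst (@clamp01 R)); first exact: cvg_fst.
  exact: clamp01_continuous.
apply: cvgD; apply: cvgM; [|exact: cvg_snd|exact: cl|].
  by apply: cvgB; [exact: cvg_cst|exact: cl].
by apply: (@continuous_comp _ _ _ snd F); [exact: cvg_snd|exact: cF].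
Qed.

Definition plane_isotopy (G : R -> plane -> plane) : Prop :=
  continuous (fun x : R * plane => G x.1 x.2) /\ forall s, injective (G s).

(** The action on the line, coned and carried to [K].  The last clause says that a
    loop is not freely homotopic, in the complement of [K], to its image under a
    non-integer [x].  In the coordinates where [K] lies on the circle, the loop is
    an ellipse winding around a point [p] of [K] but not around the other point
    that [x] moves to [p]; hence its image does not wind around [p]. *)
Theorem cantor_plane_action (K : set plane) : is_cantor_set K ->
  exists P : R -> plane -> plane,
  [/\ (forall x y p, P (x + y) p = P x (P y p)) /\ (forall p, P 1 p = p),
      forall x, continuous (P x),
      forall x p, K p -> K (P x p),
      forall x, exists G, [/\ plane_isotopy G, G 0 =1 id & G 1 =1 P x] &
      forall x, (forall k : int, x <> k%:~R) ->
        exists p (g : R -> plane),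
        [/\ K p, continuous g, g 0 = g 1, forall t, ~ K (g t) &
         forall v : R * R -> plane, continuous v -> (forall z, ~ K (v z)) ->
           (forall s, v (s, 0) = v (s, 1)) -> (forall t, v (0, t) = g t) ->
           ~ (forall t, v (1, t) = P x (g t))]].
Proof.
move=> /cantor_setP[f [cf fi fK]].
have [h [h' [c [[hK h'K ch ch'] cc ci c01 hf]]]] := circular_position cf fi.
have C01 z : range c z -> 0 < z < 1.
  by move=> [x _ <-]; have := c01 x; lra.
have [||||F [FD F1 Fm FC Ffaith]] := @circle_action R (range c) C01.
- exact: line_closed.
- by exists (c point); exists point.
- move=> _ e [x _ <-] e0; have [y yx xy] := line_perfect x cc ci e0.
  by exists (c y) => //; exists y.
- by move=> a b; exact: line_thin.
have F0 z : F 0 z = z.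
  have lF : circle_lift (F 0).
    by split=> [x y|x]; [exact: Fm|rewrite -!F1 -!FD addrC].
  by apply: (lift_inj lF); rewrite -FD addr0.
have lF x : circle_lift (F x).
  by split=> [y z|y]; [exact: Fm|rewrite -!F1 -!FD addrC].
have cF x : continuous (F x).
  apply: (@increasing_continuous (F x) (F (- x))); first exact: Fm.
  by move=> z; rewrite -FD subrr F0.
pose P x p := h' (cone (F x) (h p)).
have hP x p : h (P x p) = cone (F x) (h p) by rewrite /P h'K.
have ccone x : continuous (cone (F x)).
  have lx : forall s : R, circle_lift ((fun=> F x) s) by move=> _; exact: lF.
  have cx : continuous (fun z : R * R => F x z.2).
    by move=> z; apply: (@continuous_comp _ _ _ snd (F x)); [exact: cvg_snd|exact: cF].
  have H := @cone_continuous R (fun=> F x) lx cx.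
  move=> p; apply: (@continuous_comp _ _ _ (fun p : plane => (0 : R, p))
    (fun z : R * plane => cone (F x) z.2) p); last exact: H.
  by apply: continuous_pair; [exact: cvg_cst|exact: cvg_id].
have PD x y p : P (x + y) p = P x (P y p).
  rewrite /P h'K cone_comp //; congr h'; apply: cone_eq => z.
  by exists 0; rewrite addr0 FD.
have cP x : continuous (P x).
  move=> p; apply: (@continuous_comp _ _ _ (cone (F x) \o h) h'); last exact: ch'.
  by apply: continuous_comp; [exact: ch|exact: ccone].
have circ1 t : circ t = 1 *: circ t :> plane by rewrite scale1r.
have cone_circ x t : cone (F x) (circ t) = circ (F x t).
  by rewrite circ1 coneE // -circ1.
exists P; split=> //.
- split=> // p; rewrite /P -[RHS]hK; congr h'.
  rewrite -[RHS]cone_id; apply: cone_eq => z; by exists 1; rewrite F1.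
- move=> x p; rewrite -fK => -[y _ <-].
  have [k [z _ zE]] := FC x (c y) (ex_intro2 _ _ y I erefl).
  exists z => //; apply: (can_inj hK); rewrite hP !hf cone_circ.
  by rewrite -(circ_int _ k) zE subrK.
- move=> x; exists (fun s p => h' (cone (slide (F x) s) (h p))); split.
  + split=> [z|s p q]; last first.
      by move=> /(can_inj h'K)/(cone_inj (slide_lift s (lF x)))/(can_inj hK).
    have H := cone_continuous (fun s => slide_lift s (lF x))
      (slide_continuous (cF x)).
    apply: (@continuous_comp _ _ _ (fun z : R * plane =>
      cone (slide (F x) z.1) (h z.2)) h'); last exact: ch'.
    apply: (@continuous_comp _ _ _ (fun z : R * plane => (z.1, h z.2))
      (fun z : R * plane => cone (slide (F x) z.1) z.2)); last exact: H.
    apply: continuous_pair; first exact: cvg_fst.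
    by apply: (@continuous_comp _ _ _ snd h); [exact: cvg_snd|exact: ch].
  + move=> p; rewrite -[RHS]hK; congr h'; rewrite -[RHS]cone_id; apply: cone_eq => z.
    by exists 0; rewrite /slide clamp01_id ?lexx ?ler01 // addr0; ring.
  + move=> p; congr h'; apply: cone_eq => z.
    by exists 0; rewrite /slide clamp01_id ?lexx ?ler01 // addr0; ring.
move=> x xn.
(* a point of the Cantor set that is moved on the circle by the inverse *)
have [y yn] : exists y, forall k : int, F (- x) (c y) <> c y + k%:~R.
  apply: contrapT => H; have [_ [y _ <-]|k E] := Ffaith (- x).
    apply: contrapT => H'; apply: H; exists y => k E.
    by apply: H'; exists k.
  by apply: (xn (- k)); rewrite intrN -E opprK.
have [k [z _ zE]] := FC (- x) (c y) (ex_intro2 _ _ y I erefl).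
have yz : y <> z by move=> E; apply: (yn k); move: zE; rewrite -E; lra.
have [g [cg g01 gK wy wz]] := ellipse_separates cc ci c01 yz.
exists (f y), (h' \o g); split.
- by rewrite -fK; exists y.
- by move=> t; apply: continuous_comp; [exact: cg|exact: ch'].
- by rewrite /= g01.
- by move=> t; rewrite -fK => -[w _ /(congr1 h)]; rewrite /= h'K hf => /esym/gK.
move=> v cv vK vloop v0 v1.
have wy1 : winds (fun t => cone (F x) (g t)) (circ (c y)) 1.
  apply/winds_translate; pose w z := h (v z) - circ (c y).
  apply: (winds_ext (g := fun t => w (1, t))).
    by move=> t _; rewrite /w v1 hP /= h'K.
  apply: winds_homotopy.
  - by move=> p; apply: cvgB; [apply: continuous_comp; [exact: cv|exact: ch]|exact: cvg_cst].
  - move=> s t; rewrite /w -hf => /eqP; rewrite subr_eq0 => /eqP/(can_inj hK) E.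
    by apply: (vK (s, t)); rewrite E -fK; exists y.
  - by move=> s; rewrite /w vloop.
  apply: (winds_ext (g := fun t => g t - circ (c y))).
    by move=> t _; rewrite /w v0 /= h'K.
  by move/winds_translate: wy.
have wy0 : winds (fun t => cone (F x) (g t)) (circ (c y)) 0.
  have E : circ (c y) = cone (F x) (circ (c z)).
    rewrite cone_circ zE.
    by rewrite -intrN lift_int // circ_int -FD subrr F0.
  have H := cone_continuous (fun s => slide_lift s (lF x)) (slide_continuous (cF x)).
  have := @winds_isotopy R (fun s => cone (slide (F x) s)) g (circ (c z)) 0 H.
  have e0 p : cone (slide (F x) 0) p = p.
    rewrite -[RHS]cone_id; apply: cone_eq => u; exists 0.
    by rewrite /slide clamp01_id ?lexx ?ler01 // addr0; ring.
  have e1 p : cone (slide (F x) 1) p = cone (F x) p.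
    apply: cone_eq => u; exists 0.
    by rewrite /slide clamp01_id ?lexx ?ler01 // addr0; ring.
  rewrite e0 e1 -E => H2; apply: (winds_ext (g := fun t => cone (slide (F x) 1) (g t))) => //.
  apply H2 => //.
  + by move=> s; exact: cone_inj (slide_lift s (lF x)).
  + exact: continuous_subspaceT.
  + by apply: winds_ext wz => t _; rewrite e0.
by have := winds_unique wy1 wy0.
Qed.

End PlaneAction.

(** * Mapping classes of the complement *)

Section ComplementHomeo.
Variables (R : realType) (K : set (R * R)).
Local Notation plane := (R * R)%type.
Local Notation U := (~` K : set plane).

Definition to_complement (p : plane) (pK : ~ K p) : U := exist _ p (mem_set (pK : U p)).

Definition restrict_complement (f : plane -> plane) (fU : forall p, ~ K p -> ~ K (f p)) (u : U) : U :=
  to_complement (fU _ (set_valP u)).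

Lemma continuous_to_complement (T : topologicalType) (u : T -> U) :
  continuous (fun t => set_val (u t) : plane) -> continuous u.
Proof. by move=> cu; apply: (@continuous_comp_initial _ _ _ (set_val : U -> plane)). Qed.

Lemma set_val_continuous : continuous (set_val : U -> plane).
Proof. exact: initial_continuous. Qed.

Lemma restrict_continuous f (fU : forall p, ~ K p -> ~ K (f p)) :
  continuous f -> continuous (restrict_complement fU).
Proof.
move=> cf; apply: continuous_to_complement => u.
by apply: (@continuous_comp _ _ _ (set_val : U -> plane) f);
  [exact: set_val_continuous|exact: cf].
Qed.

Lemma restrict_cancel f f' (fU : forall p, ~ K p -> ~ K (f p))
    (f'U : forall p, ~ K p -> ~ K (f' p)) :
  cancel f f' -> cancel (restrict_complement fU) (restrict_complement f'U).
Proof. by move=> fK u; apply: val_inj; exact: fK. Qed.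

Definition restrict_homeo (f f' : plane -> plane) fU f'U (fK : cancel f f')
    (f'K : cancel f' f) (cf : continuous f) (cf' : continuous f') : Homeo U :=
  @Homeomorphism U U (@restrict_complement f fU) (@restrict_complement f' f'U)
    (restrict_cancel fU f'U fK) (restrict_cancel f'U fU f'K)
    (restrict_continuous (fU := fU) cf) (restrict_continuous (fU := f'U) cf').

(** Winding numbers are constant along an isotopy of the plane, so the condition
    holds globally. *)
Lemma isotopy_orientation_preserving (f : Homeo U) (G : R -> plane -> plane) :
  plane_isotopy G -> G 0 =1 id -> (forall u, set_val (f u) = G 1 (set_val u)) ->
  is_orientation_preserving f.
Proof.
move=> [cG Gi] G0 G1; apply/asboolP => u; exists setT; first exact: filterT.
move=> g cg g01 gu n.
have := @winds_isotopy R G (fun t => set_val (g t)) (set_val u) n cG Gi.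
have -> : (fun t => G 0 (set_val (g t))) = (fun t => set_val (g t)).
  by apply/funext => t; rewrite G0.
have -> : (fun t => G 1 (set_val (g t))) = (fun t => set_val (f (g t))).
  by apply/funext => t; rewrite G1.
rewrite G0 -G1; apply.
- by apply: within_continuous_comp cg => x _; exact: set_val_continuous.
- by rewrite g01.
- by move=> t /gu[_ ne] /val_inj.
Qed.

End ComplementHomeo.

Section CircleGroup.
Variable R : realType.

Lemma circle_pi_eq (a b : R) : (\pi_(circle_group R) a = \pi_(circle_group R) b)%qT
  <-> exists k : int, a = b + k%:~R.
Proof.
split=> [/eqP|[k ->]].
  rewrite -Quotient.idealrBE => /intrP[k E]; exists k.
  by rewrite -E addrC subrK.
apply/eqP; rewrite -Quotient.idealrBE addrC addKr; exact: intr_int.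
Qed.

Lemma circle_reprD (x y : circle_group R) :
  exists k : int, repr (x + y) = repr x + repr y + k%:~R.
Proof.
by apply/circle_pi_eq; rewrite reprK raddfD /= !reprK.
Qed.

End CircleGroup.

Theorem theorem5p2 (R : realType) (K : set (R * R)) (hK : is_cantor_set K) :
  exists phi : circle_group R -> mapping_class_group (~` K),
    (forall x y : circle_group R, phi (x + y) = (phi x * phi y)%g) /\
    injective phi.
Proof.
have [P [[PD P1] cP PK PI Pf]] := cantor_plane_action hK.
have P0 p : P 0 p = p by rewrite -[in LHS](P1 p) -PD add0r P1.
have PZ x (k : int) p : P (x + k%:~R) p = P x p.
  have nat_ y (n : nat) : P (y + n%:R) p = P y p.
    by elim: n => [|n IH]; rewrite ?addr0 // -natr1 addrA PD P1.
  case: k => n; first exact: nat_.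
  by rewrite NegzE intrN -[LHS](nat_ _ n.+1) subrK.
have PV x : cancel (P x) (P (- x)) by move=> p; rewrite -PD addNr P0.
have PV' x : cancel (P (- x)) (P x) by move=> p; rewrite -PD subrr P0.
have PU x p : ~ K p -> ~ K (P x p).
  by move=> pK /(PK (- x)); rewrite PV.
pose psi x : Homeo (~` K) :=
  restrict_homeo (PU x) (PU (- x)) (PV x) (PV' x) (cP x) (cP (- x)).
have psiP x : is_orientation_preserving (psi x).
  have [G [Giso G0 G1]] := PI x.
  by apply: isotopy_orientation_preserving Giso G0 _ => u; rewrite G1.
pose Psi x : HomeoPlus (~` K) := MkHomeoPlus (psiP x).
exists (fun x => \pi_(mapping_class_group (~` K)) (Psi (repr x)))%qT; split.
  move=> x y; rewrite -[RHS]mcg_piM; congr (\pi_(_) _)%qT.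
  apply: val_inj; apply: homeomorphismP => u; apply: val_inj => /=.
  by have [k ->] := circle_reprD x y; rewrite PZ PD.
move=> x y /eqP/mcg_eqP[H [H0 H1 cH]].
rewrite -[x]reprK -[y]reprK; apply/circle_pi_eq.
move: (repr x) (repr y) H0 H1 => a b H0 H1.
apply: contrapT => ab.
have [k E|p [g [Kp cg g01 gK noH]]] := Pf (b - a).
  by apply: ab; exists (- k); rewrite intrN -E; ring.
(* Apply the isotopy from [P a] to [P b] to the loop moved by [P (- a)]: this
   deforms the loop to its image under [P (b - a)]. *)
pose gU t := to_complement (gK t).
pose v (z : R * R) := set_val (H (clamp01 z.1) (psi (- a) (gU z.2))).
have cgU : continuous gU by apply: continuous_to_complement.
have gU01 : gU 0 = gU 1 by exact: val_inj.
apply: (noH v).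
- move=> z.
  have cH' : continuous (fun z : R * ~` K => H (clamp01 z.1) z.2).
    apply/continuous_subspace_setT.
    apply: (@within_continuous_comp_homo _ _ _ setT
      [set p : R * ~` K | 0 <= p.1 <= 1] (fun z => (clamp01 z.1, z.2))
      (fun z => H z.1 z.2)) cH.
      by move=> w _; exact: clamp01_in.
    apply: continuous_subspaceT.
    by apply: continuous_reparametrization; exact: clamp01_continuous.
  apply: (@continuous_comp _ _ _ (fun z : R * R => H (clamp01 z.1) (psi (- a) (gU z.2)))
    (set_val : ~` K -> R * R)); last exact: set_val_continuous.
  apply: (@continuous_comp _ _ _ (fun z : R * R => (z.1, psi (- a) (gU z.2)))
    (fun z : R * ~` K => H (clamp01 z.1) z.2)); last exact: cH'.
  apply: continuous_pair; first exact: cvg_fst.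
  apply: (@continuous_comp _ _ _ snd (psi (- a) \o gU)); first exact: cvg_snd.
  by apply: continuous_comp; [exact: cgU|exact: homeo_fun_continuous].
- by move=> z; exact: (set_valP (H (clamp01 z.1) (psi (- a) (gU z.2)))).
- by move=> s; rewrite /v /= gU01.
- move=> t; rewrite /v clamp01_id ?lexx ?ler01 // H0; exact: PV'.
- move=> t; rewrite /v clamp01_id ?lexx ?ler01 // H1; exact: (esym (PD b (- a) (g t))).
Qed.
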